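(* Let $f$ and $g$ be transcendental entire functions of bounded type with $f\circ g=g\circ f$. Then $\overline{I(f)}\cup\overline{I(g)}\subset\overline{I(f\circ g)}$.
   Context: For an entire function $f$, $f^n$ denotes the $n$-th iterate and $I(f)=\{z\in\mathbb{C}: f^n(z)\to\infty\}$ is its escaping set; $\overline{E}$ denotes closure in $\mathbb{C}$. A transcendental entire function is of bounded type if the set of its critical values and finite asymptotic values, together with their finite limit points, is bounded. *)

(* Defs.v *)
From Stdlib Require Import Reals List.
Open Scope R_scope.

Definition CC : Type := (R * R)%type.
Definition Cre (z : CC) : R := fst z.
Definition Cim (z : CC) : R := snd z.
Definition C0 : CC := (0, 0).
Definition C1 : CC := (1, 0).
Definition Cadd (z w : CC) : CC := (fst z + fst w, snd z + snd w).
Definition Copp (z : CC) : CC := (- fst z, - snd z).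
Definition Csub (z w : CC) : CC := Cadd z (Copp w).
Definition Cmul (z w : CC) : CC :=
  (fst z * fst w - snd z * snd w, fst z * snd w + snd z * fst w).
Definition Cnorm (z : CC) : R := sqrt (fst z * fst z + snd z * snd z).
Fixpoint Cpow (z : CC) (n : nat) : CC :=
  match n with O => C1 | S m => Cmul z (Cpow z m) end.

Definition has_cderiv (f : CC -> CC) (z l : CC) : Prop :=
  forall eps : R, eps > 0 -> exists delta : R, delta > 0 /\
    forall h : CC, 0 < Cnorm h < delta ->
      Cnorm (Csub (Csub (f (Cadd z h)) (f z)) (Cmul l h)) <= eps * Cnorm h.

Definition entire (f : CC -> CC) : Prop := forall z, exists l, has_cderiv f z l.

Fixpoint poly_eval (a : list CC) (z : CC) : CC :=
  match a with nil => C0 | cons c a' => Cadd c (Cmul z (poly_eval a' z)) end.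
Definition is_polynomial (f : CC -> CC) : Prop :=
  exists a : list CC, forall z, f z = poly_eval a z.

Definition transcendental_entire (f : CC -> CC) : Prop :=
  entire f /\ ~ is_polynomial f.

Definition critical_value (f : CC -> CC) (w : CC) : Prop :=
  exists z, has_cderiv f z C0 /\ f z = w.

Definition asymptotic_value (f : CC -> CC) (a : CC) : Prop :=
  exists gamma : R -> CC,
    (forall t, 0 <= t -> forall eps, eps > 0 -> exists delta, delta > 0 /\
       forall s, 0 <= s -> Rabs (s - t) < delta ->
         Cnorm (Csub (gamma s) (gamma t)) < eps) /\
    (forall M, exists T, forall t, t >= T -> Cnorm (gamma t) > M) /\
    (forall eps, eps > 0 -> exists T, forall t, t >= T ->
       Cnorm (Csub (f (gamma t)) a) < eps).

Definition Cclosure (E : CC -> Prop) (w : CC) : Prop :=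
  forall eps, eps > 0 -> exists z, E z /\ Cnorm (Csub z w) < eps.

Definition limit_point (E : CC -> Prop) (w : CC) : Prop :=
  forall eps, eps > 0 -> exists z, E z /\ z <> w /\ Cnorm (Csub z w) < eps.

Definition sing_values (f : CC -> CC) (w : CC) : Prop :=
  critical_value f w \/ asymptotic_value f w.

Definition bounded_type (f : CC -> CC) : Prop :=
  transcendental_entire f /\
  exists M, forall w, (sing_values f w \/ limit_point (sing_values f) w) ->
    Cnorm w <= M.

Definition iterate (f : CC -> CC) (n : nat) (z : CC) : CC := Nat.iter n f z.

Definition escaping (f : CC -> CC) (z : CC) : Prop :=
  forall M, exists N, forall n, (n >= N)%nat -> Cnorm (iterate f n z) > M.

(* Main.v *)
Require Import Defs.
From Stdlib Require Import Reals ZArith List Lra Lia Psatz Classical ClassicalEpsilon.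
From Coquelicot Require Import Coquelicot.
Open Scope R_scope.

(** Let [h = f o g]. Since [f] commutes with [h], a point whose image under [f] escapes under [h]
    escapes itself, so it suffices to find points of [I(h)] near the forward orbit of a point of
    [I(f)].

    Over a half-plane [Re > ell] whose exponential contains no singular value of [f], every solution
    of [f (e^s) = e^w] extends to an inverse branch [Phi] with [f (e^Phi) = exp]. The image of [Phi]
    contains no disc of radius 4: otherwise it would contain two points differing by [2 pi i], so
    [Phi (u + 2 pi i k) = Phi u + 2 pi i]; then [Re Phi] grows linearly and Cauchy's formula on the
    loop [e^Phi] kills all high Taylor coefficients of [f], making it a polynomial. Bloch's theorem
    now gives the Eremenko-Lyubich estimate [|Phi'| <= 512 / (Re - ell)].

    Far to the right these branches contract. Composing branches of [g] and [f] alternately produces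
    a point of [I(h)] within distance 8, in logarithmic coordinates, of any given point far to the
    right. Pulling these points back along the orbit of a point of [I(f)] by branches of [f]
    shows that some iterate of it lies in the closure of [I(h)], and the open mapping theorem brings
    this back to the point itself. *)

(** * Complex differentiation *)

(** The branches live on half-planes because convexity makes lifts single-valued. All that is known
    about the image of [Phi] is that it contains no large disc, so the derivative bound rests on
    Bloch's theorem, which holds for every holomorphic function, injective or not. The bound decays
    like the reciprocal of the distance to [Re = ell], hence a contraction by 1/4 far to the right.
    The orbit of a point of I(f) may escape arbitrarily slowly and says nothing about its behaviour
    under [g]. Points of I(h) are therefore built afresh near each orbit point: a transcendental
    function reaches modulus r^2 on every large circle of radius r, so some point with the same real
    part, at vertical distance at most pi in logarithmic coordinates, has an image with at least
    twice that real part. Repeating this for [g] and [f] in turn gives an orbit with errors, which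
    the contracting inverse branches correct to a true one. The total error is bounded however far
    out the orbit point lies, while pulling back along j steps of the orbit of [f] divides it by at
    least 2^j; hence the accumulation. *)

Ltac cring := match goal with |- @eq _ ?a ?b => change (@eq C a b) end; ring.

Lemma Rlt_Rmin_inv (x a b : R) : x < Rmin a b -> x < a /\ x < b.
Proof. intros H. split; eapply Rlt_le_trans; [exact H|apply Rmin_l|exact H|apply Rmin_r]. Qed.

Lemma Cmod_sym (a b : C) : Cmod (a - b) = Cmod (b - a).
Proof. rewrite <- Cmod_opp. f_equal. ring. Qed.

Lemma Cmod_diag (a : C) : Cmod (a - a) = 0.
Proof. replace (a - a)%C with (RtoC 0) by ring. apply Cmod_0. Qed.

Lemma Cmod_tri (a b c : C) : Cmod (a - c) <= Cmod (a - b) + Cmod (b - c).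
Proof. replace (a - c)%C with ((a - b) + (b - c))%C by ring. apply Cmod_triangle. Qed.

Lemma Cmod_minus_le (a b : C) : Cmod (a - b) <= Cmod a + Cmod b.
Proof. rewrite <- (Cmod_opp b). apply Cmod_triangle. Qed.

Lemma Cmod_rev (a b : C) : Cmod a - Cmod b <= Cmod (a - b).
Proof.
  assert (H := Cmod_triangle (a - b) b).
  replace (a - b + b)%C with a in H by ring. lra.
Qed.

Lemma Re_le_Cmod (z : C) : Rabs (Re z) <= Cmod z.
Proof. eapply Rle_trans; [apply Rmax_l | apply Rmax_Cmod]. Qed.

Lemma Im_le_Cmod (z : C) : Rabs (Im z) <= Cmod z.
Proof. eapply Rle_trans; [apply Rmax_r | apply Rmax_Cmod]. Qed.

Lemma Cmod_le_Re_Im (z : C) : Cmod z <= Rabs (Re z) + Rabs (Im z).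
Proof.
  destruct z as [x y]. unfold Re, Im; simpl.
  replace (x, y) with (RtoC x + Ci * RtoC y)%C.
  2: { unfold RtoC, Ci, Cplus, Cmult; simpl. f_equal; ring. }
  eapply Rle_trans; [apply Cmod_triangle|].
  rewrite Cmod_mult, Cmod_Ci, !Cmod_R. lra.
Qed.

Lemma Cmod_sqr (z : C) : Cmod z * Cmod z = Re z * Re z + Im z * Im z.
Proof. unfold Cmod, Re, Im. rewrite sqrt_sqrt; nra. Qed.

Lemma Cmod_scal (r : R) (z : C) : Cmod (RtoC r * z) = Rabs r * Cmod z.
Proof. now rewrite Cmod_mult, Cmod_R. Qed.

Lemma continuous_C_iff {U : UniformSpace} (f : U -> C) (x : U) :
  continuous f x <-> continuous (fun u => Re (f u)) x /\ continuous (fun u => Im (f u)) x.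
Proof.
  split.
  - intros H. split; apply (continuous_comp f); auto.
    + apply continuous_fst.
    + apply continuous_snd.
  - intros [H1 H2].
    apply continuous_ext with (fun u => (Re (f u), Im (f u))).
    { intros u. symmetry. apply surjective_pairing. }
    apply filterlim_locally. intros e.
    apply filter_and; [exact (proj1 (filterlim_locally _ _) H1 e) | exact (proj1 (filterlim_locally _ _) H2 e)].
Qed.

Section ContinuousAlgebra.
Context {U : UniformSpace}.
Implicit Types (f g : U -> C) (x : U).

Lemma continuous_Cplus f g x :
  continuous f x -> continuous g x -> continuous (fun u => (f u + g u)%C) x.
Proof.
  rewrite !continuous_C_iff. intros [H1 H2] [H3 H4]. split; simpl.
  - now apply (continuous_plus (fun u => Re (f u)) (fun u => Re (g u))).
  - now apply (continuous_plus (fun u => Im (f u)) (fun u => Im (g u))).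
Qed.

Lemma continuous_Copp f x : continuous f x -> continuous (fun u => (- f u)%C) x.
Proof.
  rewrite !continuous_C_iff. intros [H1 H2]. split; simpl.
  - now apply (continuous_opp (fun u => Re (f u))).
  - now apply (continuous_opp (fun u => Im (f u))).
Qed.

Lemma continuous_Cminus f g x :
  continuous f x -> continuous g x -> continuous (fun u => (f u - g u)%C) x.
Proof. intros. apply continuous_Cplus; auto. now apply continuous_Copp. Qed.

Lemma continuous_Cmult f g x :
  continuous f x -> continuous g x -> continuous (fun u => (f u * g u)%C) x.
Proof.
  rewrite !continuous_C_iff. intros [H1 H2] [H3 H4].
  split; unfold Re, Im, Cmult in *; simpl.
  - apply (continuous_minus (fun u => fst (f u) * fst (g u)) (fun u => snd (f u) * snd (g u)));
      apply (continuous_mult (K := R_AbsRing)); assumption.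
  - apply (continuous_plus (fun u => fst (f u) * snd (g u)) (fun u => snd (f u) * fst (g u)));
      apply (continuous_mult (K := R_AbsRing)); assumption.
Qed.

Lemma continuous_RtoC (f : U -> R) x : continuous f x -> continuous (fun u => RtoC (f u)) x.
Proof.
  intros H. apply continuous_C_iff. split; simpl; auto.
  apply continuous_const.
Qed.

Lemma continuous_Re f x : continuous f x -> continuous (fun u => Re (f u)) x.
Proof. rewrite continuous_C_iff. tauto. Qed.
Lemma continuous_Im f x : continuous f x -> continuous (fun u => Im (f u)) x.
Proof. rewrite continuous_C_iff. tauto. Qed.

Lemma continuous_sum_sqr f x :
  continuous f x -> continuous (fun u => fst (f u) ^ 2 + snd (f u) ^ 2) x.
Proof.
  intros H. apply continuous_ext with (fun u => Re (f u) * Re (f u) + Im (f u) * Im (f u)).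
  { intros u. unfold Re, Im. simpl. now rewrite !Rmult_1_r. }
  apply (continuous_plus (fun u => Re (f u) * Re (f u)) (fun u => Im (f u) * Im (f u))).
  - apply (continuous_mult (K := R_AbsRing) (fun u => Re (f u)) (fun u => Re (f u))); now apply continuous_Re.
  - apply (continuous_mult (K := R_AbsRing) (fun u => Im (f u)) (fun u => Im (f u))); now apply continuous_Im.
Qed.

Lemma continuous_Cmod f x : continuous f x -> continuous (fun u => Cmod (f u)) x.
Proof.
  intros H. apply (continuous_comp (fun u => fst (f u) ^ 2 + snd (f u) ^ 2) sqrt).
  - now apply continuous_sum_sqr.
  - apply continuity_pt_filterlim, continuity_pt_sqrt. nra.
Qed.

Lemma continuous_Cinv f x :
  continuous f x -> f x <> 0 -> continuous (fun u => (/ f u)%C) x.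
Proof.
  intros H Hn.
  assert (Hs : (fst (f x) ^ 2 + snd (f x) ^ 2) <> 0).
  { intros E. apply Hn. destruct (f x) as [a b]; simpl in E.
    assert (a = 0) by nra. assert (b = 0) by nra. subst. reflexivity. }
  assert (Hd : continuous (fun u => / (fst (f u) ^ 2 + snd (f u) ^ 2)) x).
  { apply (continuous_comp (fun u => fst (f u) ^ 2 + snd (f u) ^ 2) Rinv); [now apply continuous_sum_sqr|].
    now apply continuous_Rinv. }
  apply continuous_C_iff; split; unfold Cinv, Rdiv; simpl.
  - apply (continuous_mult (K := R_AbsRing) (fun u => fst (f u))); auto. now apply (continuous_Re f).
  - apply (continuous_mult (K := R_AbsRing) (fun u => - snd (f u))); auto.
    apply (continuous_opp (fun u => snd (f u))). now apply (continuous_Im f).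
Qed.

Lemma continuous_Cdiv f g x :
  continuous f x -> continuous g x -> g x <> RtoC 0 -> continuous (fun u => (f u / g u)%C) x.
Proof. intros. apply continuous_Cmult; auto. now apply continuous_Cinv. Qed.

Lemma continuous_Cpow f x n : continuous f x -> continuous (fun u => (f u ^ n)%C) x.
Proof.
  intros H. induction n; simpl; [apply continuous_const|]. now apply continuous_Cmult.
Qed.
End ContinuousAlgebra.

Lemma C_ball_Cmod (x y : C) (e : R) : Cmod (y - x) < e -> ball x e y.
Proof.
  intros H. split.
  - change (Rabs (Re (y - x)) < e). eapply Rle_lt_trans; [apply Re_le_Cmod | exact H].
  - change (Rabs (Im (y - x)) < e). eapply Rle_lt_trans; [apply Im_le_Cmod | exact H].
Qed.

(** The uniform structure of [C] is that of the product [R * R]: its balls are squares, hence the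
    factor 2. *)
Lemma Cmod_C_ball (x y : C) (e : R) : ball x e y -> Cmod (y - x) < 2 * e.
Proof.
  intros [H1 H2]. change (Rabs (Re (y - x)) < e) in H1. change (Rabs (Im (y - x)) < e) in H2.
  eapply Rle_lt_trans; [apply Cmod_le_Re_Im|]. lra.
Qed.

Lemma continuous_C_eps (f : C -> C) (z : C) :
  continuous f z <->
  forall e, 0 < e -> exists d, 0 < d /\ forall w, Cmod (w - z) < d -> Cmod (f w - f z) < e.
Proof.
  split.
  - intros H e He.
    assert (He2 : 0 < e / 2) by lra.
    destruct (proj1 (filterlim_locally _ _) H (mkposreal _ He2)) as [d Hd].
    exists d. split; [apply cond_pos|]. intros w Hw.
    replace e with (2 * (e / 2)) by field. apply Cmod_C_ball. apply Hd.
    now apply C_ball_Cmod.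
  - intros H. apply filterlim_locally. intros [e He].
    destruct (H e He) as [d [Hd1 Hd2]].
    assert (Hd3 : 0 < d / 2) by lra.
    exists (mkposreal _ Hd3). intros w Hw. apply C_ball_Cmod. apply Hd2.
    replace d with (2 * (d / 2)) by field. now apply Cmod_C_ball.
Qed.

Lemma continuous_RC_eps (f : R -> C) (t : R) :
  continuous f t <->
  forall e, 0 < e -> exists d, 0 < d /\ forall s, Rabs (s - t) < d -> Cmod (f s - f t) < e.
Proof.
  split.
  - intros H e He.
    assert (He2 : 0 < e / 2) by lra.
    destruct (proj1 (filterlim_locally _ _) H (mkposreal _ He2)) as [d Hd].
    exists d. split; [apply cond_pos|]. intros w Hw.
    replace e with (2 * (e / 2)) by field. apply Cmod_C_ball. apply Hd. exact Hw.
  - intros H. apply filterlim_locally. intros [e He].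
    destruct (H e He) as [d [Hd1 Hd2]].
    exists (mkposreal _ Hd1). intros w Hw. apply C_ball_Cmod. apply Hd2. exact Hw.
Qed.

Lemma continuous_C_ext_loc (f g : C -> C) (z : C) (r : R) :
  0 < r -> (forall w, Cmod (w - z) < r -> f w = g w) -> continuous f z -> continuous g z.
Proof.
  intros Hr E. rewrite !continuous_C_eps. intros H e He.
  destruct (H e He) as [d [Hd1 Hd2]]. exists (Rmin d r). split; [now apply Rmin_pos|].
  intros w Hw. rewrite <- !E.
  - apply Hd2. eapply Rlt_le_trans; [exact Hw | apply Rmin_l].
  - now rewrite Cmod_diag.
  - eapply Rlt_le_trans; [exact Hw | apply Rmin_r].
Qed.

(** Caratheodory's form of the derivative, in which the chain rule and the differentiability of lifts
    are one-line computations. *)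
Definition cder (f : C -> C) (z l : C) : Prop :=
  exists phi : C -> C, continuous phi z /\ phi z = l /\
    forall w, (f w - f z)%C = (phi w * (w - z))%C.

Lemma cder_eps (f : C -> C) (z l : C) :
  cder f z l <->
  forall e, 0 < e -> exists d, 0 < d /\ forall w, Cmod (w - z) < d ->
    Cmod (f w - f z - l * (w - z)) <= e * Cmod (w - z).
Proof.
  split.
  - intros [phi [Hc [Hl E]]] e He.
    destruct (proj1 (continuous_C_eps _ _) Hc e He) as [d [Hd1 Hd2]].
    exists d. split; auto. intros w Hw.
    rewrite E, <- Hl.
    replace (phi w * (w - z) - phi z * (w - z))%C with ((phi w - phi z) * (w - z))%C by ring.
    rewrite Cmod_mult. apply Rmult_le_compat_r; [apply Cmod_ge_0|]. left. auto.
  - intros H.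
    exists (fun w => if Ceq_dec w z then l else ((f w - f z) / (w - z))%C).
    split; [|split].
    + apply continuous_C_eps. intros e He.
      assert (He2 : 0 < e / 2) by lra.
      destruct (H _ He2) as [d [Hd1 Hd2]]. exists d. split; auto.
      intros w Hw. destruct (Ceq_dec z z) as [_|n]; [|now contradict n].
      destruct (Ceq_dec w z) as [->|n].
      * now rewrite Cmod_diag.
      * assert (Hn : (w - z)%C <> 0) by now apply Cminus_eq_contra.
        replace ((f w - f z) / (w - z) - l)%C with ((f w - f z - l * (w - z)) / (w - z))%C
          by (field; auto).
        rewrite Cmod_div by auto. apply Cmod_gt_0 in Hn.
        apply Rle_lt_trans with (e / 2); [|lra].
        apply Rle_div_l; auto.
    + destruct (Ceq_dec z z) as [_|n]; [reflexivity|now contradict n].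
    + intros w. destruct (Ceq_dec w z) as [->|n]; [ring|].
      field. now apply Cminus_eq_contra.
Qed.

Lemma cder_ext_loc (f g : C -> C) (z l : C) (r : R) :
  0 < r -> (forall w, Cmod (w - z) < r -> f w = g w) -> cder f z l -> cder g z l.
Proof.
  intros Hr E. rewrite !cder_eps. intros H e He.
  destruct (H e He) as [d [Hd1 Hd2]]. exists (Rmin d r). split; [now apply Rmin_pos|].
  intros w Hw. rewrite <- !E.
  - apply Hd2. eapply Rlt_le_trans; [exact Hw | apply Rmin_l].
  - now rewrite Cmod_diag.
  - eapply Rlt_le_trans; [exact Hw | apply Rmin_r].
Qed.

Lemma cder_continuous (f : C -> C) (z l : C) : cder f z l -> continuous f z.
Proof.
  intros [phi [Hc [Hl E]]].
  apply continuous_ext with (fun w => (f z + phi w * (w - z))%C).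
  { intros w. rewrite <- E. cring. }
  apply continuous_Cplus; [apply continuous_const|].
  apply continuous_Cmult; auto. apply continuous_Cminus; [apply continuous_id|apply continuous_const].
Qed.

Lemma cder_unique (f : C -> C) (z l l' : C) : cder f z l -> cder f z l' -> l = l'.
Proof.
  rewrite !cder_eps. intros H H'. apply NNPP. intros Hn.
  apply Cminus_eq_contra, Cmod_gt_0 in Hn.
  set (e := Cmod (l - l')) in *.
  destruct (H (e / 4)) as [d [Hd1 Hd2]]; [lra|].
  destruct (H' (e / 4)) as [d' [Hd1' Hd2']]; [lra|].
  set (r := Rmin d d' / 2).
  assert (Hr : 0 < Rmin d d') by now apply Rmin_pos.
  assert (A := Rmin_l d d'). assert (B := Rmin_r d d').
  assert (Hm : Cmod (z + RtoC r - z) = r).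
  { replace (z + RtoC r - z)%C with (RtoC r) by ring. rewrite Cmod_R, Rabs_pos_eq; unfold r; lra. }
  specialize (Hd2 (z + RtoC r)%C). specialize (Hd2' (z + RtoC r)%C).
  rewrite Hm in *. 
  assert (K1 := Hd2 ltac:(unfold r; lra)). assert (K2 := Hd2' ltac:(unfold r; lra)).
  assert (K : Cmod ((l - l') * RtoC r) <= e / 4 * r + e / 4 * r).
  { replace ((l - l') * RtoC r)%C with
      ((f (z + RtoC r) - f z - l' * (z + RtoC r - z)) - (f (z + RtoC r) - f z - l * (z + RtoC r - z)))%C by ring.
    eapply Rle_trans; [apply Cmod_minus_le|]. lra. }
  rewrite Cmod_mult, Cmod_R in K. fold e in K.
  rewrite Rabs_pos_eq in K by (unfold r; lra). unfold r in K. nra.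
Qed.

Lemma cder_const (c z : C) : cder (fun _ => c) z 0.
Proof. exists (fun _ => RtoC 0). split; [apply continuous_const|]. split; [reflexivity|]. intros w; ring. Qed.

Lemma cder_id (z : C) : cder (fun w => w) z 1.
Proof. exists (fun _ => RtoC 1). split; [apply continuous_const|]. split; [reflexivity|]. intros w; ring. Qed.

Lemma cder_plus f g z l m : cder f z l -> cder g z m -> cder (fun w => (f w + g w)%C) z (l + m).
Proof.
  intros [p [Hp [El Ef]]] [q [Hq [Em Eg]]]. exists (fun w => (p w + q w)%C).
  split; [now apply continuous_Cplus|]. split; [now subst|].
  intros w. replace (f w + g w - (f z + g z))%C with ((f w - f z) + (g w - g z))%C by ring.
  rewrite Ef, Eg. ring.
Qed.

Lemma cder_mult f g z l m :
  cder f z l -> cder g z m -> cder (fun w => (f w * g w)%C) z (l * g z + f z * m).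
Proof.
  intros Hf Hg. assert (Hcg := cder_continuous _ _ _ Hg).
  destruct Hf as [p [Hp [El Ef]]], Hg as [q [Hq [Em Eg]]].
  exists (fun w => (p w * g w + f z * q w)%C).
  split; [|split].
  - apply continuous_Cplus; apply continuous_Cmult; auto. apply continuous_const.
  - now subst.
  - intros w. replace (f w * g w - f z * g z)%C with ((f w - f z) * g w + f z * (g w - g z))%C by ring.
    rewrite Ef, Eg. ring.
Qed.

Lemma cder_comp f g z l m :
  cder f (g z) l -> cder g z m -> cder (fun w => f (g w)) z (l * m).
Proof.
  intros Hf Hg. assert (Hcg := cder_continuous _ _ _ Hg).
  destruct Hf as [p [Hp [El Ef]]], Hg as [q [Hq [Em Eg]]].
  exists (fun w => (p (g w) * q w)%C).
  split; [|split].
  - apply continuous_Cmult; auto. now apply (continuous_comp g p).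
  - now subst.
  - intros w. rewrite Ef, Eg. ring.
Qed.

Lemma cder_eq f z l l' : cder f z l -> l = l' -> cder f z l'.
Proof. now intros H <-. Qed.

Lemma cder_scal c f z l : cder f z l -> cder (fun w => (c * f w)%C) z (c * l).
Proof.
  intros H. eapply cder_eq; [apply (cder_mult (fun _ => c)); [apply cder_const|exact H]|]. ring.
Qed.

Lemma cder_opp f z l : cder f z l -> cder (fun w => (- f w)%C) z (- l).
Proof.
  intros [p [Hp [El Ef]]]. exists (fun w => (- p w)%C). split; [now apply continuous_Copp|].
  split; [now subst|]. intros w. replace (- f w - - f z)%C with (- (f w - f z))%C by ring.
  rewrite Ef. ring.
Qed.

Lemma cder_minus f g z l m : cder f z l -> cder g z m -> cder (fun w => (f w - g w)%C) z (l - m).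
Proof. intros. apply cder_plus; auto. now apply cder_opp. Qed.

Lemma cder_inv_id z : z <> RtoC 0 -> cder (fun w => (/ w)%C) z (- / (z * z)).
Proof.
  intros Hz.
  (* Caratheodory's identity is demanded at every [w], also at 0, where [/ w] is a convention. The
     function is first replaced at 0 by its tangent line at [z], which changes nothing near [z]. *)
  apply cder_ext_loc with (fun w => if Ceq_dec w 0 then (/ z + - / (z * z) * (w - z))%C else (/ w)%C) (Cmod z).
  - now apply Cmod_gt_0.
  - intros w Hw. destruct (Ceq_dec w 0) as [->|n]; auto.
    exfalso. replace (0 - z)%C with (- z)%C in Hw by ring. rewrite Cmod_opp in Hw. lra.
  - exists (fun w => if Ceq_dec w 0 then (- / (z * z))%C else (- / (w * z))%C). split; [|split].
    + apply continuous_C_ext_loc with (fun w => (- / (w * z))%C) (Cmod z).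
      * now apply Cmod_gt_0.
      * intros w Hw. destruct (Ceq_dec w 0) as [->|n]; auto.
        exfalso. replace (0 - z)%C with (- z)%C in Hw by ring. rewrite Cmod_opp in Hw. lra.
      * apply continuous_Copp, continuous_Cinv; [|now apply Cmult_neq_0].
        apply continuous_Cmult; [apply continuous_id|apply continuous_const].
    + destruct (Ceq_dec z 0); auto.
    + intros w. destruct (Ceq_dec w 0) as [->|n]; destruct (Ceq_dec z 0) as [e|_]; try contradiction.
      * field. auto.
      * field. auto.
Qed.

Lemma cder_inv f z l : cder f z l -> f z <> RtoC 0 -> cder (fun w => (/ f w)%C) z (- l / (f z * f z)).
Proof.
  intros H Hn. eapply cder_eq; [apply (cder_comp (fun w => (/ w)%C) f); [now apply cder_inv_id|exact H]|].
  field. auto.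
Qed.

(** Divide the two Caratheodory factorisations: [E w - E z] is [p (psi w) * (psi w - psi z)], and
    continuity of [psi] keeps [p (psi w)] away from 0 near [z]. Lifts are obtained as continuous
    maps; this makes them holomorphic. *)
Lemma cder_lift (P E psi : C -> C) (z l m : C) (r : R) :
  0 < r -> (forall w, Cmod (w - z) < r -> P (psi w) = E w) -> continuous psi z ->
  cder P (psi z) l -> l <> RtoC 0 -> cder E z m -> cder psi z (m / l).
Proof.
  intros Hr HE Hc [p [Hp [El EP]]] Hl [q [Hq [Em EE]]].
  assert (Hpc : continuous (fun w => p (psi w)) z) by now apply (continuous_comp psi p).
  assert (Hl0 := proj1 (Cmod_gt_0 _) Hl).
  destruct (proj1 (continuous_C_eps _ _) Hpc (Cmod l)) as [d [Hd1 Hd2]]; auto.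
  set (r' := Rmin d r). assert (Hr' : 0 < r') by now apply Rmin_pos.
  assert (Hnz : forall w, Cmod (w - z) < r' -> p (psi w) <> RtoC 0).
  { intros w Hw E0. assert (K := Hd2 w ltac:(eapply Rlt_le_trans; [exact Hw | apply Rmin_l])).
    rewrite E0, El in K. replace (0 - l)%C with (- l)%C in K by ring. rewrite Cmod_opp in K. lra. }
  apply cder_eps. intros e He.
  assert (Hcq : continuous (fun w => (q w / p (psi w))%C) z).
  { apply continuous_Cdiv; auto. now rewrite El. }
  destruct (proj1 (continuous_C_eps _ _) Hcq e He) as [d' [Hd1' Hd2']].
  exists (Rmin d' r'). split; [now apply Rmin_pos|]. intros w Hw.
  assert (Hw1 : Cmod (w - z) < d') by (eapply Rlt_le_trans; [exact Hw | apply Rmin_l]).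
  assert (Hw2 : Cmod (w - z) < r') by (eapply Rlt_le_trans; [exact Hw | apply Rmin_r]).
  assert (Hw3 : Cmod (w - z) < r) by (eapply Rlt_le_trans; [exact Hw2 | apply Rmin_r]).
  assert (Hz3 : Cmod (z - z) < r).
  { now rewrite Cmod_diag. }
  assert (K := EP (psi w)). rewrite (HE w Hw3), (HE z Hz3), EE in K.
  assert (K2 : (psi w - psi z)%C = (q w / p (psi w) * (w - z))%C).
  { transitivity ((p (psi w) * (psi w - psi z)) / p (psi w))%C; [field; now apply Hnz|].
    rewrite <- K. field. now apply Hnz. }
  rewrite K2. specialize (Hd2' w Hw1). rewrite Em, El in Hd2'.
  replace (q w / p (psi w) * (w - z) - m / l * (w - z))%C with ((q w / p (psi w) - m / l) * (w - z))%C by (unfold Cdiv; ring).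
  rewrite Cmod_mult. apply Rmult_le_compat_r; [apply Cmod_ge_0|]. now left.
Qed.

(** * Differentiable curves in the plane *)

Definition rder (g : R -> C) (t : R) (v : C) : Prop :=
  exists phi : R -> C, continuous phi t /\ phi t = v /\
    forall s, (g s - g t)%C = (phi s * RtoC (s - t))%C.

Lemma rder_affine (a b : C) (t : R) : rder (fun s => (a + RtoC s * b)%C) t b.
Proof.
  exists (fun _ => b). split; [apply continuous_const|]. split; auto.
  intros s. rewrite RtoC_minus. ring.
Qed.

Lemma rder_continuous g t v : rder g t v -> continuous g t.
Proof.
  intros [q [Hq [Em Eg]]].
  apply continuous_ext with (fun s => (g t + q s * RtoC (s - t))%C).
  { intros s. rewrite <- Eg. cring. }
  apply continuous_Cplus; [apply continuous_const|]. apply continuous_Cmult; auto.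
  apply continuous_RtoC. apply (continuous_minus (fun s : R => s)); [apply continuous_id|apply continuous_const].
Qed.

Lemma rder_comp f g t l v : cder f (g t) l -> rder g t v -> rder (fun s => f (g s)) t (l * v).
Proof.
  intros [p [Hp [El Ef]]] Hg. assert (Hcg := rder_continuous _ _ _ Hg).
  destruct Hg as [q [Hq [Em Eg]]].
  exists (fun s => (p (g s) * q s)%C). split; [|split].
  - apply continuous_Cmult; auto. now apply (continuous_comp g p).
  - now subst.
  - intros s. rewrite Ef, Eg. ring.
Qed.

Lemma rder_scal c g t v : rder g t v -> rder (fun s => (c * g s)%C) t (c * v).
Proof.
  intros [q [Hq [Em Eg]]]. exists (fun s => (c * q s)%C). split; [|split].
  - apply continuous_Cmult; auto. apply continuous_const.
  - now subst.
  - intros s. replace (c * g s - c * g t)%C with (c * (g s - g t))%C by ring. rewrite Eg. ring.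
Qed.

Lemma is_derive_caratheodory (g p : R -> R) (t : R) :
  continuous p t -> (forall s, g s - g t = p s * (s - t)) -> is_derive g t (p t).
Proof.
  intros Hp E. apply is_derive_Reals. intros e He.
  destruct (proj1 (filterlim_locally _ _) Hp (mkposreal e He)) as [d Hd].
  exists d. intros h Hh Hd'. rewrite E.
  replace (p (t + h) * (t + h - t) / h) with (p (t + h)) by (field; auto).
  apply Hd. change (Rabs (t + h - t) < d). now replace (t + h - t) with h by ring.
Qed.

Lemma rder_Re g t v : rder g t v -> is_derive (fun s => Re (g s)) t (Re v).
Proof.
  intros [q [Hq [<- Eg]]]. apply (is_derive_caratheodory _ (fun s => Re (q s))).
  - now apply continuous_Re.
  - intros s. assert (K := f_equal Re (Eg s)).
    unfold Re, Cmult, Cminus, Cplus, Copp, RtoC in *; simpl in *. lra.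
Qed.

Lemma rder_Im g t v : rder g t v -> is_derive (fun s => Im (g s)) t (Im v).
Proof.
  intros [q [Hq [<- Eg]]]. apply (is_derive_caratheodory _ (fun s => Im (q s))).
  - now apply continuous_Im.
  - intros s. assert (K := f_equal Im (Eg s)).
    unfold Im, Cmult, Cminus, Cplus, Copp, RtoC in *; simpl in *. lra.
Qed.

(** * Integrals of complex-valued functions of a real variable *)

Definition CInt (f : R -> C) (a b : R) : C :=
  (RInt (fun t => Re (f t)) a b, RInt (fun t => Im (f t)) a b).

Lemma ex_RInt_Re (f : R -> C) a b : (forall t, continuous f t) -> ex_RInt (fun t => Re (f t)) a b.
Proof. intros H. apply (ex_RInt_continuous (V := R_CompleteNormedModule)). intros. now apply continuous_Re. Qed.

Lemma ex_RInt_Im (f : R -> C) a b : (forall t, continuous f t) -> ex_RInt (fun t => Im (f t)) a b.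
Proof. intros H. apply (ex_RInt_continuous (V := R_CompleteNormedModule)). intros. now apply continuous_Im. Qed.

#[local] Hint Resolve ex_RInt_Re ex_RInt_Im : core.

Lemma CInt_ext (f g : R -> C) a b : (forall t, f t = g t) -> CInt f a b = CInt g a b.
Proof. intros H. unfold CInt. f_equal; apply RInt_ext; intros; now rewrite H. Qed.

Lemma CInt_plus (f g : R -> C) a b :
  (forall t, continuous f t) -> (forall t, continuous g t) ->
  CInt (fun t => (f t + g t)%C) a b = (CInt f a b + CInt g a b)%C.
Proof.
  intros Hf Hg. unfold CInt, Cplus; simpl. f_equal.
  - apply (RInt_plus (V := R_CompleteNormedModule) (fun t => Re (f t)) (fun t => Re (g t))); auto.
  - apply (RInt_plus (V := R_CompleteNormedModule) (fun t => Im (f t)) (fun t => Im (g t))); auto.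
Qed.

Lemma CInt_scal (c : C) (f : R -> C) a b :
  (forall t, continuous f t) -> CInt (fun t => (c * f t)%C) a b = (c * CInt f a b)%C.
Proof.
  intros Hf. destruct c as [c1 c2]. unfold CInt, Cmult; simpl.
  assert (S : forall (k : R) (h : R -> R), ex_RInt h a b ->
    is_RInt (fun t => k * h t) a b (k * RInt h a b)).
  { intros k h Hh. apply (is_RInt_scal (V := R_NormedModule) h a b k).
    now apply (RInt_correct (V := R_CompleteNormedModule)). }
  f_equal; apply is_RInt_unique.
  - apply (is_RInt_minus (V := R_NormedModule) (fun t => c1 * Re (f t)) (fun t => c2 * Im (f t))); apply S; auto.
  - apply (is_RInt_plus (V := R_NormedModule) (fun t => c1 * Im (f t)) (fun t => c2 * Re (f t))); apply S; auto.
Qed.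

Lemma CInt_minus (f g : R -> C) a b :
  (forall t, continuous f t) -> (forall t, continuous g t) ->
  CInt (fun t => (f t - g t)%C) a b = (CInt f a b - CInt g a b)%C.
Proof.
  intros Hf Hg. unfold CInt, Cminus, Cplus, Copp; simpl. f_equal.
  - apply (RInt_minus (V := R_CompleteNormedModule) (fun t => Re (f t)) (fun t => Re (g t))); auto.
  - apply (RInt_minus (V := R_CompleteNormedModule) (fun t => Im (f t)) (fun t => Im (g t))); auto.
Qed.

Lemma CInt_const (c : C) a b : CInt (fun _ => c) a b = (RtoC (b - a) * c)%C.
Proof.
  unfold CInt. rewrite !RInt_const. unfold scal, RtoC, Cmult; simpl. unfold mult; simpl.
  unfold Re, Im. f_equal; ring.
Qed.

Lemma CInt_Chasles (f : R -> C) a b c :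
  (forall t, continuous f t) -> (CInt f a b + CInt f b c)%C = CInt f a c.
Proof.
  intros Hf. unfold CInt, Cplus; simpl. f_equal.
  - apply (RInt_Chasles (V := R_CompleteNormedModule) (fun t => Re (f t))); auto.
  - apply (RInt_Chasles (V := R_CompleteNormedModule) (fun t => Im (f t))); auto.
Qed.

Lemma CInt_comp_lin (f : R -> C) u v a b : (forall t, continuous f t) ->
  CInt (fun t => (RtoC u * f (u * t + v)%R)%C) a b = CInt f (u * a + v) (u * b + v).
Proof.
  intros Hf. unfold CInt. f_equal.
  - rewrite <- (RInt_comp_lin (V := R_CompleteNormedModule) (fun t => Re (f t))); auto.
    apply RInt_ext. intros t _. unfold Re, Cmult, RtoC, scal; simpl. unfold mult; simpl. ring.
  - rewrite <- (RInt_comp_lin (V := R_CompleteNormedModule) (fun t => Im (f t))); auto.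
    apply RInt_ext. intros t _. unfold Im, Cmult, RtoC, scal; simpl. unfold mult; simpl. ring.
Qed.

Lemma Cmod_conj (z : C) : Cmod (Cconj z) = Cmod z.
Proof. unfold Cmod, Cconj; simpl. f_equal. ring. Qed.

(** Multiplying by the conjugate of the integral [I] gives the real number |I|^2, which the real
    inequality bounds by |I| times the integral of [g]; then |I| cancels. *)
Lemma CInt_norm_RInt (f : R -> C) (g : R -> R) a b : a <= b -> (forall t, continuous f t) ->
  ex_RInt g a b -> (forall t, a <= t <= b -> Cmod (f t) <= g t) -> Cmod (CInt f a b) <= RInt g a b.
Proof.
  intros Hab Hf Eg HM. set (I := CInt f a b).
  assert (HI := Cmod_ge_0 I).
  assert (Hcc : forall t, continuous (fun t => (Cconj I * f t)%C) t).
  { intros t. apply continuous_Cmult; auto. apply continuous_const. }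
  assert (Hc := CInt_scal (Cconj I) f a b Hf).
  assert (HR : RInt (fun t => Re (Cconj I * f t)) a b = Cmod I * Cmod I).
  { transitivity (Re (CInt (fun t => (Cconj I * f t)%C) a b)); [reflexivity|].
    rewrite Hc. fold I. rewrite Cmod_sqr. unfold Cconj, Cmult, Re, Im; simpl. ring. }
  assert (Es : ex_RInt (fun t => Cmod I * g t) a b).
  { apply (ex_RInt_scal (V := R_NormedModule) g). exact Eg. }
  assert (K : RInt (fun t => Re (Cconj I * f t)) a b <= RInt (fun t => Cmod I * g t) a b).
  { apply RInt_le; [exact Hab|apply (ex_RInt_Re _ a b Hcc)|exact Es|].
    intros t Ht. eapply Rle_trans; [apply Rle_abs|].
    eapply Rle_trans; [apply Re_le_Cmod|]. rewrite Cmod_mult, Cmod_conj.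
    apply Rmult_le_compat_l; auto. apply HM. lra. }
  rewrite HR in K.
  replace (RInt (fun t => Cmod I * g t) a b) with (Cmod I * RInt g a b) in K
    by (symmetry; apply (RInt_scal (V := R_CompleteNormedModule) g); exact Eg).
  destruct (Req_dec (Cmod I) 0) as [E|E].
  - rewrite E. apply RInt_ge_0; auto. intros t Ht. eapply Rle_trans; [apply Cmod_ge_0|apply HM; lra].
  - nra.
Qed.

Lemma CInt_norm (f : R -> C) a b M : a <= b -> (forall t, continuous f t) ->
  (forall t, a <= t <= b -> Cmod (f t) <= M) -> Cmod (CInt f a b) <= (b - a) * M.
Proof.
  intros Hab Hf HM. rewrite <- (RInt_const a b M : RInt (fun _ => M) a b = (b - a) * M).
  apply CInt_norm_RInt; auto. apply ex_RInt_const.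
Qed.

Lemma CInt_FTC (F f : R -> C) a b :
  (forall t, rder F t (f t)) -> (forall t, continuous f t) -> CInt f a b = (F b - F a)%C.
Proof.
  intros HF Hf. unfold CInt, Cminus, Cplus, Copp; simpl. f_equal; apply is_RInt_unique.
  - apply (is_RInt_derive (V := R_CompleteNormedModule) (fun t => Re (F t)) (fun t => Re (f t))).
    + intros. now apply rder_Re.
    + intros. now apply continuous_Re.
  - apply (is_RInt_derive (V := R_CompleteNormedModule) (fun t => Im (F t)) (fun t => Im (f t))).
    + intros. now apply rder_Im.
    + intros. now apply continuous_Im.
Qed.

Lemma CInt_swap (f : R -> C) a b : (forall t, continuous f t) -> CInt f b a = (- CInt f a b)%C.
Proof.
  intros Hf. assert (K := CInt_Chasles f a b a Hf).
  assert (K0 : CInt f a a = RtoC 0).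
  { unfold CInt. now rewrite !RInt_point. }
  rewrite K0 in K. replace (- CInt f a b)%C with (0 - CInt f a b)%C by ring. rewrite <- K. ring.
Qed.

Lemma continuity_pt_of_continuous (f : R -> R) t : continuous f t -> continuity_pt f t.
Proof. intros H. now apply continuity_pt_filterlim. Qed.

(** The real mean value theorem, applied to the component of [g] in the direction of the chord
    [D]. *)
Lemma curve_mean_value (g v : R -> C) (M : R) :
  (forall t, 0 <= t <= 1 -> rder g t (v t)) -> (forall t, 0 <= t <= 1 -> Cmod (v t) <= M) ->
  Cmod (g 1 - g 0) <= M.
Proof.
  intros Hg HM. set (D := (g 1 - g 0)%C).
  assert (HD := Cmod_ge_0 D).
  destruct (Req_dec (Cmod D) 0) as [E|E].
  { rewrite E. eapply Rle_trans; [apply Cmod_ge_0|apply (HM 0); lra]. }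
  destruct (MVT_gen (fun t => Re (Cconj D * g t)) 0 1 (fun t => Re (Cconj D * v t))) as [c [Hc Ec]].
  - intros t Ht. rewrite Rmin_left, Rmax_right in Ht by lra.
    apply rder_Re, rder_scal, Hg. lra.
  - intros t Ht. rewrite Rmin_left, Rmax_right in Ht by lra.
    apply continuity_pt_of_continuous, continuous_Re.
    apply rder_continuous with (Cconj D * v t)%C. apply rder_scal, Hg. lra.
  - rewrite Rmin_left, Rmax_right in Hc by lra.
    replace (Re (Cconj D * g 1) - Re (Cconj D * g 0)) with (Cmod D * Cmod D) in Ec.
    2: { rewrite Cmod_sqr. unfold D, Cconj, Cmult, Cminus, Cplus, Copp, Re, Im; simpl. ring. }
    assert (K : Re (Cconj D * v c) <= Cmod D * M).
    { eapply Rle_trans; [apply Rle_abs|]. eapply Rle_trans; [apply Re_le_Cmod|]. rewrite Cmod_mult.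
      rewrite Cmod_conj. apply Rmult_le_compat_l; auto. }
    nra.
Qed.

Lemma mean_value_segment (f f' : C -> C) (a b : C) (M : R) :
  (forall t, 0 <= t <= 1 -> cder f (a + RtoC t * (b - a)) (f' (a + RtoC t * (b - a)))%C) ->
  (forall t, 0 <= t <= 1 -> Cmod (f' (a + RtoC t * (b - a))%C) <= M) ->
  Cmod (f b - f a) <= M * Cmod (b - a).
Proof.
  intros Hf HM.
  assert (K := curve_mean_value (fun t => f (a + RtoC t * (b - a))%C)
    (fun t => (f' (a + RtoC t * (b - a)) * (b - a))%C) (M * Cmod (b - a))).
  cbv beta in K.
  replace (a + RtoC 1 * (b - a))%C with b in K by ring.
  replace (a + RtoC 0 * (b - a))%C with a in K by ring.
  apply K.
  - intros t Ht. apply (rder_comp f (fun t => (a + RtoC t * (b - a))%C)); auto. apply rder_affine.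
  - intros t Ht. rewrite Cmod_mult. apply Rmult_le_compat_r; [apply Cmod_ge_0|auto].
Qed.

Lemma mean_value_segment_linear (f f' : C -> C) (a b l : C) (M : R) :
  (forall t, 0 <= t <= 1 -> cder f (a + RtoC t * (b - a)) (f' (a + RtoC t * (b - a)))%C) ->
  (forall t, 0 <= t <= 1 -> Cmod (f' (a + RtoC t * (b - a))%C - l) <= M) ->
  Cmod (f b - f a - l * (b - a)) <= M * Cmod (b - a).
Proof.
  intros Hf HM.
  replace (f b - f a - l * (b - a))%C with ((f b - l * b) - (f a - l * a))%C by ring.
  apply (mean_value_segment (fun z => (f z - l * z)%C) (fun z => (f' z - l)%C)); auto.
  intros t Ht. apply cder_minus; auto.
  eapply cder_eq; [apply cder_scal, cder_id|]. ring.
Qed.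

Lemma segment_in_disc (c a b : C) (r t : R) :
  0 <= t <= 1 -> Cmod (a - c) < r -> Cmod (b - c) < r -> Cmod (a + RtoC t * (b - a) - c) < r.
Proof.
  intros Ht Ha Hb.
  replace (a + RtoC t * (b - a) - c)%C with (RtoC (1 - t) * (a - c) + RtoC t * (b - c))%C
    by (rewrite RtoC_minus; ring).
  eapply Rle_lt_trans; [apply Cmod_triangle|]. rewrite !Cmod_scal, !Rabs_pos_eq by lra.
  (* One of the two weights is at least 1/2, which keeps the inequality strict. *)
  destruct (Rle_dec (1/2) t); nra.
Qed.

Lemma segment_in_cdisc (c a b : C) (r t : R) :
  0 <= t <= 1 -> Cmod (a - c) <= r -> Cmod (b - c) <= r -> Cmod (a + RtoC t * (b - a) - c) <= r.
Proof.
  intros Ht Ha Hb.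
  replace (a + RtoC t * (b - a) - c)%C with (RtoC (1 - t) * (a - c) + RtoC t * (b - c))%C
    by (rewrite RtoC_minus; ring).
  eapply Rle_trans; [apply Cmod_triangle|]. rewrite !Cmod_scal, !Rabs_pos_eq by lra. nra.
Qed.

(** * The complex exponential *)

Definition cexp (z : C) : C := (exp (Re z) * cos (Im z), exp (Re z) * sin (Im z)).

Lemma cexp_add (z w : C) : cexp (z + w) = (cexp z * cexp w)%C.
Proof.
  unfold cexp, Cmult, Cplus, Re, Im; simpl. rewrite exp_plus, cos_plus, sin_plus. f_equal; ring.
Qed.

Lemma cexp_0 : cexp 0 = RtoC 1.
Proof. unfold cexp, Re, Im, RtoC; simpl. rewrite exp_0, cos_0, sin_0. f_equal; ring. Qed.

Lemma Cmod_cexp (z : C) : Cmod (cexp z) = exp (Re z).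
Proof.
  unfold Cmod, cexp; simpl. assert (H := exp_pos (Re z)).
  replace (_ + _) with (exp (Re z) * exp (Re z)).
  - rewrite sqrt_square; lra.
  - assert (K := sin2_cos2 (Im z)). unfold Rsqr in K. nra.
Qed.

Lemma cexp_neq_0 (z : C) : cexp z <> RtoC 0.
Proof. apply Cmod_gt_0. rewrite Cmod_cexp. apply exp_pos. Qed.

Lemma cexp_opp (z : C) : cexp (- z) = (/ cexp z)%C.
Proof.
  assert (K : (cexp z * cexp (- z))%C = RtoC 1).
  { rewrite <- cexp_add, <- cexp_0. f_equal. ring. }
  assert (Hn := cexp_neq_0 z).
  transitivity (/ cexp z * (cexp z * cexp (- z)))%C; [field; auto|]. rewrite K. ring.
Qed.

Lemma derivable_pt_lim_0 (phi : R -> R) (l e : R) : derivable_pt_lim phi 0 l -> 0 < e ->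
  exists d, 0 < d /\ forall x, Rabs x < d -> Rabs (phi x - phi 0 - l * x) <= e * Rabs x.
Proof.
  intros H He. destruct (H e He) as [d Hd]. exists d. split; [apply cond_pos|]. intros x Hx.
  destruct (Req_dec x 0) as [->|Hn]; [rewrite Rminus_diag, Rmult_0_r, Rminus_0_r, Rabs_R0; lra|].
  specialize (Hd x Hn Hx). rewrite Rplus_0_l in Hd.
  replace (phi x - phi 0 - l * x) with (((phi x - phi 0) / x - l) * x) by (field; auto).
  rewrite Rabs_mult. apply Rmult_le_compat_r; [apply Rabs_pos|lra].
Qed.

Lemma cder_cexp_0 : cder cexp 0 1.
Proof.
  (* The bounds [R1] and [R2] below add up to [8 * (k * m)]; [k <= 1] gives the crude estimate
     [Ex]. *)
  apply cder_eps. intros e He. set (k := Rmin 1 (e / 8)).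
  assert (Hk : 0 < k) by (apply Rmin_pos; lra).
  assert (K1 : k <= 1) by apply Rmin_l. assert (K2 : k <= e / 8) by apply Rmin_r.
  destruct (derivable_pt_lim_0 exp _ k (derivable_pt_lim_exp 0) Hk) as [d1 [Hd1 A1]].
  destruct (derivable_pt_lim_0 cos _ k (derivable_pt_lim_cos 0) Hk) as [d2 [Hd2 A2]].
  destruct (derivable_pt_lim_0 sin _ k (derivable_pt_lim_sin 0) Hk) as [d3 [Hd3 A3]].
  rewrite exp_0 in A1. rewrite sin_0, cos_0 in A2. rewrite cos_0, sin_0 in A3.
  exists (Rmin (Rmin d1 d2) (Rmin d3 k)). split; [apply Rmin_pos; apply Rmin_pos; auto|]. intros w Hw.
  replace (w - 0)%C with w in * by ring. rewrite cexp_0.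
  destruct (Rlt_Rmin_inv _ _ _ Hw) as [Hw1 Hw2].
  destruct (Rlt_Rmin_inv _ _ _ Hw1) as [W1 W2]. destruct (Rlt_Rmin_inv _ _ _ Hw2) as [W3 W4].
  assert (Hx := Re_le_Cmod w). assert (Hy := Im_le_Cmod w).
  destruct w as [x y]. unfold Re, Im in Hx, Hy; simpl in Hx, Hy. set (m := Cmod (x, y)) in *.
  specialize (A1 x ltac:(lra)). specialize (A2 y ltac:(lra)). specialize (A3 y ltac:(lra)).
  assert (Px := Rabs_pos x). assert (Py := Rabs_pos y).
  eapply Rle_trans; [apply Cmod_le_Re_Im|].
  unfold cexp, Cminus, Cplus, Copp, Cmult, Re, Im; simpl.
  assert (Ex : Rabs (exp x - 1) <= 2 * Rabs x).
  { replace (exp x - 1) with ((exp x - 1 - 1 * x) + x) by ring. eapply Rle_trans; [apply Rabs_triang|]. nra. }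
  assert (R1 : Rabs (exp x * cos y + - (1) + - (1 * x - 0 * y)) <= k * m + 2 * (k * m)).
  { replace (exp x * cos y + - (1) + - (1 * x - 0 * y)) with
      ((exp x - 1 - 1 * x) * cos y + (1 + x) * (cos y - 1 - - 0 * y)) by ring.
    eapply Rle_trans; [apply Rabs_triang|]. rewrite !Rabs_mult.
    assert (Rabs (cos y) <= 1) by (apply Rabs_le; apply COS_bound).
    assert (Rabs (1 + x) <= 2). { eapply Rle_trans; [apply Rabs_triang|]. rewrite Rabs_R1. lra. }
    apply Rplus_le_compat.
    - rewrite <- (Rmult_1_r (k * m)). apply Rmult_le_compat; auto using Rabs_pos. nra.
    - apply Rmult_le_compat; auto using Rabs_pos. nra. }
  assert (R2 : Rabs (exp x * sin y + - 0 + - (1 * y + 0 * x)) <= 3 * (k * m) + 2 * (k * m)).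
  { replace (exp x * sin y + - 0 + - (1 * y + 0 * x)) with
      (exp x * (sin y - 0 - 1 * y) + (exp x - 1) * y) by ring.
    eapply Rle_trans; [apply Rabs_triang|]. rewrite !Rabs_mult.
    assert (Rabs (exp x) <= 3).
    { replace (exp x) with ((exp x - 1) + 1) by ring. eapply Rle_trans; [apply Rabs_triang|]. rewrite Rabs_R1. lra. }
    apply Rplus_le_compat.
    - apply Rmult_le_compat; auto using Rabs_pos. nra.
    - apply Rle_trans with (2 * Rabs x * m); [apply Rmult_le_compat; auto using Rabs_pos|nra]. }
  nra.
Qed.

Lemma cder_cexp (z : C) : cder cexp z (cexp z).
Proof.
  destruct cder_cexp_0 as [p [H1 [H2 H3]]].
  exists (fun w => (cexp z * p (w - z))%C).
  assert (E0 : (z - z)%C = RtoC 0) by ring. split; [|split].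
  - apply continuous_Cmult; [apply continuous_const|].
    apply (continuous_comp (fun w => (w - z)%C) p); [|now rewrite E0].
    apply continuous_Cminus; [apply continuous_id|apply continuous_const].
  - rewrite E0, H2. ring.
  - intros w. assert (K := H3 (w - z)%C). rewrite cexp_0 in K.
    replace (cexp w) with (cexp z * cexp (w - z))%C by (rewrite <- cexp_add; f_equal; ring).
    transitivity (cexp z * (cexp (w - z) - 1))%C; [ring|]. rewrite K. ring.
Qed.

Lemma continuous_cexp (z : C) : continuous cexp z.
Proof. eapply cder_continuous, cder_cexp. Qed.

Lemma cos_eq_1_period x : cos x = 1 -> exists k : Z, x = 2 * PI * IZR k.
Proof.
  intros H. replace x with (2 * (x / 2)) in H by field. rewrite cos_2a_sin in H.
  assert (Hs : sin (x / 2) = 0) by nra.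
  destruct (sin_eq_0_0 _ Hs) as [k Hk]. exists k. lra.
Qed.

Definition per (k : Z) : C := (0, 2 * PI * IZR k).

Lemma cexp_per (z : C) (k : Z) : cexp (z + per k) = cexp z.
Proof.
  rewrite cexp_add. replace (cexp (per k)) with (RtoC 1); [ring|].
  unfold cexp, per, Re, Im, RtoC; simpl. rewrite exp_0.
  assert (Hp : sin (PI * IZR k) = 0).
  { apply sin_eq_0_1. exists k. ring. }
  replace (2 * PI * IZR k) with (2 * (PI * IZR k)) by ring.
  rewrite cos_2a_sin, sin_2a, Hp. f_equal; ring.
Qed.

Lemma cexp_inj (z w : C) : cexp z = cexp w -> exists k, z = (w + per k)%C.
Proof.
  intros H. assert (K : cexp (z - w) = RtoC 1).
  { unfold Cminus. rewrite cexp_add, H, cexp_opp. field. apply cexp_neq_0. }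
  assert (Kr : Re (z - w) = 0).
  { assert (M := Cmod_cexp (z - w)). rewrite K, Cmod_1 in M.
    rewrite <- exp_0 in M. symmetry. now apply exp_inv. }
  assert (Kc : cos (Im (z - w)) = 1).
  { assert (M := f_equal fst K). change (exp (Re (z - w)) * cos (Im (z - w)) = 1) in M.
    rewrite Kr, exp_0 in M. lra. }
  destruct (cos_eq_1_period _ Kc) as [k Hk]. exists k.
  destruct z as [a b], w as [c d]. unfold Re, Im, Cminus, Cplus, Copp, per in *; simpl in *.
  f_equal; lra.
Qed.

Lemma clog_exists (z : C) : z <> RtoC 0 -> exists s, cexp s = z.
Proof.
  intros Hz. assert (Hm := proj1 (Cmod_gt_0 _) Hz).
  destruct z as [x y]. set (m := Cmod (x, y)) in *.
  assert (Hx := Re_le_Cmod (x, y)). unfold Re in Hx; simpl in Hx. fold m in Hx.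
  assert (Hsq := Cmod_sqr (x, y)). unfold Re, Im in Hsq; simpl in Hsq. fold m in Hsq.
  assert (Hb : -1 <= x / m <= 1).
  { apply Rabs_le_between in Hx. split; [apply Rle_div_r|apply Rle_div_l]; lra. }
  set (th := acos (x / m)).
  assert (Hc : cos th = x / m) by (apply cos_acos; lra).
  assert (Hs : sin th * sin th = (y / m) * (y / m)).
  { assert (K := sin2_cos2 th). unfold Rsqr in K. rewrite Hc in K.
    assert ((x / m) * (x / m) + (y / m) * (y / m) = 1) by (field_simplify; [|lra]; apply Rmult_eq_reg_r with (m ^ 2); [field_simplify; [simpl; lra|lra]| nra]).
    lra. }
  assert (Hexp : exp (ln m) = m) by now apply exp_ln.
  (* The arc cosine lies in [0, pi], so the sine of [th] is right only up to sign. *)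
  destruct (Req_dec (sin th) (y / m)) as [E|E].
  - exists (ln m, th). unfold cexp, Re, Im; simpl. rewrite Hexp, Hc, E. f_equal; field; lra.
  - assert (E2 : sin th = - (y / m)) by nra.
    exists (ln m, - th). unfold cexp, Re, Im; simpl. rewrite Hexp, cos_neg, sin_neg, Hc, E2. f_equal; field; lra.
Qed.

Lemma clog_near (z : C) (c : R) : z <> RtoC 0 -> exists s, cexp s = z /\ Rabs (Im s - c) <= PI.
Proof.
  intros Hz. destruct (clog_exists z Hz) as [s Hs].
  assert (HP := PI_RGT_0).
  set (q := (c - Im s) / (2 * PI)).
  (* [up (q - 1 / 2)] is an integer nearest to [q], so the error [2 * PI * (q - k)] is at most [PI]
     in absolute value. *)
  destruct (archimed (q - 1 / 2)) as [A B].
  set (k := up (q - 1 / 2)) in *.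
  exists (s + per k)%C. split; [now rewrite cexp_per|].
  unfold Im, Cplus, per; simpl. change (snd s) with (Im s).
  assert (E : c - Im s = 2 * PI * q) by (unfold q; field; lra).
  apply Rabs_le. nra.
Qed.

Lemma pow_half_pos n : 0 < (1 / 2) ^ n.
Proof. apply pow_lt. lra. Qed.

Lemma pow_half_small (K e : R) : 0 < e -> exists N, forall n, (N <= n)%nat -> K * (1 / 2) ^ n < e.
Proof.
  intros He.
  destruct (pow_lt_1_zero (1 / 2) ltac:(rewrite Rabs_pos_eq; lra) (e / (1 + Rabs K))) as [N HN].
  { assert (H := Rabs_pos K). apply Rdiv_lt_0_compat; lra. }
  exists N. intros n Hn. specialize (HN n ltac:(lia)).
  assert (Hp := pow_half_pos n). rewrite Rabs_pos_eq in HN by lra.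
  assert (H := Rabs_pos K). assert (H' := Rle_abs K).
  apply Rlt_div_r in HN; [|lra]. nra.
Qed.

(** Completeness of the plane with an explicit rate. The limits in Goursat's theorem, Newton's
    iteration, the doubling argument and the construction of escaping points are all taken in this
    form. *)
Lemma geometric_limit (a : nat -> C) (K : R) :
  (forall n, Cmod (a (S n) - a n) <= K * (1 / 2) ^ n) ->
  exists p, forall n, Cmod (a n - p) <= 2 * K * (1 / 2) ^ n.
Proof.
  intros H.
  assert (H2 : forall n k, Cmod (a (n + k)%nat - a n) <= 2 * K * (1 / 2) ^ n - 2 * K * (1 / 2) ^ (n + k)).
  { intros n k. induction k.
    - rewrite Nat.add_0_r. replace (a n - a n)%C with (RtoC 0) by ring. rewrite Cmod_0. lra.
    - rewrite Nat.add_succ_r. eapply Rle_trans; [apply (Cmod_tri _ (a (n + k)%nat))|].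
      assert (K1 := H (n + k)%nat). simpl pow. lra. }
  assert (HK : 0 <= K).
  { assert (K1 := H 0%nat). simpl in K1. assert (K2 := Cmod_ge_0 (a 1%nat - a 0%nat)). lra. }
  assert (H3 : forall n m, (n <= m)%nat -> Cmod (a m - a n) <= 2 * K * (1 / 2) ^ n).
  { intros n m Hnm. replace m with (n + (m - n))%nat by lia.
    assert (K1 := H2 n (m - n)%nat). assert (K2 := pow_half_pos (n + (m - n))). nra. }
  assert (Hcau : forall pr : C -> R, (forall z w, Rabs (pr z - pr w) <= Cmod (z - w)) ->
    exists l, Un_cv (fun n => pr (a n)) l).
  { intros pr Hpr. destruct (Rcomplete.R_complete (fun n => pr (a n))) as [l Hl]; [|now exists l].
    intros e He. destruct (pow_half_small (2 * K) (e / 2)) as [N HN]; [lra|].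
    exists N. intros n m Hn Hm. unfold Rdist.
    replace (pr (a n) - pr (a m)) with ((pr (a n) - pr (a N)) - (pr (a m) - pr (a N))) by ring.
    eapply Rle_lt_trans; [apply Rabs_triang|]. rewrite Rabs_Ropp.
    assert (A1 := Hpr (a n) (a N)). assert (A2 := Hpr (a m) (a N)).
    assert (B1 := H3 N n ltac:(lia)). assert (B2 := H3 N m ltac:(lia)).
    specialize (HN N ltac:(lia)). lra. }
  destruct (Hcau Re) as [x Hx].
  { intros z w. apply (Re_le_Cmod (z - w)). }
  destruct (Hcau Im) as [y Hy].
  { intros z w. apply (Im_le_Cmod (z - w)). }
  exists (x, y). intros n. apply Rnot_lt_le. intros Hlt.
  set (e := Cmod (a n - (x, y)) - 2 * K * (1 / 2) ^ n) in *.
  assert (He : 0 < e / 4) by (unfold e; lra).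
  destruct (Hx _ He) as [N1 HN1]. destruct (Hy _ He) as [N2 HN2].
  set (m := (n + N1 + N2)%nat).
  specialize (HN1 m ltac:(unfold m; lia)). specialize (HN2 m ltac:(unfold m; lia)).
  unfold Rdist in *.
  assert (A : Cmod (a m - (x, y)) < e / 2).
  { eapply Rle_lt_trans; [apply Cmod_le_Re_Im|].
    change (Re (a m - (x, y))) with (Re (a m) - x). change (Im (a m - (x, y))) with (Im (a m) - y). lra. }
  assert (B := H3 n m ltac:(unfold m; lia)). rewrite Cmod_sym in B.
  assert (T := Cmod_tri (a n) (a m) (x, y)). unfold e in *. lra.
Qed.

(** * Goursat's theorem *)

Definition segint (f : C -> C) (a b : C) : C :=
  CInt (fun t => (f (a + RtoC t * (b - a)) * (b - a))%C) 0 1.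

Lemma continuous_affine (a b : C) (t : R) : continuous (fun t : R => (a + RtoC t * b)%C) t.
Proof. eapply rder_continuous, rder_affine. Qed.

Section Segments.
Variable f : C -> C.
Hypothesis Hf : forall z, continuous f z.

Lemma continuous_segment_integrand (a b : C) (t : R) :
  continuous (fun t : R => (f (a + RtoC t * (b - a)) * (b - a))%C) t.
Proof.
  apply continuous_Cmult; [|apply continuous_const].
  apply (continuous_comp (fun t : R => (a + RtoC t * (b - a))%C) f); auto. apply continuous_affine.
Qed.

Lemma segint_rev (a b : C) : segint f b a = (- segint f a b)%C.
Proof.
  unfold segint. rewrite <- CInt_swap by apply continuous_segment_integrand.
  replace 1 with (-1 * 0 + 1) at 2 by ring. replace 0 with (-1 * 1 + 1) at 3 by ring.
  rewrite <- CInt_comp_lin by apply continuous_segment_integrand.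
  apply CInt_ext. intros t.
  replace (a + RtoC (-1 * t + 1) * (b - a))%C with (b + RtoC t * (a - b))%C
    by (rewrite RtoC_plus, RtoC_mult; ring).
  replace (RtoC (-1)) with (- RtoC 1)%C by (rewrite <- RtoC_opp; reflexivity). ring.
Qed.

Definition mid (a b : C) : C := (RtoC (1 / 2) * (a + b))%C.

Lemma RtoC_half : (RtoC (1 / 2) + RtoC (1 / 2))%C = RtoC 1.
Proof. rewrite <- RtoC_plus. f_equal. field. Qed.

Lemma half_split (a : C) : a = (RtoC (1 / 2) * a + RtoC (1 / 2) * a)%C.
Proof. rewrite <- Cmult_plus_distr_r, RtoC_half. ring. Qed.

Lemma mid_sub_l (a b : C) : (mid a b - a)%C = (RtoC (1 / 2) * (b - a))%C.
Proof. unfold mid. rewrite (half_split a) at 2. ring. Qed.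

Lemma mid_sub_r (a b : C) : (b - mid a b)%C = (RtoC (1 / 2) * (b - a))%C.
Proof. unfold mid. rewrite (half_split b) at 1. ring. Qed.

Lemma segint_split (a b : C) : segint f a b = (segint f a (mid a b) + segint f (mid a b) b)%C.
Proof.
  unfold segint at 1. rewrite <- (CInt_Chasles _ 0 (1 / 2) 1) by apply continuous_segment_integrand.
  f_equal.
  - replace 0 with (1 / 2 * 0 + 0) at 1 by ring. replace (1 / 2) with (1 / 2 * 1 + 0) at 2 by ring.
    rewrite <- CInt_comp_lin by apply continuous_segment_integrand.
    unfold segint. apply CInt_ext. intros t. rewrite mid_sub_l.
    replace (RtoC (1 / 2 * t + 0)) with (RtoC t * RtoC (1 / 2))%C
      by (rewrite <- RtoC_mult; f_equal; ring).
    replace (a + RtoC t * (RtoC (1 / 2) * (b - a)))%C with (a + RtoC t * RtoC (1 / 2) * (b - a))%C by ring.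
    ring.
  - replace (1 / 2) with (1 / 2 * 0 + 1 / 2) at 1 by ring. replace 1 with (1 / 2 * 1 + 1 / 2) at 3 by field.
    rewrite <- CInt_comp_lin by apply continuous_segment_integrand.
    unfold segint. apply CInt_ext. intros t. rewrite mid_sub_r.
    replace (mid a b + RtoC t * (RtoC (1 / 2) * (b - a)))%C with (a + RtoC (1 / 2 * t + 1 / 2) * (b - a))%C.
    2: { rewrite RtoC_plus, RtoC_mult. unfold mid. rewrite (half_split a) at 1. ring. }
    ring.
Qed.

Lemma segint_bound (a b : C) (M : R) :
  (forall t, 0 <= t <= 1 -> Cmod (f (a + RtoC t * (b - a))%C) <= M) ->
  Cmod (segint f a b) <= M * Cmod (b - a).
Proof.
  intros HM. unfold segint. replace (M * Cmod (b - a)) with ((1 - 0) * (M * Cmod (b - a))) by ring.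
  apply CInt_norm; [lra|apply continuous_segment_integrand|].
  intros t Ht. rewrite Cmod_mult. apply Rmult_le_compat_r; [apply Cmod_ge_0|auto].
Qed.

Lemma segint_primitive (F : C -> C) (a b : C) :
  (forall z, cder F z (f z)) -> segint f a b = (F b - F a)%C.
Proof.
  intros HF. unfold segint.
  rewrite (CInt_FTC (fun t => F (a + RtoC t * (b - a))%C)).
  - replace (a + RtoC 1 * (b - a))%C with b by ring.
    now replace (a + RtoC 0 * (b - a))%C with a by ring.
  - intros t. apply (rder_comp F (fun t => (a + RtoC t * (b - a))%C)); auto. apply rder_affine.
  - apply continuous_segment_integrand.
Qed.
End Segments.

Lemma segint_minus (f g : C -> C) a b :
  (forall z, continuous f z) -> (forall z, continuous g z) ->
  segint (fun z => (f z - g z)%C) a b = (segint f a b - segint g a b)%C.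
Proof.
  intros Hf Hg. unfold segint. rewrite <- CInt_minus; try now apply continuous_segment_integrand.
  apply CInt_ext. intros t. ring.
Qed.

Definition triint (f : C -> C) (a b c : C) : C := (segint f a b + segint f b c + segint f c a)%C.
Definition perim (a b c : C) : R := Cmod (b - a) + Cmod (c - b) + Cmod (a - c).

Lemma triint_quarter (f : C -> C) (Hf : forall z, continuous f z) (a b c : C) :
  triint f a b c =
  (triint f a (mid a b) (mid c a) + triint f (mid a b) b (mid b c)
   + triint f (mid c a) (mid b c) c + triint f (mid a b) (mid b c) (mid c a))%C.
Proof.
  unfold triint. rewrite (segint_split f Hf a b), (segint_split f Hf b c), (segint_split f Hf c a).
  rewrite (segint_rev f Hf (mid c a) (mid a b)), (segint_rev f Hf (mid a b) (mid b c)), (segint_rev f Hf (mid b c) (mid c a)).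
  ring.
Qed.

Lemma Cmod_half (z : C) : Cmod (RtoC (1 / 2) * z) = Cmod z / 2.
Proof. rewrite Cmod_scal, Rabs_pos_eq; lra. Qed.

(** Among the four triangles cut off by the midpoints one carries at least a quarter of the
    integral. The halved perimeter and the drift of the first vertex are recorded because they make
    the first vertices converge geometrically. *)
Lemma triint_descent (f : C -> C) (Hf : forall z, continuous f z) (a b c : C) :
  exists T : C * C * C, let '(a', b', c') := T in
    Cmod (triint f a b c) <= 4 * Cmod (triint f a' b' c') /\
    perim a' b' c' = perim a b c / 2 /\ Cmod (a' - a) <= perim a b c.
Proof.
  assert (Hq := triint_quarter f Hf a b c).
  assert (P1 := Cmod_ge_0 (b - a)). assert (P2 := Cmod_ge_0 (c - b)). assert (P3 := Cmod_ge_0 (a - c)).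
  assert (E1 : (mid a b - a)%C = (RtoC (1 / 2) * (b - a))%C) by apply mid_sub_l.
  assert (E2 : (b - mid a b)%C = (RtoC (1 / 2) * (b - a))%C) by apply mid_sub_r.
  assert (E3 : (mid b c - b)%C = (RtoC (1 / 2) * (c - b))%C) by apply mid_sub_l.
  assert (E4 : (c - mid b c)%C = (RtoC (1 / 2) * (c - b))%C) by apply mid_sub_r.
  assert (E5 : (mid c a - c)%C = (RtoC (1 / 2) * (a - c))%C) by apply mid_sub_l.
  assert (E6 : (a - mid c a)%C = (RtoC (1 / 2) * (a - c))%C) by apply mid_sub_r.
  assert (E7 : (mid c a - mid a b)%C = (RtoC (1 / 2) * (c - b))%C) by (unfold mid; ring).
  assert (E8 : (mid a b - mid b c)%C = (RtoC (1 / 2) * (a - c))%C) by (unfold mid; ring).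
  assert (E9 : (mid b c - mid c a)%C = (RtoC (1 / 2) * (b - a))%C) by (unfold mid; ring).
  set (t1 := triint f a (mid a b) (mid c a)) in *. set (t2 := triint f (mid a b) b (mid b c)) in *.
  set (t3 := triint f (mid c a) (mid b c) c) in *. set (t4 := triint f (mid a b) (mid b c) (mid c a)) in *.
  assert (Hs : Cmod (triint f a b c) <= Cmod t1 + Cmod t2 + Cmod t3 + Cmod t4).
  { rewrite Hq. eapply Rle_trans; [apply Cmod_triangle|]. apply Rplus_le_compat_r.
    eapply Rle_trans; [apply Cmod_triangle|]. apply Rplus_le_compat_r. apply Cmod_triangle. }
  unfold perim.
  destruct (Rle_dec (Cmod (triint f a b c)) (4 * Cmod t1)) as [K1|K1].
  { exists (a, mid a b, mid c a). cbv beta iota. split; [exact K1|]. rewrite E1, E7, E6, !Cmod_half.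
    split; [lra|]. rewrite Cmod_diag. lra. }
  destruct (Rle_dec (Cmod (triint f a b c)) (4 * Cmod t2)) as [K2|K2].
  { exists (mid a b, b, mid b c). cbv beta iota. split; [exact K2|].
    rewrite E2, E3, E8, E1, !Cmod_half. split; lra. }
  destruct (Rle_dec (Cmod (triint f a b c)) (4 * Cmod t3)) as [K3|K3].
  { exists (mid c a, mid b c, c). cbv beta iota. split; [exact K3|].
    rewrite E9, E4. rewrite (Cmod_sym (mid c a) a), E6. rewrite E5, !Cmod_half. split; lra. }
  exists (mid a b, mid b c, mid c a). cbv beta iota. split; [fold t4; lra|].
  rewrite (Cmod_sym (mid b c)), E8, (Cmod_sym (mid c a)), E9, (Cmod_sym (mid a b) (mid c a)), E7, E1, !Cmod_half.
  split; lra.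
Qed.

Lemma triint_affine (u v a b c : C) : triint (fun z => (u + v * z)%C) a b c = RtoC 0.
Proof.
  assert (Hc : forall z : C, continuous (fun z => (u + v * z)%C) z).
  { intros z. apply continuous_Cplus; [apply continuous_const|].
    apply continuous_Cmult; [apply continuous_const|apply continuous_id]. }
  assert (HF : forall z : C, cder (fun z => (u * z + RtoC (1 / 2) * v * (z * z))%C) z (u + v * z)).
  { intros z. eapply cder_eq.
    - apply cder_plus; [apply cder_scal, cder_id|]. apply cder_scal, cder_mult; apply cder_id.
    - rewrite (half_split (v * z)). ring. }
  unfold triint. rewrite !(segint_primitive _ Hc _ _ _ HF). ring.
Qed.

Lemma goursat (f : C -> C) : (forall z, exists l, cder f z l) -> forall a b c, triint f a b c = RtoC 0.
Proof.
  intros Hd a b c.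
  assert (Hf : forall z, continuous f z).
  { intros z. destruct (Hd z) as [l Hl]. now apply cder_continuous in Hl. }
  set (next := fun T : C * C * C => proj1_sig (constructive_indefinite_description _
     (let '(a, b, c) as T0 := T return exists T' : C * C * C, 
        let '(a', b', c') := T' in let '(a, b, c) := T0 in
        Cmod (triint f a b c) <= 4 * Cmod (triint f a' b' c') /\
        perim a' b' c' = perim a b c / 2 /\ Cmod (a' - a) <= perim a b c
      in triint_descent f Hf a b c))).
  set (T := fun n => Nat.iter n next (a, b, c)).
  set (A := fun n => fst (fst (T n))). set (B := fun n => snd (fst (T n))). set (D := fun n => snd (T n)).
  assert (HT : forall n, Cmod (triint f (A n) (B n) (D n)) <= 4 * Cmod (triint f (A (S n)) (B (S n)) (D (S n))) /\
    perim (A (S n)) (B (S n)) (D (S n)) = perim (A n) (B n) (D n) / 2 /\ Cmod (A (S n) - A n) <= perim (A n) (B n) (D n)).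
  { intros n. unfold A, B, D. change (T (S n)) with (next (T n)).
    destruct (T n) as [[a0 b0] c0]. unfold next.
    destruct (constructive_indefinite_description _ _) as [[[a' b'] c'] H]. simpl. exact H. }
  set (L := perim a b c).
  assert (HL : forall n, perim (A n) (B n) (D n) = L * (1 / 2) ^ n).
  { induction n.
    - simpl. unfold A, B, D, L; simpl. ring.
    - destruct (HT n) as [_ [E _]]. rewrite E, IHn. simpl. field. }
  assert (HI : forall n, Cmod (triint f a b c) <= 4 ^ n * Cmod (triint f (A n) (B n) (D n))).
  { induction n.
    - simpl. unfold A, B, D; simpl. lra.
    - destruct (HT n) as [E _]. simpl. assert (0 < 4 ^ n) by (apply pow_lt; lra). nra. }
  destruct (geometric_limit A L) as [p Hp].
  { intros n. destruct (HT n) as [_ [_ E]]. now rewrite HL in E. }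
  destruct (Hd p) as [l Hl]. rewrite cder_eps in Hl.
  assert (HLpos : 0 <= L).
  { unfold L, perim. assert (P1 := Cmod_ge_0 (b - a)). assert (P2 := Cmod_ge_0 (c - b)). assert (P3 := Cmod_ge_0 (a - c)). lra. }
  apply Cmod_eq_0. apply Rle_antisym; [|apply Cmod_ge_0]. apply Rnot_lt_le. intros Hpos.
  set (m := Cmod (triint f a b c)) in *.
  (* The final estimate is [m <= 3 * e * L^2], which this [e] contradicts; the summand 1 covers
     [L = 0]. The factor 3 is 2 for the distance from [A N] to [p] plus 1 for the size of the
     triangle. *)
  set (e := m / (4 * (L * L) + 1)).
  assert (He : 0 < e) by (apply Rdiv_lt_0_compat; nra).
  destruct (Hl e He) as [d [Hd1 Hd2]].
  destruct (pow_half_small (3 * L) d Hd1) as [N HN]. specialize (HN N ltac:(lia)).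
  set (q := (1 / 2) ^ N) in *. assert (Hq : 0 < q) by apply pow_half_pos.
  (* Subtracting the tangent map at [p] leaves the triangle integral unchanged and makes the
     integrand small. *)
  set (aff := fun z => ((f p - l * p) + l * z)%C).
  assert (Haff : forall z, continuous aff z).
  { intros z. apply continuous_Cplus; [apply continuous_const|].
    apply continuous_Cmult; [apply continuous_const|apply continuous_id]. }
  set (g := fun z => (f z - aff z)%C).
  assert (Hg : forall z, continuous g z).
  { intros z. apply continuous_Cminus; auto. }
  assert (Eg : triint g (A N) (B N) (D N) = triint f (A N) (B N) (D N)).
  { assert (K := triint_affine (f p - l * p) l (A N) (B N) (D N)). fold aff in K.
    unfold triint, g in *. rewrite !segint_minus by auto.
    transitivity ((segint f (A N) (B N) + segint f (B N) (D N) + segint f (D N) (A N)) - (segint aff (A N) (B N) + segint aff (B N) (D N) + segint aff (D N) (A N)))%C; [ring|].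
    rewrite K. ring. }
  assert (HLN := HL N). fold q in HLN. unfold perim in HLN.
  assert (P1 := Cmod_ge_0 (B N - A N)). assert (P2 := Cmod_ge_0 (D N - B N)). assert (P3 := Cmod_ge_0 (A N - D N)).
  assert (Hpt : forall z, Cmod (z - A N) <= L * q -> Cmod (g z) <= e * (3 * L * q)).
  { intros z Hz. assert (K := Cmod_tri z (A N) p). specialize (Hp N). fold q in Hp.
    assert (Hzp : Cmod (z - p) <= 3 * L * q) by lra.
    replace (g z) with (f z - f p - l * (z - p))%C by (unfold g, aff; ring).
    eapply Rle_trans; [apply Hd2; lra|]. apply Rmult_le_compat_l; lra. }
  assert (Ha : Cmod (A N - A N) <= L * q) by (replace (A N - A N)%C with (RtoC 0) by ring; rewrite Cmod_0; nra).
  assert (Hb : Cmod (B N - A N) <= L * q) by lra.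
  assert (Hc : Cmod (D N - A N) <= L * q) by (rewrite Cmod_sym; lra).
  assert (K1 : Cmod (segint g (A N) (B N)) <= e * (3 * L * q) * Cmod (B N - A N)).
  { apply segint_bound; auto. intros t Ht. apply Hpt. now apply segment_in_cdisc. }
  assert (K2 : Cmod (segint g (B N) (D N)) <= e * (3 * L * q) * Cmod (D N - B N)).
  { apply segint_bound; auto. intros t Ht. apply Hpt. now apply segment_in_cdisc. }
  assert (K3 : Cmod (segint g (D N) (A N)) <= e * (3 * L * q) * Cmod (A N - D N)).
  { apply segint_bound; auto. intros t Ht. apply Hpt. now apply segment_in_cdisc. }
  assert (K : Cmod (triint f (A N) (B N) (D N)) <= e * (3 * L * q) * (L * q)).
  { rewrite <- Eg. unfold triint. rewrite <- HLN.
    eapply Rle_trans; [apply Cmod_triangle|].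
    eapply Rle_trans; [apply Rplus_le_compat_r, Cmod_triangle|]. lra. }
  specialize (HI N).
  assert (Hq4 : 4 ^ N * (q * q) = 1).
  { unfold q. rewrite <- Rpow_mult_distr, <- Rpow_mult_distr. replace (4 * (1 / 2 * (1 / 2))) with 1 by field. apply pow1. }
  assert (H4 : 0 < 4 ^ N) by (apply pow_lt; lra).
  assert (Hm : m <= e * (3 * (L * L))).
  { eapply Rle_trans; [exact HI|]. replace (e * (3 * (L * L))) with (4 ^ N * (q * q) * (e * (3 * (L * L)))) by (rewrite Hq4; ring).
    replace (4 ^ N * (q * q) * (e * (3 * (L * L)))) with (4 ^ N * (e * (3 * L * q) * (L * q))) by ring.
    apply Rmult_le_compat_l; lra. }
  assert (Em : e * (4 * (L * L) + 1) = m) by (unfold e; field; nra).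
  nra.
Qed.

(** Integrate over the segment from 0. Goursat's theorem for the triangle 0, z, w turns the
    increment into the integral from [z] to [w], where [f] is close to [f z]. *)
Lemma entire_primitive (f : C -> C) :
  (forall z, exists l, cder f z l) -> exists F, forall z, cder F z (f z).
Proof.
  intros Hd. assert (G := goursat f Hd).
  assert (Hf : forall z, continuous f z).
  { intros z. destruct (Hd z) as [l Hl]. now apply cder_continuous in Hl. }
  exists (fun z => segint f 0 z). intros z. apply cder_eps. intros e He.
  destruct (proj1 (continuous_C_eps _ _) (Hf z) e He) as [d [Hd1 Hd2]].
  exists d. split; auto. intros w Hw.
  assert (E : (segint f 0 w - segint f 0 z)%C = segint f z w).
  { assert (K := G (RtoC 0) z w). unfold triint in K.
    rewrite (segint_rev f Hf 0 w) in K.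
    transitivity (segint f z w - (segint f 0 z + segint f z w + - segint f 0 w))%C; [ring|].
    rewrite K. ring. }
  rewrite E.
  assert (Hk : forall u : C, continuous (fun _ : C => f z) u) by (intros; apply continuous_const).
  assert (Ec : segint (fun _ => f z) z w = (f z * (w - z))%C).
  { unfold segint. rewrite CInt_const. replace (RtoC (1 - 0)) with (RtoC 1) by (f_equal; ring). ring. }
  rewrite <- Ec, <- segint_minus by auto.
  apply segint_bound.
  - intros u. apply continuous_Cminus; auto.
  - intros t Ht. left. apply Hd2. apply segment_in_disc; auto.
    now rewrite Cmod_diag.
Qed.

(** * Cauchy's integral formula on a disc *)

Lemma is_derive_RInt_param_near (G dG : R -> R -> R) (a b s0 e : R) : 0 < e ->
  (forall s t, Rabs (s - s0) < e -> is_derive (fun u => G u t) s (dG s t)) ->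
  (forall t, continuous (fun p : R * R => dG (fst p) (snd p)) (s0, t)) ->
  (forall s t, Rabs (s - s0) < e -> continuous (G s) t) ->
  is_derive (fun s => RInt (G s) a b) s0 (RInt (dG s0) a b).
Proof.
  intros He Hd Hc HG.
  assert (L : forall P : R -> Prop, (forall s, Rabs (s - s0) < e -> P s) -> locally s0 P).
  { intros P HP. exists (mkposreal e He). intros s Hs. apply HP. exact Hs. }
  assert (s0s : Rabs (s0 - s0) < e) by (rewrite Rminus_diag, Rabs_R0; auto).
  replace (RInt (dG s0) a b) with (RInt (fun t => Derive (fun u => G u t) s0) a b).
  2: { apply RInt_ext. intros t _. apply is_derive_unique. now apply Hd. }
  apply is_derive_RInt_param.
  - apply L. intros s Hs t _. exists (dG s t). now apply Hd.
  - intros t _. apply continuity_2d_pt_ext_loc with dG.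
    + exists (mkposreal e He). intros u v Hu _. symmetry. apply is_derive_unique. now apply Hd.
    + apply continuity_2d_pt_filterlim. apply Hc.
  - apply L. intros s Hs. apply (ex_RInt_continuous (V := R_CompleteNormedModule)). intros t _. now apply HG.
Qed.

Section Param.
Variables (G dG : R -> R -> C) (a b s0 e : R).
Hypothesis He : 0 < e.
Hypothesis Hd : forall s t, Rabs (s - s0) < e -> rder (fun u => G u t) s (dG s t).
Hypothesis Hc : forall t, continuous (fun p : R * R => dG (fst p) (snd p)) (s0, t).
Hypothesis HG : forall s t, Rabs (s - s0) < e -> continuous (G s) t.

Lemma is_derive_CInt_param_Re :
  is_derive (fun s => Re (CInt (G s) a b)) s0 (Re (CInt (dG s0) a b)).
Proof.
  apply (is_derive_RInt_param_near (fun s t => Re (G s t)) (fun s t => Re (dG s t)) a b s0 e He).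
  - intros. apply rder_Re. now apply Hd.
  - intros. now apply continuous_Re.
  - intros. now apply continuous_Re, HG.
Qed.

Lemma is_derive_CInt_param_Im :
  is_derive (fun s => Im (CInt (G s) a b)) s0 (Im (CInt (dG s0) a b)).
Proof.
  apply (is_derive_RInt_param_near (fun s t => Im (G s t)) (fun s t => Im (dG s t)) a b s0 e He).
  - intros. apply rder_Im. now apply Hd.
  - intros. now apply continuous_Im.
  - intros. now apply continuous_Im, HG.
Qed.
End Param.

(** Deformation principle behind the two Cauchy formulas. The parameter interval exceeds [0, 1] by
    [e] because the derivatives at 0 and 1 are two-sided; the vanishing is asked for [0 < s < 1]
    only, since the primitive in [cauchy_formula] contains the factor [/ s]. *)
Lemma CInt_param_constant (G dG : R -> R -> C) (a b e : R) : 0 < e ->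
  (forall s t, - e < s < 1 + e -> rder (fun u => G u t) s (dG s t)) ->
  (forall s t, - e < s < 1 + e -> continuous (fun p : R * R => dG (fst p) (snd p)) (s, t)) ->
  (forall s t, - e < s < 1 + e -> continuous (G s) t) ->
  (forall s, 0 < s < 1 -> CInt (dG s) a b = RtoC 0) ->
  CInt (G 1) a b = CInt (G 0) a b.
Proof.
  intros He Hd Hc HG H0.
  assert (N : forall s0 s, 0 <= s0 <= 1 -> Rabs (s - s0) < e -> - e < s < 1 + e).
  { intros s0 s Hs0 Hs. apply Rabs_lt_between in Hs. lra. }
  assert (DR : forall s, 0 <= s <= 1 -> is_derive (fun s => Re (CInt (G s) a b)) s (Re (CInt (dG s) a b))).
  { intros s0 Hs0. apply is_derive_CInt_param_Re with e; auto; intros.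
    - apply Hd; eapply N; eauto. - apply Hc; lra. - apply HG; eapply N; eauto. }
  assert (DI : forall s, 0 <= s <= 1 -> is_derive (fun s => Im (CInt (G s) a b)) s (Im (CInt (dG s) a b))).
  { intros s0 Hs0. apply is_derive_CInt_param_Im with e; auto; intros.
    - apply Hd; eapply N; eauto. - apply Hc; lra. - apply HG; eapply N; eauto. }
  assert (Z : forall (J dJ : R -> R), (forall s, 0 <= s <= 1 -> is_derive J s (dJ s)) ->
    (forall s, 0 < s < 1 -> dJ s = 0) -> J 1 = J 0).
  { intros J dJ HJ Hz.
    destruct (MVT_gen J 0 1 (fun _ => 0)) as [c [_ Ec]]; [| |lra].
    - intros s Hs. rewrite Rmin_left, Rmax_right in Hs by lra. rewrite <- (Hz s Hs). apply HJ. lra.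
    - intros s Hs. rewrite Rmin_left, Rmax_right in Hs by lra. apply continuity_pt_of_continuous.
      apply (ex_derive_continuous (V := R_NormedModule) J). exists (dJ s). now apply HJ. }
  apply injective_projections.
  - apply (Z (fun s => Re (CInt (G s) a b)) _ DR). intros s Hs. rewrite H0; auto.
  - apply (Z (fun s => Im (CInt (G s) a b)) _ DI). intros s Hs. rewrite H0; auto.
Qed.

Definition circ (t : R) : C := cexp (0 + RtoC t * Ci).

Lemma rder_circ t : rder circ t (circ t * Ci).
Proof. apply (rder_comp cexp (fun t => (0 + RtoC t * Ci)%C)); [apply cder_cexp|apply rder_affine]. Qed.

Lemma continuous_circ t : continuous circ t.
Proof. eapply rder_continuous, rder_circ. Qed.

Lemma Cmod_circ t : Cmod (circ t) = 1.
Proof.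
  unfold circ. rewrite Cmod_cexp.
  replace (Re (0 + RtoC t * Ci)) with 0; [apply exp_0|]. unfold Re, Cplus, Cmult, RtoC, Ci; simpl. ring.
Qed.

Lemma circ_neq_0 t : circ t <> RtoC 0.
Proof. apply cexp_neq_0. Qed.

Lemma circ_2PI : circ (2 * PI) = circ 0.
Proof.
  unfold circ. rewrite <- (cexp_per (0 + RtoC 0 * Ci) 1). f_equal.
  unfold per, Cplus, Cmult, RtoC, Ci; simpl. f_equal; ring.
Qed.

Lemma Cmod_rcirc r t : 0 <= r -> Cmod (RtoC r * circ t) = r.
Proof. intros. now rewrite Cmod_scal, Cmod_circ, Rabs_pos_eq, Rmult_1_r. Qed.

Lemma RtoC_neq_0 r : 0 < r -> RtoC r <> RtoC 0.
Proof. intros H. apply Cmod_gt_0. rewrite Cmod_R, Rabs_pos_eq; lra. Qed.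

Lemma rcirc_sub_neq_0 r t h : Cmod h < r -> (RtoC r * circ t - h)%C <> RtoC 0.
Proof.
  intros H. apply Cmod_gt_0. assert (Q := Cmod_ge_0 h).
  assert (K := Cmod_rev (RtoC r * circ t) h). rewrite Cmod_rcirc in K; lra.
Qed.

Lemma continuous_rcirc r t : continuous (fun t => (RtoC r * circ t)%C) t.
Proof. apply continuous_Cmult; [apply continuous_const|apply continuous_circ]. Qed.

Lemma continuous_cauchy_kernel r h t : Cmod h < r ->
  continuous (fun t => (RtoC r * circ t / (RtoC r * circ t - h))%C) t.
Proof.
  intros H. apply continuous_Cdiv; [apply continuous_rcirc| |now apply rcirc_sub_neq_0].
  apply continuous_Cminus; [apply continuous_rcirc|apply continuous_const].
Qed.

Lemma rder_rcirc r h t : rder (fun t => (RtoC r * circ t - h)%C) t (RtoC r * circ t * Ci).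
Proof.
  destruct (rder_scal (RtoC r) _ _ _ (rder_circ t)) as [p [H1 [H2 H3]]].
  exists p. split; [exact H1|]. split; [rewrite H2; ring|].
  intros s. rewrite <- H3. ring.
Qed.

Lemma continuous_pair_fst (s t : R) : continuous (fun p : R * R => RtoC (fst p)) (s, t).
Proof. apply continuous_RtoC. apply continuous_fst. Qed.

Lemma continuous_pair_snd (g : R -> C) (s t : R) :
  continuous g t -> continuous (fun p : R * R => g (snd p)) (s, t).
Proof. intros H. apply (continuous_comp (fun p : R * R => snd p) g); [apply continuous_snd|exact H]. Qed.

(** Shrink [h] to 0 through [s * h]. The [s]-derivative of the kernel is the [t]-derivative of a
    [2 * PI]-periodic function, so the integral keeps its value at [s = 0], where the kernel is
    1. *)
Lemma cauchy_kernel_integral r h : Cmod h < r ->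
  CInt (fun t => (RtoC r * circ t / (RtoC r * circ t - h))%C) 0 (2 * PI) = RtoC (2 * PI).
Proof.
  intros Hh. assert (Hh0 := Cmod_ge_0 h).
  set (e := (r - Cmod h) / (2 * r)).
  assert (He : 0 < e) by (apply Rdiv_lt_0_compat; lra).
  assert (Hse : forall s, - e < s < 1 + e -> Cmod (RtoC s * h) < r).
  { intros s Hs. rewrite Cmod_scal.
    assert (Rabs s <= 1 + e) by (apply Rabs_le; lra).
    apply Rle_lt_trans with ((1 + e) * Cmod h); [now apply Rmult_le_compat_r|].
    assert (E : e * (2 * r) = r - Cmod h) by (unfold e; field; lra).
    nra. }
  assert (Hnz : forall s t, - e < s < 1 + e -> (RtoC r * circ t - RtoC s * h)%C <> RtoC 0).
  { intros. apply rcirc_sub_neq_0. auto. }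
  assert (K := CInt_param_constant
    (fun s t => (RtoC r * circ t / (RtoC r * circ t - RtoC s * h))%C)
    (fun s t => (RtoC r * circ t * h / ((RtoC r * circ t - RtoC s * h) * (RtoC r * circ t - RtoC s * h)))%C)
    0 (2 * PI) e He).
  cbv beta in K.
  replace (RtoC 1 * h)%C with h in K by ring.
  rewrite K; clear K.
  - transitivity (CInt (fun _ => RtoC 1) 0 (2 * PI)).
    + apply CInt_ext. intros t. field. split; [apply circ_neq_0|apply RtoC_neq_0; lra].
    + rewrite CInt_const. rewrite Rminus_0_r. ring.
  - intros s t Hs.
    assert (Q : cder (fun z => (RtoC r * circ t / (RtoC r * circ t - z * h))%C) (RtoC s)
       (RtoC r * circ t * h / ((RtoC r * circ t - RtoC s * h) * (RtoC r * circ t - RtoC s * h)))).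
    { eapply cder_eq.
      - apply (cder_scal (RtoC r * circ t)). apply (cder_inv (fun z => (RtoC r * circ t - z * h)%C)); [|now apply Hnz].
        apply cder_minus; [apply cder_const|]. apply cder_mult; [apply cder_id|apply cder_const].
      - cbv beta. field. now apply Hnz. }
    assert (A := rder_affine 0 1 s).
    assert (Q2 : cder (fun z => (RtoC r * circ t / (RtoC r * circ t - z * h))%C) (0 + RtoC s * 1)
       (RtoC r * circ t * h / ((RtoC r * circ t - RtoC s * h) * (RtoC r * circ t - RtoC s * h)))).
    { replace (0 + RtoC s * 1)%C with (RtoC s) by ring. exact Q. }
    assert (B := rder_comp _ (fun s => (0 + RtoC s * 1)%C) s _ _ Q2 A).
    destruct B as [p [H1 [H2 H3]]]. exists p. split; [exact H1|]. split; [rewrite H2; ring|].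
    intros u. rewrite <- H3. cbv beta.
    replace (0 + RtoC u * 1)%C with (RtoC u) by ring. now replace (0 + RtoC s * 1)%C with (RtoC s) by ring.
  - intros s t Hs.
    assert (C1 : continuous (fun p : R * R => (RtoC r * circ (snd p))%C) (s, t)).
    { apply (continuous_pair_snd (fun t => (RtoC r * circ t)%C)), continuous_rcirc. }
    assert (C2 : continuous (fun p : R * R => (RtoC r * circ (snd p) - RtoC (fst p) * h)%C) (s, t)).
    { apply continuous_Cminus; auto. apply continuous_Cmult; [apply continuous_pair_fst|apply continuous_const]. }
    apply continuous_Cdiv.
    + apply continuous_Cmult; auto. apply continuous_const.
    + now apply continuous_Cmult.
    + apply Cmult_neq_0; now apply Hnz.
  - intros s t Hs. now apply continuous_cauchy_kernel, Hse.
  - intros s Hs.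
    assert (Hs' : - e < s < 1 + e) by lra.
    rewrite (CInt_FTC (fun t => (Ci * h * / (RtoC r * circ t - RtoC s * h))%C)).
    + rewrite circ_2PI. ring.
    + intros t.
      assert (A := rder_rcirc r (RtoC s * h) t).
      assert (Q := rder_comp (fun z => (Ci * h * / z)%C) (fun t => (RtoC r * circ t - RtoC s * h)%C) t _ _
        (cder_scal (Ci * h) _ _ _ (cder_inv_id _ (Hnz s t Hs'))) A).
      cbv beta in Q.
      destruct Q as [p [H1 [H2 H3]]]. exists p. split; [exact H1|]. split; [|exact H3].
      rewrite H2.
      assert (Ei : (Ci * Ci)%C = (- RtoC 1)%C) by (unfold Ci, Cmult, Copp, RtoC; simpl; f_equal; ring).
      transitivity (- (Ci * Ci) * (RtoC r * circ t * h / ((RtoC r * circ t - RtoC s * h) * (RtoC r * circ t - RtoC s * h))))%C.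
      * field. now apply Hnz.
      * rewrite Ei. ring.
    + intros t. apply continuous_Cdiv.
      * apply continuous_Cmult; [apply continuous_rcirc|apply continuous_const].
      * apply continuous_Cmult; (apply continuous_Cminus; [apply continuous_rcirc|apply continuous_const]).
      * apply Cmult_neq_0; now apply Hnz.
Qed.

Section CauchyDisc.
Variables (f f' : C -> C) (a : C) (rho r : R).
Hypothesis Hr : 0 < r < rho.
Hypothesis Hf : forall z, Cmod (z - a) < rho -> cder f z (f' z).
Hypothesis Hf' : forall z, Cmod (z - a) < rho -> continuous f' z.

Lemma continuous_on_circle t : continuous (fun t => f (a + RtoC r * circ t)%C) t.
Proof.
  apply (continuous_comp (fun t => (a + RtoC r * circ t)%C) f).
  - apply continuous_Cplus; [apply continuous_const|apply continuous_rcirc].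
  - eapply cder_continuous, Hf. replace (a + RtoC r * circ t - a)%C with (RtoC r * circ t)%C by ring.
    rewrite Cmod_rcirc; lra.
Qed.

(** Contract the circle to [a + h] along segments. The factor [RtoC r * circ t - h] produced by the
    chain rule cancels the denominator of the kernel, and what remains is, up to the constant
    [/ (s * Ci)], the [t]-derivative of [f] along the contracted circle. At [s = 0] only the kernel
    integral is left. *)
Lemma cauchy_formula (h : C) : Cmod h < r ->
  CInt (fun t => (f (a + RtoC r * circ t) * (RtoC r * circ t / (RtoC r * circ t - h)))%C) 0 (2 * PI)
  = (RtoC (2 * PI) * f (a + h))%C.
Proof.
  intros Hh. assert (Hh0 := Cmod_ge_0 h).
  set (e := (rho - r) / (2 * r)).
  assert (He : 0 < e) by (apply Rdiv_lt_0_compat; lra).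
  assert (Ee : e * (2 * r) = rho - r) by (unfold e; field; lra).
  set (pt := fun s t => (a + h + RtoC s * (RtoC r * circ t - h))%C).
  assert (Hpt : forall s t, - e < s < 1 + e -> Cmod (pt s t - a) < rho).
  { intros s t Hs.
    replace (pt s t - a)%C with (RtoC (1 - s) * h + RtoC s * (RtoC r * circ t))%C
      by (unfold pt; rewrite RtoC_minus; ring).
    eapply Rle_lt_trans; [apply Cmod_triangle|]. rewrite Cmod_scal, (Cmod_scal s), Cmod_rcirc by lra.
    destruct (Rle_dec 0 s); destruct (Rle_dec s 1).
    - rewrite !Rabs_pos_eq by lra. nra.
    - rewrite Rabs_left1, Rabs_pos_eq by lra. nra.
    - rewrite Rabs_pos_eq, Rabs_left1 by lra. nra.
    - lra. }
  set (k := fun t => (RtoC r * circ t / (RtoC r * circ t - h))%C).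
  assert (Hnz : forall t, (RtoC r * circ t - h)%C <> RtoC 0) by (intros; now apply rcirc_sub_neq_0).
  assert (Hkc : forall t, continuous k t) by (intros; now apply continuous_cauchy_kernel).
  assert (K := CInt_param_constant (fun s t => (f (pt s t) * k t)%C)
    (fun s t => (f' (pt s t) * (RtoC r * circ t))%C) 0 (2 * PI) e He).
  cbv beta in K.
  transitivity (CInt (fun t => (f (pt 1 t) * k t)%C) 0 (2 * PI)).
  { apply CInt_ext. intros t. unfold k. do 2 f_equal. unfold pt. ring. }
  rewrite K; clear K.
  - rewrite <- (cauchy_kernel_integral r h Hh). fold k.
    transitivity (CInt (fun t => (f (a + h) * k t)%C) 0 (2 * PI)).
    + apply CInt_ext. intros t. do 2 f_equal. unfold pt. ring.
    + rewrite CInt_scal; auto. ring.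
  - intros s t Hs.
    assert (Q := rder_comp f (fun s => pt s t) s _ _ (Hf _ (Hpt s t Hs)) (rder_affine (a + h) (RtoC r * circ t - h) s)).
    apply (rder_scal (k t)) in Q. destruct Q as [p [H1 [H2 H3]]].
    exists p. split; [exact H1|]. split.
    + rewrite H2. unfold k. field. apply Hnz.
    + intros u. rewrite <- H3. ring.
  - intros s t Hs.
    assert (C1 : continuous (fun p : R * R => (RtoC r * circ (snd p))%C) (s, t)).
    { apply (continuous_pair_snd (fun t => (RtoC r * circ t)%C)), continuous_rcirc. }
    apply continuous_Cmult; auto.
    apply (continuous_comp (fun p : R * R => pt (fst p) (snd p)) f').
    + unfold pt. apply continuous_Cplus; [apply continuous_const|].
      apply continuous_Cmult; [apply continuous_pair_fst|].
      apply continuous_Cminus; auto. apply continuous_const.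
    + apply Hf'. now apply Hpt.
  - intros s t Hs. apply continuous_Cmult; auto.
    apply (continuous_comp (pt s) f).
    + unfold pt. apply continuous_Cplus; [apply continuous_const|].
      apply continuous_Cmult; [apply continuous_const|].
      apply continuous_Cminus; [apply continuous_rcirc|apply continuous_const].
    + eapply cder_continuous, Hf, Hpt. lra.
  - intros s Hs.
    assert (Hs' : - e < s < 1 + e) by lra.
    assert (Hs0 : RtoC s <> RtoC 0).
    { apply Cmod_gt_0. rewrite Cmod_R, Rabs_pos_eq; lra. }
    assert (Hi := Ci_nz).
    rewrite (CInt_FTC (fun t => (/ (RtoC s * Ci) * f (pt s t))%C)).
    + unfold pt. rewrite circ_2PI. ring.
    + intros t.
      assert (A : rder (pt s) t (RtoC s * (RtoC r * circ t * Ci))).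
      { destruct (rder_scal (RtoC s) _ _ _ (rder_rcirc r h t)) as [p [H1 [H2 H3]]].
        exists p. split; [exact H1|]. split; [exact H2|]. intros u. rewrite <- H3. unfold pt. ring. }
      assert (Q := rder_scal (/ (RtoC s * Ci)) _ _ _ (rder_comp f (pt s) t _ _ (Hf _ (Hpt s t Hs')) A)).
      destruct Q as [p [H1 [H2 H3]]]. exists p. split; [exact H1|]. split; [|exact H3].
      rewrite H2. field. auto.
    + intros t. apply continuous_Cmult; [|apply continuous_rcirc].
      apply (continuous_comp (pt s) f').
      * unfold pt. apply continuous_Cplus; [apply continuous_const|].
        apply continuous_Cmult; [apply continuous_const|].
        apply continuous_Cminus; [apply continuous_rcirc|apply continuous_const].
      * apply Hf'. now apply Hpt.
Qed.

Lemma circle_mean : CInt (fun t => f (a + RtoC r * circ t)%C) 0 (2 * PI) = (RtoC (2 * PI) * f a)%C.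
Proof.
  assert (K := cauchy_formula 0). rewrite Cmod_0 in K. specialize (K ltac:(lra)).
  replace (a + 0)%C with a in K by ring. rewrite <- K.
  apply CInt_ext. intros t. field. split; [apply circ_neq_0|apply RtoC_neq_0; lra].
Qed.

End CauchyDisc.

Lemma two_PI_neq_0 : RtoC (2 * PI) <> RtoC 0.
Proof. apply RtoC_neq_0. assert (H := PI_RGT_0). lra. Qed.

Lemma rcirc_neq_0 r t : 0 < r -> (RtoC r * circ t)%C <> RtoC 0.
Proof. intros H. apply Cmult_neq_0; [now apply RtoC_neq_0|apply circ_neq_0]. Qed.

Lemma continuous_rcirc_inv r t : 0 < r -> continuous (fun t => (/ (RtoC r * circ t))%C) t.
Proof. intros H. apply continuous_Cinv; [apply continuous_rcirc|now apply rcirc_neq_0]. Qed.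

Lemma Cmod_rcirc_inv r t : 0 < r -> Cmod (/ (RtoC r * circ t)) = / r.
Proof. intros H. rewrite Cmod_inv by now apply rcirc_neq_0. rewrite Cmod_rcirc; lra. Qed.

(** * Taylor coefficients and remainders *)

Lemma circle_param (a z : C) (r : R) : 0 < r -> Cmod (z - a) = r ->
  exists t, - PI <= t <= PI /\ z = (a + RtoC r * circ t)%C.
Proof.
  intros Hr Hz. assert (Hrn := RtoC_neq_0 r Hr).
  assert (Hm : Cmod ((z - a) / RtoC r) = 1).
  { rewrite Cmod_div, Hz, Cmod_R, Rabs_pos_eq by (auto; lra). field. lra. }
  assert (Hnz : ((z - a) / RtoC r)%C <> RtoC 0) by (apply Cmod_gt_0; lra).
  destruct (clog_near _ 0 Hnz) as [s [Es Hs]]. rewrite Rminus_0_r in Hs.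
  assert (Hre : Re s = 0).
  { apply exp_inv. now rewrite exp_0, <- Cmod_cexp, Es. }
  exists (Im s). split; [now apply Rabs_le_between|].
  replace (circ (Im s)) with (cexp s).
  - rewrite Es. field. exact Hrn.
  - unfold circ. f_equal. destruct s as [x y]. unfold Re, Im in *; simpl in *. subst x.
    unfold Cplus, Cmult, RtoC, Ci; simpl. f_equal; ring.
Qed.

Definition tcoef (f : C -> C) (a : C) (r : R) (n : nat) : C :=
  (/ RtoC (2 * PI) * CInt (fun t => f (a + RtoC r * circ t) * (/ (RtoC r * circ t)) ^ n) 0 (2 * PI))%C.

(** The Taylor remainder of order [n] divided by [h ^ n]. The Taylor expansions below are finite
    sums with this remainder, controlled by [trem_bound]. *)
Definition trem (f : C -> C) (a : C) (r : R) (h : C) (n : nat) : C :=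
  (/ RtoC (2 * PI) * CInt (fun t => f (a + RtoC r * circ t) * (/ (RtoC r * circ t)) ^ n *
     (RtoC r * circ t / (RtoC r * circ t - h))) 0 (2 * PI))%C.

Section Taylor.
Variables (f f' : C -> C) (a : C) (rho r : R).
Hypothesis Hr : 0 < r < rho.
Hypothesis Hf : forall z, Cmod (z - a) < rho -> cder f z (f' z).
Hypothesis Hf' : forall z, Cmod (z - a) < rho -> continuous f' z.

Lemma continuous_tcoef_integrand n t :
  continuous (fun t => (f (a + RtoC r * circ t) * (/ (RtoC r * circ t)) ^ n)%C) t.
Proof.
  apply continuous_Cmult; [now apply (continuous_on_circle f f' a rho r Hr Hf)|].
  apply continuous_Cpow, continuous_rcirc_inv. lra.
Qed.

Lemma continuous_trem_integrand h n t : Cmod h < r ->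
  continuous (fun t => (f (a + RtoC r * circ t) * (/ (RtoC r * circ t)) ^ n *
     (RtoC r * circ t / (RtoC r * circ t - h)))%C) t.
Proof.
  intros Hh. apply continuous_Cmult; [apply continuous_tcoef_integrand|now apply continuous_cauchy_kernel].
Qed.

Lemma trem_0 h : Cmod h < r -> trem f a r h 0 = f (a + h)%C.
Proof.
  intros Hh. unfold trem.
  rewrite (CInt_ext _ (fun t => (f (a + RtoC r * circ t) * (RtoC r * circ t / (RtoC r * circ t - h)))%C)).
  - rewrite (cauchy_formula f f' a rho r Hr Hf Hf' h Hh). field. apply two_PI_neq_0.
  - intros t. simpl. ring.
Qed.

(** With [z] on the circle, [z / (z - h) = 1 + h / z * (z / (z - h))]; the summand 1 gives the
    coefficient. *)
Lemma trem_step h n : Cmod h < r -> trem f a r h n = (tcoef f a r n + h * trem f a r h (S n))%C.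
Proof.
  intros Hh. unfold trem, tcoef.
  rewrite (CInt_ext (fun t => (f (a + RtoC r * circ t) * (/ (RtoC r * circ t)) ^ n *
     (RtoC r * circ t / (RtoC r * circ t - h)))%C)
    (fun t => (f (a + RtoC r * circ t) * (/ (RtoC r * circ t)) ^ n +
       h * (f (a + RtoC r * circ t) * (/ (RtoC r * circ t)) ^ (S n) * (RtoC r * circ t / (RtoC r * circ t - h))))%C)).
  - rewrite CInt_plus, CInt_scal.
    + ring.
    + intros t. now apply continuous_trem_integrand.
    + intros t. apply continuous_tcoef_integrand.
    + intros t. apply continuous_Cmult; [apply continuous_const|now apply continuous_trem_integrand].
  - intros t. rewrite Cpow_S. set (p := ((/ (RtoC r * circ t)) ^ n)%C). field.
    split; [|split].
    + now apply rcirc_sub_neq_0. + apply circ_neq_0. + apply RtoC_neq_0; lra.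
Qed.

Lemma trem_bound h n M : Cmod h < r -> (forall z, Cmod (z - a) = r -> Cmod (f z) <= M) ->
  Cmod (trem f a r h n) <= M * (/ r) ^ n * (r / (r - Cmod h)).
Proof.
  intros Hh HM. unfold trem. assert (HP := PI_RGT_0). assert (Hh0 := Cmod_ge_0 h).
  rewrite Cmod_mult, Cmod_inv by apply two_PI_neq_0. rewrite Cmod_R, Rabs_pos_eq by lra.
  assert (K : Cmod (CInt (fun t => (f (a + RtoC r * circ t) * (/ (RtoC r * circ t)) ^ n *
     (RtoC r * circ t / (RtoC r * circ t - h)))%C) 0 (2 * PI)) <= (2 * PI - 0) * (M * (/ r) ^ n * (r / (r - Cmod h)))).
  { apply CInt_norm; [lra|intros; now apply continuous_trem_integrand|].
    intros t _. rewrite !Cmod_mult, Cmod_pow, Cmod_rcirc_inv by lra.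
    assert (A : Cmod (f (a + RtoC r * circ t)%C) <= M).
    { apply HM. replace (a + RtoC r * circ t - a)%C with (RtoC r * circ t)%C by ring. apply Cmod_rcirc. lra. }
    assert (B : Cmod (RtoC r * circ t / (RtoC r * circ t - h)) <= r / (r - Cmod h)).
    { rewrite Cmod_div by now apply rcirc_sub_neq_0. rewrite Cmod_rcirc by lra.
      apply Rmult_le_compat_l; [lra|]. apply Rinv_le_contravar; [lra|].
      assert (Q := Cmod_rev (RtoC r * circ t) h). rewrite Cmod_rcirc in Q; lra. }
    assert (0 < / r) by (apply Rinv_0_lt_compat; lra).
    assert (0 < (/ r) ^ n) by now apply pow_lt.
    assert (Q1 := Cmod_ge_0 (f (a + RtoC r * circ t)%C)).
    apply Rmult_le_compat; auto.
    - apply Rmult_le_pos; lra.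
    - apply Cmod_ge_0.
    - apply Rmult_le_compat_r; lra. }
  apply Rmult_le_reg_l with (2 * PI); [lra|].
  rewrite <- Rmult_assoc, Rinv_r, Rmult_1_l by lra. lra.
Qed.

(** Cauchy's inequality: at [h = 0] the remainder is the coefficient itself. *)
Lemma tcoef_bound n M : (forall z, Cmod (z - a) = r -> Cmod (f z) <= M) ->
  Cmod (tcoef f a r n) <= M * (/ r) ^ n.
Proof.
  intros HM. assert (H0 : Cmod 0 < r) by (rewrite Cmod_0; lra).
  assert (K := trem_bound 0 n M H0 HM). rewrite trem_step in K by exact H0.
  rewrite Cmod_0, Rminus_0_r, Rdiv_diag, Rmult_1_r in K by lra.
  now replace (tcoef f a r n + 0 * trem f a r 0 (S n))%C with (tcoef f a r n) in K by ring.
Qed.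

Lemma circle_bounded : exists M, 0 <= M /\ forall z, Cmod (z - a) = r -> Cmod (f z) <= M.
Proof.
  destruct (continuity_ab_maj (fun t => Cmod (f (a + RtoC r * circ t)%C)) (- PI) PI) as [t0 [H0 _]].
  - assert (H := PI_RGT_0). lra.
  - intros t _. apply continuity_pt_of_continuous, continuous_Cmod.
    now apply (continuous_on_circle f f' a rho r Hr Hf).
  - exists (Cmod (f (a + RtoC r * circ t0)%C)). split; [apply Cmod_ge_0|].
    intros z Hz.
    destruct (circle_param a z r) as [t [Ht ->]]; [lra|exact Hz|]. now apply H0.
Qed.

(** The expansion with second-order remainder shows that the coefficient is a derivative of [f] at
    [a], and derivatives are unique. *)
Lemma tcoef_1 : tcoef f a r 1 = f' a.
Proof.
  destruct circle_bounded as [M [HM0 HM]].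
  assert (Haa : Cmod (a - a) < rho) by (rewrite Cmod_diag; lra).
  apply (cder_unique f a); [|now apply Hf].
  set (c := tcoef f a r 1).
  assert (HB : 0 <= M * (/ r) ^ 2 * 2).
  { assert (0 < / r) by (apply Rinv_0_lt_compat; lra). simpl. nra. }
  set (B := M * (/ r) ^ 2 * 2) in *.
  apply cder_eps. intros e He. exists (Rmin (r / 2) (e / (B + 1))). split.
  { apply Rmin_pos; [lra|]. apply Rdiv_lt_0_compat; lra. }
  intros w Hw.
  destruct (Rlt_Rmin_inv _ _ _ Hw) as [H1 H2].
  apply Rlt_div_r in H2; [|lra].
  set (h := (w - a)%C) in *.
  assert (Hh : Cmod h < r) by lra.
  assert (H0r : Cmod 0 < r) by (rewrite Cmod_0; lra).
  assert (E0 : f w = (tcoef f a r 0 + h * (c + h * trem f a r h 2))%C).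
  { unfold c. rewrite <- !trem_step, trem_0 by auto. f_equal. unfold h. ring. }
  assert (E1 : f a = tcoef f a r 0).
  { assert (T := trem_step 0 0 H0r). rewrite (trem_0 0 H0r) in T.
    replace (a + 0)%C with a in T by ring. rewrite T. ring. }
  rewrite E0, E1.
  replace (tcoef f a r 0 + h * (c + h * trem f a r h 2) - tcoef f a r 0 - c * h)%C with (h * (h * trem f a r h 2))%C by ring.
  rewrite !Cmod_mult.
  assert (T := trem_bound h 2 M Hh HM).
  assert (Q := Cmod_ge_0 h).
  assert (Tr : Cmod (trem f a r h 2) <= B).
  { eapply Rle_trans; [exact T|]. unfold B. apply Rmult_le_compat_l.
    - assert (0 < / r) by (apply Rinv_0_lt_compat; lra). simpl. nra.
    - apply Rle_div_l; lra. }
  assert (Q2 := Cmod_ge_0 (trem f a r h 2)). 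
  rewrite (Rmult_comm e). apply Rmult_le_compat_l; auto. nra.
Qed.

(** On the circle, [f] times [circ] has mean 0, hence so has its conjugate. Adding that conjugate to
    the integral for [f' a] replaces [f] by [2 * Re f], whose absolute value integrates to a
    multiple of [Re (f a)] by positivity. This is a Harnack inequality in differential form. *)
Lemma deriv_bound_of_Re_pos : (forall z, Cmod (z - a) < rho -> 0 <= Re (f z)) ->
  Cmod (f' a) <= 2 / r * Re (f a).
Proof.
  intros Hpos. assert (HP := PI_RGT_0).
  assert (Hin : forall t, Cmod (a + RtoC r * circ t - a) < rho).
  { intros t. replace (a + RtoC r * circ t - a)%C with (RtoC r * circ t)%C by ring. rewrite Cmod_rcirc; lra. }
  assert (Cf := continuous_on_circle f f' a rho r Hr Hf).
  assert (Hconj : forall t, Cconj (circ t) = (/ circ t)%C).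
  { intros t. assert (E : (Cconj (circ t) * circ t)%C = RtoC 1).
    { assert (M := Cmod_sqr (circ t)). rewrite Cmod_circ in M. unfold Re, Im in M.
      destruct (circ t) as [x y]. simpl in M.
      apply injective_projections; unfold Cconj, Cmult, RtoC; simpl; lra. } 
    assert (Hn := circ_neq_0 t).
    transitivity (Cconj (circ t) * circ t * / circ t)%C; [field; auto|]. rewrite E. ring. }
  assert (Cci : forall t, continuous (fun t => (/ circ t)%C) t).
  { intros t. apply continuous_Cinv; [apply continuous_circ|apply circ_neq_0]. }
  assert (E1 : CInt (fun t => (f (a + RtoC r * circ t) * / circ t)%C) 0 (2 * PI) = (RtoC (2 * PI) * RtoC r * f' a)%C).
  { rewrite <- tcoef_1. unfold tcoef.
    rewrite (CInt_ext (fun t => (f (a + RtoC r * circ t) * / circ t)%C) (fun t => (RtoC r * (f (a + RtoC r * circ t) * (/ (RtoC r * circ t)) ^ 1))%C)).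
    - rewrite CInt_scal by apply continuous_tcoef_integrand. field. apply two_PI_neq_0.
    - intros t. simpl. field. split; [apply circ_neq_0|apply RtoC_neq_0; lra]. }
  (* The mean value property of [(z - a) * f z], which vanishes at [a]. *)
  assert (E2 : CInt (fun t => (f (a + RtoC r * circ t) * circ t)%C) 0 (2 * PI) = RtoC 0).
  { assert (K := circle_mean (fun z => ((z - a) * f z)%C) (fun z => (1 * f z + (z - a) * f' z)%C) a rho r Hr).
    cbv beta in K. 
    assert (K1 : CInt (fun t => ((a + RtoC r * circ t - a) * f (a + RtoC r * circ t))%C) 0 (2 * PI) = RtoC 0).
    { rewrite K; [ring| |].
      - intros z Hz. apply (cder_mult (fun z => (z - a)%C) f); auto. eapply cder_eq; [apply cder_minus; [apply cder_id|apply cder_const]|]. ring.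
      - intros z Hz. apply continuous_Cplus; apply continuous_Cmult; auto.
        + apply continuous_const. + eapply cder_continuous, Hf; auto.
        + apply continuous_Cminus; [apply continuous_id|apply continuous_const]. }
    rewrite (CInt_ext _ (fun t => (RtoC r * (f (a + RtoC r * circ t) * circ t))%C)) in K1 by (intros; ring).
    rewrite CInt_scal in K1.
    - transitivity (/ RtoC r * (RtoC r * CInt (fun t => (f (a + RtoC r * circ t) * circ t)%C) 0 (2 * PI)))%C.
      + field. apply RtoC_neq_0; lra.
      + rewrite K1. ring.
    - intros t. apply continuous_Cmult; [apply Cf|apply continuous_circ]. }
  assert (E3 : CInt (fun t => (RtoC (2 * Re (f (a + RtoC r * circ t)%C)) * / circ t)%C) 0 (2 * PI) = (RtoC (2 * PI) * RtoC r * f' a)%C).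
  { assert (E2' : CInt (fun t => (Cconj (f (a + RtoC r * circ t)) * / circ t)%C) 0 (2 * PI) = RtoC 0).
    { assert (J : forall g : R -> C, (forall t, continuous g t) ->
        CInt (fun t => Cconj (g t)) 0 (2 * PI) = Cconj (CInt g 0 (2 * PI))).
      { intros g Hg. unfold CInt, Cconj, Re, Im; simpl. f_equal.
        apply (RInt_opp (V := R_CompleteNormedModule) (fun t => snd (g t))).
        apply (ex_RInt_Im g); auto. }
      rewrite (CInt_ext _ (fun t => Cconj (f (a + RtoC r * circ t) * circ t)%C)).
      - rewrite J, E2; [unfold Cconj, RtoC; simpl; f_equal; ring|].
        intros t. apply continuous_Cmult; [apply Cf|apply continuous_circ].
      - intros t. rewrite <- Hconj. unfold Cconj, Cmult; simpl. f_equal; ring. }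
    rewrite <- E1. 
    transitivity (CInt (fun t => (f (a + RtoC r * circ t) * / circ t)%C) 0 (2 * PI) + CInt (fun t => (Cconj (f (a + RtoC r * circ t)) * / circ t)%C) 0 (2 * PI))%C.
    - rewrite <- CInt_plus.
      + apply CInt_ext. intros t. rewrite <- Cmult_plus_distr_r. f_equal.
        unfold Cconj, Cplus, RtoC, Re; simpl. f_equal; ring.
      + intros t. apply continuous_Cmult; auto.
      + intros t. apply continuous_Cmult; auto.
        apply continuous_C_iff. unfold Cconj, Re, Im; simpl. split.
        * exact (continuous_Re _ _ (Cf t)).
        * apply (continuous_opp (fun t => snd (f (a + RtoC r * circ t)%C))). exact (continuous_Im _ _ (Cf t)).
    - rewrite E2'. ring. }
  assert (Em := circle_mean f f' a rho r Hr Hf Hf').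
  assert (K := CInt_norm_RInt (fun t => (RtoC (2 * Re (f (a + RtoC r * circ t)%C)) * / circ t)%C)
     (fun t => 2 * Re (f (a + RtoC r * circ t)%C)) 0 (2 * PI) ltac:(lra)).
  assert (Cr : forall t, continuous (fun t => 2 * Re (f (a + RtoC r * circ t)%C)) t).
  { intros t. apply (continuous_mult (K := R_AbsRing)); [apply continuous_const|]. apply continuous_Re, Cf. }
  rewrite E3 in K. rewrite !Cmod_mult, !Cmod_R, !Rabs_pos_eq in K by lra.
  assert (K' : 2 * PI * r * Cmod (f' a) <= RInt (fun t => 2 * Re (f (a + RtoC r * circ t)%C)) 0 (2 * PI)).
  { apply K; auto.
    - intros t. apply continuous_Cmult; auto. now apply continuous_RtoC.
    - apply (ex_RInt_continuous (V := R_CompleteNormedModule)). auto.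
    - intros t _. rewrite Cmod_mult, Cmod_inv, Cmod_circ, Cmod_R by apply circ_neq_0.
      rewrite Rabs_pos_eq; [lra|]. specialize (Hpos _ (Hin t)). lra. }
  assert (Es : RInt (fun t => 2 * Re (f (a + RtoC r * circ t)%C)) 0 (2 * PI) = 2 * RInt (fun t => Re (f (a + RtoC r * circ t)%C)) 0 (2 * PI)).
  { apply (RInt_scal (V := R_CompleteNormedModule) (fun t => Re (f (a + RtoC r * circ t)%C))).
    apply (ex_RInt_Re (fun t => f (a + RtoC r * circ t)%C)). exact Cf. }
  assert (Em1 : RInt (fun t => Re (f (a + RtoC r * circ t)%C)) 0 (2 * PI) = Re (RtoC (2 * PI) * f a)).
  { rewrite <- Em. reflexivity. }
  rewrite Es, Em1 in K'.
  replace (Re (RtoC (2 * PI) * f a)) with (2 * PI * Re (f a)) in K' by (unfold Re, Cmult, RtoC; simpl; ring).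
  apply Rmult_le_reg_l with (2 * PI * r); [nra|].
  replace (2 * PI * r * (2 / r * Re (f a))) with (2 * (2 * PI * Re (f a))) by (field; lra). lra.
Qed.
End Taylor.

(** The integral [tcoef] of index 1 as a linear functional of the boundary values, so that a
    difference of derivatives at two centres becomes one integral over corresponding boundary
    points. *)
Definition dmean (r : R) (u : R -> C) : C :=
  (/ RtoC (2 * PI) * CInt (fun t => u t * (/ (RtoC r * circ t)) ^ 1) 0 (2 * PI))%C.

Lemma continuous_dmean_integrand r u t : 0 < r -> continuous u t ->
  continuous (fun t => (u t * (/ (RtoC r * circ t)) ^ 1)%C) t.
Proof. intros Hr Hu. apply continuous_Cmult; auto. now apply continuous_Cpow, continuous_rcirc_inv. Qed.

Lemma dmean_minus r u v : 0 < r -> (forall t, continuous u t) -> (forall t, continuous v t) ->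
  (dmean r u - dmean r v)%C = dmean r (fun t => (u t - v t)%C).
Proof.
  intros Hr Hu Hv. unfold dmean.
  rewrite (CInt_ext (fun t => ((u t - v t) * (/ (RtoC r * circ t)) ^ 1)%C)
    (fun t => (u t * (/ (RtoC r * circ t)) ^ 1 - v t * (/ (RtoC r * circ t)) ^ 1)%C)) by (intros; ring).
  rewrite CInt_minus by (intros; now apply continuous_dmean_integrand). ring.
Qed.

Lemma dmean_scal r c u : 0 < r -> (forall t, continuous u t) ->
  (dmean r u * c)%C = dmean r (fun t => (u t * c)%C).
Proof.
  intros Hr Hu. unfold dmean.
  rewrite (CInt_ext (fun t => (u t * c * (/ (RtoC r * circ t)) ^ 1)%C)
    (fun t => (c * (u t * (/ (RtoC r * circ t)) ^ 1))%C)) by (intros; ring).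
  rewrite CInt_scal by (intros; now apply continuous_dmean_integrand). ring.
Qed.

Lemma dmean_bound r u K : 0 < r -> (forall t, continuous u t) -> (forall t, Cmod (u t) <= K) ->
  Cmod (dmean r u) <= K / r.
Proof.
  intros Hr Hu HK. assert (HP := PI_RGT_0). assert (Pr := Rinv_0_lt_compat r Hr). unfold dmean.
  rewrite Cmod_mult, Cmod_inv by apply two_PI_neq_0. rewrite Cmod_R, Rabs_pos_eq by lra.
  assert (Q : Cmod (CInt (fun t => (u t * (/ (RtoC r * circ t)) ^ 1)%C) 0 (2 * PI)) <= (2 * PI - 0) * (K / r)).
  { apply CInt_norm; [lra|intros; now apply continuous_dmean_integrand|].
    intros t _. rewrite Cmod_mult, Cmod_pow, Cmod_rcirc_inv by lra. rewrite pow_1.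
    apply Rmult_le_compat_r; [lra|apply HK]. }
  apply Rmult_le_reg_l with (2 * PI); [lra|].
  rewrite <- Rmult_assoc, Rinv_r, Rmult_1_l by lra. lra.
Qed.

(** Express [f' p] and [f' q] by circles of the same radius [r]. One is a translate of the other by
    [q - p], so corresponding boundary values differ by at most [M] times that distance, and the
    integral contributes [/ r]. *)
Lemma deriv_lipschitz (f f' : C -> C) (p q : C) (rho r M : R) : 0 < r < rho -> Cmod (q - p) < rho - r ->
  (forall z, Cmod (z - p) < rho -> cder f z (f' z)) ->
  (forall z, Cmod (z - p) < rho -> continuous f' z) ->
  (forall z, Cmod (z - p) < rho -> Cmod (f' z) <= M) ->
  Cmod (f' q - f' p) <= M / r * Cmod (q - p).
Proof.
  intros Hr Hq Hf Hf' HM.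
  set (d := Cmod (q - p)) in *. assert (Hd0 : 0 <= d) by apply Cmod_ge_0.
  assert (Hq' : 0 < r < rho - d) by lra.
  assert (Hfq : forall z, Cmod (z - q) < rho - d -> Cmod (z - p) < rho).
  { intros z Hz. assert (T := Cmod_tri z q p). fold d in T. lra. }
  rewrite <- (tcoef_1 f f' p rho r Hr Hf Hf').
  rewrite <- (tcoef_1 f f' q (rho - d) r Hq' (fun z Hz => Hf z (Hfq z Hz)) (fun z Hz => Hf' z (Hfq z Hz))).
  assert (Cp := continuous_on_circle f f' p rho r Hr Hf).
  assert (Cq := continuous_on_circle f f' q (rho - d) r Hq' (fun z Hz => Hf z (Hfq z Hz))).
  change (Cmod (dmean r (fun t => f (q + RtoC r * circ t)%C) - dmean r (fun t => f (p + RtoC r * circ t)%C)) <= M / r * d).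
  rewrite dmean_minus by (auto; lra). replace (M / r * d) with (M * d / r) by (field; lra).
  apply dmean_bound; [lra|intros; now apply continuous_Cminus|]. intros t.
  replace d with (Cmod (q + RtoC r * circ t - (p + RtoC r * circ t))) by (unfold d; f_equal; ring).
  assert (Hin : forall s, 0 <= s <= 1 -> Cmod (p + RtoC r * circ t + RtoC s * (q + RtoC r * circ t - (p + RtoC r * circ t)) - p) < rho).
  { intros s Hs. replace (p + RtoC r * circ t + RtoC s * (q + RtoC r * circ t - (p + RtoC r * circ t)) - p)%C
      with (RtoC r * circ t + RtoC s * (q - p))%C by ring.
    eapply Rle_lt_trans; [apply Cmod_triangle|]. rewrite Cmod_rcirc, Cmod_scal, Rabs_pos_eq by lra.
    fold d. nra. }
  apply (mean_value_segment f f'); intros s Hs; auto.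
Qed.

(** * Entire functions *)

Lemma Cmod_plus_cancel (a h : C) : Cmod (a + h - a) = Cmod h.
Proof. f_equal. ring. Qed.

Lemma bounded_on_disc (f : C -> C) (r : R) : (forall z, continuous f z) ->
  exists M, forall z, Cmod z <= r -> Cmod (f z) <= M.
Proof.
  intros Hf.
  (* A radius on which [|f| <= 1 / radius]: the uniform lower bound for such radii given by
     compactness is at the same time a bound for [f]. *)
  assert (Hp : forall p, exists e : posreal, forall z, Cmod (z - p) < 2 * e -> Cmod (f z) <= / e).
  { intros p. destruct (proj1 (continuous_C_eps _ _) (Hf p) 1 Rlt_0_1) as [d [Hd K]].
    assert (Q := Cmod_ge_0 (f p)).
    assert (He : 0 < Rmin (d / 2) (/ (Cmod (f p) + 1))) by (apply Rmin_pos; [lra|apply Rinv_0_lt_compat; lra]).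
    exists (mkposreal _ He). simpl. intros z Hz.
    assert (M1 := Rmin_l (d / 2) (/ (Cmod (f p) + 1))). assert (M2 := Rmin_r (d / 2) (/ (Cmod (f p) + 1))).
    specialize (K z ltac:(lra)). assert (T := Cmod_rev (f z) (f p)).
    apply Rinv_le_contravar in M2; [|exact He]. rewrite Rinv_inv in M2. lra. }
  set (delta := fun u v : R => proj1_sig (constructive_indefinite_description _ (Hp (u, v)))).
  destruct (compactness_value_2d (- r) r (- r) r delta) as [d Hd].
  exists (/ d). intros z Hz. apply Rnot_lt_le. intros Hlt.
  assert (R1 := Re_le_Cmod z). assert (R2 := Im_le_Cmod z). apply Rabs_le_between in R1, R2.
  apply (Hd (Re z) (Im z)); [lra|lra|].
  intros [u [v [_ [_ [H1 [H2 H3]]]]]].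
  unfold delta in *. destruct (constructive_indefinite_description _ (Hp (u, v))) as [e He]. simpl in *.
  assert (K := Cmod_le_Re_Im (z - (u, v))).
  change (Re (z - (u, v))) with (Re z - u) in K. change (Im (z - (u, v))) with (Im z - v) in K.
  specialize (He z ltac:(lra)). apply Rinv_le_contravar in H3; [lra|apply cond_pos].
Qed.

(** A primitive [F] of [f] is continuously differentiable, so Cauchy's formula for [F' = f] applies;
    differentiating it under the integral sign gives a formula for [f'] in terms of [f]. *)
Lemma entire_C1 (f : C -> C) : (forall z, exists l, cder f z l) ->
  exists f', (forall z, cder f z (f' z)) /\ (forall z, continuous f' z).
Proof.
  intros Hd.
  assert (Hf : forall z, continuous f z).
  { intros z. destruct (Hd z) as [l Hl]. now apply cder_continuous in Hl. }
  destruct (entire_primitive f Hd) as [F HF].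
  assert (Lip : forall p, exists M, 0 <= M /\ forall q q', Cmod (q - p) <= 2 -> Cmod (q' - q) < 1 -> Cmod (f q' - f q) <= M * Cmod (q' - q)).
  { intros p. assert (Q := Cmod_ge_0 p). destruct (bounded_on_disc f (Cmod p + 5)) as [M HM]; auto.
    exists M. split.
    { eapply Rle_trans; [apply Cmod_ge_0|apply (HM 0)]. rewrite Cmod_0. lra. }
    intros q q' Hq Hqq. replace M with (M / 1) by field.
    apply (deriv_lipschitz F f q q' 2 1 M); auto; try lra.
    intros z Hz. apply HM. assert (T := Cmod_tri z q p).
    assert (T2 := Cmod_rev z p). lra. }
  set (pt := fun (p : C) t => (p + RtoC 1 * circ t)%C).
  assert (Hcirc : forall (g : C -> C) (p : C), (forall z, continuous g z) -> forall t, continuous (fun t => g (pt p t)) t).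
  { intros g p Hg t. apply (continuous_comp (pt p) g); auto.
    apply continuous_Cplus; [apply continuous_const|apply continuous_rcirc]. }
  assert (HFc : forall z, continuous F z) by (intros z; eapply cder_continuous, HF).
  assert (EF : forall p, f p = dmean 1 (fun t => F (pt p t))).
  { intros p. symmetry. apply (tcoef_1 F f p 2 1); auto; lra. }
  assert (Hin : forall p t, Cmod (pt p t - p) <= 2).
  { intros. unfold pt. rewrite Cmod_plus_cancel, Cmod_rcirc; lra. }
  assert (Hsub : forall p w t, (pt w t - pt p t)%C = (w - p)%C) by (intros; unfold pt; ring).
  assert (P1 := Rlt_0_1).
  exists (fun p => dmean 1 (fun t => f (pt p t))). split.
  - intros p. destruct (Lip p) as [M [HM0 HM]].
    apply cder_eps. intros e He. exists (Rmin 1 (e / (M + 1))). split.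
    { apply Rmin_pos; [lra|]. apply Rdiv_lt_0_compat; lra. }
    intros w Hw.
    destruct (Rlt_Rmin_inv _ _ _ Hw) as [H1 H2].
    apply Rlt_div_r in H2; [|lra].
    assert (Q := Cmod_ge_0 (w - p)).
    assert (C1 : forall t, continuous (fun t => (F (pt w t) - F (pt p t))%C) t) by (intros; now apply continuous_Cminus; apply Hcirc).
    assert (C2 : forall t, continuous (fun t => (f (pt p t) * (w - p))%C) t).
    { intros t. apply continuous_Cmult; [now apply Hcirc|apply continuous_const]. }
    rewrite (EF w), (EF p), dmean_minus, dmean_scal, dmean_minus by auto.
    apply Rle_trans with (M * Cmod (w - p) * Cmod (w - p) / 1); [|nra].
    apply dmean_bound; [lra|intros; now apply continuous_Cminus|]. intros t.
    rewrite <- (Hsub p w t) at 1. rewrite <- (Hsub p w t) at 2.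
    apply mean_value_segment_linear with f; auto.
    intros s Hs. rewrite !Hsub.
    assert (Hsm : Cmod (pt p t + RtoC s * (w - p) - pt p t) <= Cmod (w - p)).
    { rewrite Cmod_plus_cancel, Cmod_scal, Rabs_pos_eq by lra. nra. }
    eapply Rle_trans; [apply HM; [apply Hin|lra]|]. now apply Rmult_le_compat_l.
  - intros p. destruct (Lip p) as [M [HM0 HM]]. apply continuous_C_eps. intros e He.
    exists (Rmin 1 (e / (M + 1))). split.
    { apply Rmin_pos; [lra|]. apply Rdiv_lt_0_compat; lra. }
    intros w Hw.
    destruct (Rlt_Rmin_inv _ _ _ Hw) as [H1 H2].
    apply Rlt_div_r in H2; [|lra].
    assert (Q := Cmod_ge_0 (w - p)).
    rewrite dmean_minus by auto.
    apply Rle_lt_trans with (M * Cmod (w - p) / 1); [|nra].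
    apply dmean_bound; [lra|intros; now apply continuous_Cminus; apply Hcirc|]. intros t.
    rewrite <- (Hsub p w t). apply HM; [apply Hin|]. now rewrite Hsub.
Qed.

Fixpoint peval (l : list C) (z : C) : C :=
  match l with nil => RtoC 0 | cons c l' => (c + z * peval l' z)%C end.

Section EntireC1.
Variables f f' : C -> C.
Hypothesis Hf : forall z, cder f z (f' z).
Hypothesis Hf' : forall z, continuous f' z.

Lemma entire_trem_0 a r h : Cmod h < r -> trem f a r h 0 = f (a + h)%C.
Proof.
  intros H. assert (Q := Cmod_ge_0 h). apply (trem_0 f f' a (r + 1) r); auto; lra.
Qed.

Lemma entire_trem_step a r h n : Cmod h < r -> trem f a r h n = (tcoef f a r n + h * trem f a r h (S n))%C.
Proof. intros H. assert (Q := Cmod_ge_0 h). apply (trem_step f f' a (r + 1) r); auto; lra. Qed.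

Lemma entire_circle_bounded a r : 0 < r -> exists M, 0 <= M /\ forall z, Cmod (z - a) = r -> Cmod (f z) <= M.
Proof. intros H. apply (circle_bounded f f' a (r + 1) r); auto; lra. Qed.

Lemma entire_trem_bound a r h n M : Cmod h < r -> (forall z, Cmod (z - a) = r -> Cmod (f z) <= M) ->
  Cmod (trem f a r h n) <= M * (/ r) ^ n * (r / (r - Cmod h)).
Proof. intros H. assert (Q := Cmod_ge_0 h). apply (trem_bound f f' a (r + 1) r); auto; lra. Qed.

Lemma entire_trem_bounded a r n : 0 < r -> exists B, 0 <= B /\ forall h, Cmod h <= r / 2 -> Cmod (trem f a r h n) <= B.
Proof.
  intros Hr. destruct (entire_circle_bounded a r Hr) as [M [HM0 HM]].
  assert (P : 0 < (/ r) ^ n) by (apply pow_lt, Rinv_0_lt_compat; lra).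
  exists (M * (/ r) ^ n * 2). split; [nra|]. intros h Hh.
  eapply Rle_trans; [apply entire_trem_bound; [lra|exact HM]|].
  apply Rmult_le_compat_l; [nra|]. apply Rle_div_l; lra.
Qed.

(** Remainders that agree for small nonzero [h] have equal coefficients, by letting [h] tend to 0;
    cancelling these and dividing by [h] gives equality of the next remainders. The induction starts
    at order 0, where both remainders are [f (a + h)]. *)
Lemma tcoef_radius a r r' : 0 < r -> 0 < r' -> forall n, tcoef f a r n = tcoef f a r' n.
Proof.
  intros Hr Hr'. set (m := Rmin r r'). assert (Hm : 0 < m) by now apply Rmin_pos.
  assert (M1 : m <= r) by apply Rmin_l. assert (M2 : m <= r') by apply Rmin_r.
  assert (Step : forall n, (forall h, h <> RtoC 0 -> Cmod h < m -> trem f a r h n = trem f a r' h n) ->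
    tcoef f a r n = tcoef f a r' n).
  { intros n H. apply NNPP. intros Hn. apply Cminus_eq_contra, Cmod_gt_0 in Hn.
    set (e := Cmod (tcoef f a r n - tcoef f a r' n)) in *.
    destruct (entire_trem_bounded a r (S n) Hr) as [B [HB0 HB]].
    destruct (entire_trem_bounded a r' (S n) Hr') as [B' [HB0' HB']].
    set (x := Rmin (m / 4) (e / (2 * (B + B' + 1)))).
    assert (Hx : 0 < x). { apply Rmin_pos; [lra|]. apply Rdiv_lt_0_compat; lra. }
    assert (Hx1 : x <= m / 4) by apply Rmin_l.
    assert (Hx2 : x <= e / (2 * (B + B' + 1))) by apply Rmin_r.
    apply Rle_div_r in Hx2; [|lra].
    assert (Mx : Cmod (RtoC x) = x) by (rewrite Cmod_R, Rabs_pos_eq; lra).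
    assert (E := H (RtoC x) (RtoC_neq_0 x Hx) ltac:(lra)).
    rewrite (entire_trem_step a r (RtoC x) n), (entire_trem_step a r' (RtoC x) n) in E by lra.
    specialize (HB (RtoC x) ltac:(lra)). specialize (HB' (RtoC x) ltac:(lra)).
    assert (Ed : (tcoef f a r n - tcoef f a r' n)%C = (RtoC x * (trem f a r' (RtoC x) (S n) - trem f a r (RtoC x) (S n)))%C).
    { transitivity ((tcoef f a r n + RtoC x * trem f a r (RtoC x) (S n)) - RtoC x * trem f a r (RtoC x) (S n) - tcoef f a r' n)%C; [ring|].
      rewrite E. ring. }
    assert (Ke : e <= x * (B' + B)).
    { unfold e. rewrite Ed, Cmod_scal, Rabs_pos_eq by lra. apply Rmult_le_compat_l; [lra|].
      eapply Rle_trans; [apply Cmod_minus_le|]. lra. }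
    nra. }
  assert (Main : forall n h, h <> RtoC 0 -> Cmod h < m -> trem f a r h n = trem f a r' h n).
  { induction n; intros h Hh Hhm.
    - rewrite !entire_trem_0 by lra. reflexivity.
    - assert (E := IHn h Hh Hhm). rewrite (entire_trem_step a r h n), (entire_trem_step a r' h n), (Step n IHn) in E by lra.
      transitivity (/ h * (tcoef f a r' n + h * trem f a r h (S n) - tcoef f a r' n))%C; [field; auto|].
      rewrite E. field; auto. }
  intros n. apply Step, Main.
Qed.

(** The remainder equals [h ^ k] times the remainder of order [N + k] for every [k], and Cauchy's
    bound on the latter leaves a factor of at most [(1 / 2) ^ k]. *)
Lemma trem_vanish a r h N : 2 * Cmod h < r -> (forall n, (N <= n)%nat -> tcoef f a r n = RtoC 0) ->
  trem f a r h N = RtoC 0.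
Proof.
  intros Hh H. assert (Q := Cmod_ge_0 h).
  destruct (entire_circle_bounded a r ltac:(lra)) as [M [HM0 HM]].
  assert (E : forall k, trem f a r h N = (h ^ k * trem f a r h (N + k))%C).
  { induction k.
    - rewrite Nat.add_0_r. simpl. ring.
    - rewrite IHk, (entire_trem_step a r h (N + k)), H by (lra || lia). rewrite Nat.add_succ_r. simpl. ring. }
  apply Cmod_eq_0, Rle_antisym; [|apply Cmod_ge_0]. apply Rnot_lt_le. intros Hpos.
  assert (Pr : 0 < / r) by (apply Rinv_0_lt_compat; lra).
  assert (PN : 0 < (/ r) ^ N) by now apply pow_lt.
  destruct (pow_half_small (M * (/ r) ^ N * 2) _ Hpos) as [k Hk]. specialize (Hk k ltac:(lia)).
  rewrite (E k), Cmod_mult, Cmod_pow in Hk.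
  assert (B := entire_trem_bound a r h (N + k) M ltac:(lra) HM).
  rewrite pow_add in B.
  assert (B2 : r / (r - Cmod h) <= 2) by (apply Rle_div_l; lra).
  assert (B3 : Cmod h ^ k * (/ r) ^ k <= (1 / 2) ^ k).
  { rewrite <- Rpow_mult_distr. apply pow_incr. split; [nra|]. apply Rle_div_l; lra. }
  assert (P1 : 0 <= Cmod h ^ k) by now apply pow_le.
  assert (P2 : 0 < (/ r) ^ k) by now apply pow_lt.
  assert (B4 : Cmod (trem f a r h (N + k)) <= M * ((/ r) ^ N * (/ r) ^ k) * 2).
  { eapply Rle_trans; [exact B|]. apply Rmult_le_compat_l; auto. apply Rmult_le_pos; [lra|nra]. }
  assert (B5 : Cmod h ^ k * Cmod (trem f a r h (N + k)) <= Cmod h ^ k * (M * ((/ r) ^ N * (/ r) ^ k) * 2)) by now apply Rmult_le_compat_l.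
  assert (B6 : Cmod h ^ k * (M * ((/ r) ^ N * (/ r) ^ k) * 2) <= M * (/ r) ^ N * 2 * (1 / 2) ^ k).
  { replace (Cmod h ^ k * (M * ((/ r) ^ N * (/ r) ^ k) * 2)) with (M * (/ r) ^ N * 2 * (Cmod h ^ k * (/ r) ^ k)) by ring.
    apply Rmult_le_compat_l; [nra|exact B3]. }
  lra.
Qed.

Lemma polynomial_of_tcoef N : (forall n, (N <= n)%nat -> tcoef f 0 1 n = RtoC 0) ->
  exists l, forall z, f z = peval l z.
Proof.
  intros H. exists (map (tcoef f 0 1) (seq 0 N)). intros z.
  set (r := 2 * Cmod z + 1). assert (Q := Cmod_ge_0 z).
  assert (Hz : Cmod z < r) by (unfold r; lra).
  assert (E : forall k m, trem f 0 r z (m + k) = RtoC 0 -> trem f 0 r z m = peval (map (tcoef f 0 1) (seq m k)) z).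
  { induction k; intros m Hm.
    - rewrite Nat.add_0_r in Hm. now rewrite Hm.
    - simpl. rewrite <- IHk.
      + rewrite entire_trem_step by exact Hz. f_equal. apply tcoef_radius; lra.
      + replace (S m + k)%nat with (m + S k)%nat by lia. exact Hm. }
  rewrite <- E.
  - rewrite entire_trem_0 by exact Hz. f_equal. ring.
  - simpl. apply trem_vanish; [unfold r; lra|]. intros n Hn. rewrite (tcoef_radius 0 r 1); auto; lra.
Qed.

Hypothesis Htr : ~ exists l, forall z, f z = peval l z.

Lemma transcendental_tcoef N : exists n, (N <= n)%nat /\ tcoef f 0 1 n <> RtoC 0.
Proof.
  apply NNPP. intros H. apply Htr, (polynomial_of_tcoef N). intros n Hn.
  apply NNPP. intros Hc. apply H. now exists n.
Qed.

(** A nonzero coefficient of index at least 3 violates Cauchy's bound [r^2 * r^(-3)] once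
    [r >= 2 / c]. The square turns into the doubling of real parts in logarithmic coordinates. *)
Lemma transcendental_growth : exists r0, 1 <= r0 /\ forall r, r0 <= r -> exists z, Cmod z = r /\ r * r <= Cmod (f z).
Proof.
  destruct (transcendental_tcoef 3) as [n [Hn Hc]]. apply Cmod_gt_0 in Hc.
  set (c := Cmod (tcoef f 0 1 n)) in *.
  exists (Rmax 1 (2 / c)). split; [apply Rmax_l|]. intros r Hr.
  assert (H1 := Rle_trans _ _ _ (Rmax_l _ _) Hr). assert (H2 := Rle_trans _ _ _ (Rmax_r _ _) Hr).
  apply Rle_div_l in H2; [|lra].
  apply NNPP. intros Hno.
  assert (HM : forall z, Cmod (z - 0) = r -> Cmod (f z) <= r * r).
  { intros z Hz. apply Rnot_lt_le. intros Hlt. apply Hno. exists z. split; [|lra].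
    rewrite <- Hz. f_equal. ring. }
  assert (B := tcoef_bound f f' 0 (r + 1) r ltac:(lra) (fun z _ => Hf z) n (r * r) HM).
  rewrite (tcoef_radius 0 r 1) in B by lra. fold c in B.
  assert (Pr : 0 < / r) by (apply Rinv_0_lt_compat; lra).
  assert (P : (/ r) ^ n <= (/ r) ^ 3).
  { replace n with (3 + (n - 3))%nat by lia. rewrite pow_add.
    assert ((/ r) ^ (n - 3) <= 1).
    { rewrite <- (pow1 (n - 3)). apply pow_incr. split; [lra|]. rewrite <- Rinv_1. apply Rinv_le_contravar; lra. }
    assert (0 < (/ r) ^ 3) by now apply pow_lt. nra. }
  assert (B2 : c <= r * r * (/ r) ^ 3). { eapply Rle_trans; [exact B|]. apply Rmult_le_compat_l; nra. }
  replace (r * r * (/ r) ^ 3) with (/ r) in B2 by (field; lra).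
  assert (c * r <= 1). { replace 1 with (/ r * r) by (field; lra). apply Rmult_le_compat_r; lra. }
  lra.
Qed.

Lemma least_nat (P : nat -> Prop) : (exists n, P n) -> exists n, P n /\ forall m, (m < n)%nat -> ~ P m.
Proof.
  intros [n Hn]. revert Hn. induction n as [n IH] using (well_founded_induction Wf_nat.lt_wf). intros Hn.
  destruct (classic (exists m, (m < n)%nat /\ P m)) as [[m [Hm HP]]|Hno].
  - exact (IH m Hm HP).
  - exists n. split; auto. intros m Hm HP. apply Hno. now exists m.
Qed.

(** The first nonzero coefficient of positive index dominates the remainder near [a]; if there is
    none, [f] is constant, against [Htr]. *)
Lemma isolated_value a : exists d, 0 < d /\ forall h, h <> RtoC 0 -> Cmod h < d -> f (a + h)%C <> f a.
Proof.
  destruct (classic (exists n, (1 <= n)%nat /\ tcoef f a 1 n <> RtoC 0)) as [Hex|Hno].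
  - destruct (least_nat _ Hex) as [n [[Hn Hc] Hleast]].
    destruct (entire_trem_bounded a 1 (S n) Rlt_0_1) as [B [HB0 HB]].
    assert (Hc0 := proj1 (Cmod_gt_0 _) Hc).
    exists (Rmin (1 / 2) (Cmod (tcoef f a 1 n) / (B + 1))). split.
    { apply Rmin_pos; [lra|]. apply Rdiv_lt_0_compat; lra. }
    intros h Hh Hhd E.
    destruct (Rlt_Rmin_inv _ _ _ Hhd) as [H1 H2].
    apply Rlt_div_r in H2; [|lra].
    assert (E0 : f a = tcoef f a 1 0).
    { assert (T := entire_trem_step a 1 0 0 ltac:(rewrite Cmod_0; lra)).
      rewrite entire_trem_0 in T by (rewrite Cmod_0; lra). replace (a + 0)%C with a in T by ring. rewrite T. ring. }
    assert (Ek : forall k, (S k <= n)%nat -> trem f a 1 h 1 = (h ^ k * trem f a 1 h (S k))%C).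
    { induction k; intros Hk; [simpl; ring|].
      rewrite IHk by lia. rewrite (entire_trem_step a 1 h (S k)) by lra.
      replace (tcoef f a 1 (S k)) with (RtoC 0).
      - simpl. ring.
      - symmetry. apply NNPP. intros Hk0. apply (Hleast (S k)); [lia|]. split; [lia|exact Hk0]. }
    assert (E1 : (h * trem f a 1 h 1)%C = RtoC 0).
    { assert (T := entire_trem_step a 1 h 0 ltac:(lra)). rewrite entire_trem_0, E, E0 in T by lra.
      transitivity (tcoef f a 1 0 + h * trem f a 1 h 1 - tcoef f a 1 0)%C; [ring|]. rewrite <- T. ring. }
    rewrite (Ek (n - 1)%nat) in E1 by lia. replace (S (n - 1)) with n in E1 by lia.
    assert (E2 : trem f a 1 h n = RtoC 0).
    { apply NNPP. intros Hnz. apply (Cmult_neq_0 h (h ^ (n - 1) * trem f a 1 h n)); auto.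
      apply Cmult_neq_0; auto. now apply Cpow_nz. }
    rewrite entire_trem_step in E2 by lra.
    assert (E3 : tcoef f a 1 n = (- (h * trem f a 1 h (S n)))%C).
    { transitivity ((tcoef f a 1 n + h * trem f a 1 h (S n)) - h * trem f a 1 h (S n))%C; [ring|]. rewrite E2. ring. }
    rewrite E3, Cmod_opp, Cmod_mult in H2. specialize (HB h ltac:(lra)).
    assert (Q := proj1 (Cmod_gt_0 _) Hh). nra.
  - exfalso. apply Htr. exists (f a :: nil). intros z.
    set (h := (z - a)%C). set (r := 2 * Cmod h + 1). assert (Q := Cmod_ge_0 h).
    assert (T := entire_trem_step a r h 0 ltac:(unfold r; lra)).
    rewrite (trem_vanish a r h 1) in T.
    + assert (T0 := entire_trem_step a r 0 0 ltac:(rewrite Cmod_0; unfold r; lra)).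
      rewrite entire_trem_0 in T by (unfold r; lra). rewrite entire_trem_0 in T0 by (rewrite Cmod_0; unfold r; lra).
      replace (a + h)%C with z in T by (unfold h; ring). replace (a + 0)%C with a in T0 by ring.
      simpl. rewrite T, T0. ring.
    + unfold r; lra.
    + intros n Hn. apply NNPP. intros Hc. apply Hno. exists n. split; auto.
      rewrite (tcoef_radius a 1 r); auto; unfold r; lra.
Qed.

(** If [w] is omitted, [/ (f - w)] is holomorphic on the disc and at its centre is bounded by its
    maximum on the circle. With [|f - f a| >= m] on the circle and [w] within [m / 3] of [f a], the
    denominator is at least [2 * m / 3] on the circle but less than [m / 3] at the centre. *)
Lemma open_mapping a e : 0 < e -> exists d, 0 < d /\ forall w, Cmod (w - f a) < d -> exists z, Cmod (z - a) < e /\ f z = w.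
Proof.
  intros He. destruct (isolated_value a) as [d0 [Hd0 Hiso]].
  set (rho := Rmin e d0). assert (Hrho : 0 < rho) by now apply Rmin_pos.
  assert (R1 : rho <= e) by apply Rmin_l. assert (R2 : rho <= d0) by apply Rmin_r.
  set (r := rho / 2). assert (Hr : 0 < r < rho) by (unfold r; lra).
  assert (HP := PI_RGT_0).
  set (g := fun z => (f z - f a)%C).
  assert (Hg : forall z, cder g z (f' z)).
  { intros z. eapply cder_eq; [apply cder_minus; [apply Hf|apply cder_const]|]. ring. }
  assert (Hmin : exists m, 0 < m /\ forall z, Cmod (z - a) = r -> m <= Cmod (g z)).
  { assert (Hgn : forall z, Cmod (z - a) = r -> g z <> RtoC 0).
    { intros z Hz E. unfold g in E. apply (Hiso (z - a)%C).
      - apply Cmod_gt_0. lra. - lra.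
      - replace (a + (z - a))%C with z by ring. apply Ceq_minus. exact E. }
    set (gi := fun z => (/ g z)%C).
    destruct (continuity_ab_maj (fun t => Cmod (gi (a + RtoC r * circ t)%C)) (- PI) PI) as [t0 [H0 _]].
    { lra. }
    { intros t _. apply continuity_pt_of_continuous, continuous_Cmod.
      apply (continuous_Cinv (fun t => g (a + RtoC r * circ t)%C)).
      - apply (continuous_on_circle g f' a rho r Hr). auto.
      - apply Hgn. rewrite Cmod_plus_cancel. apply Cmod_rcirc. lra. }
    set (z0 := (a + RtoC r * circ t0)%C) in *.
    assert (Hz0 : Cmod (z0 - a) = r) by (unfold z0; rewrite Cmod_plus_cancel; apply Cmod_rcirc; lra).
    assert (Hg0 := proj1 (Cmod_gt_0 _) (Hgn z0 Hz0)).
    exists (Cmod (g z0)). split; auto. intros z Hz.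
    destruct (circle_param a z r) as [t [Ht Ez]]; [lra|exact Hz|].
    assert (Hle := H0 t Ht). rewrite <- Ez in Hle.
    unfold gi in Hle. rewrite !Cmod_inv in Hle by (apply Hgn; auto).
    assert (Hgz := proj1 (Cmod_gt_0 _) (Hgn z Hz)).
    apply Rnot_lt_le. intros Hlt. apply Rinv_lt_contravar in Hlt; [lra|nra]. }
  destruct Hmin as [m [Hm0 Hm]].
  exists (m / 3). split; [lra|]. intros w Hw. apply NNPP. intros Hno.
  assert (Hnw : forall z, Cmod (z - a) < rho -> (f z - w)%C <> RtoC 0).
  { intros z Hz E. apply Hno. exists z. split; [lra|]. now apply Ceq_minus. }
  set (G := fun z => (/ (f z - w))%C).
  set (G' := fun z => (- f' z / ((f z - w) * (f z - w)))%C).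
  assert (HG : forall z, Cmod (z - a) < rho -> cder G z (G' z)).
  { intros z Hz. apply (cder_inv (fun z => (f z - w)%C)); [|now apply Hnw].
    eapply cder_eq; [apply cder_minus; [apply Hf|apply cder_const]|]. ring. }
  assert (Hfw : forall z, continuous (fun z => (f z - w)%C) z).
  { intros z. apply continuous_Cminus; [eapply cder_continuous, Hf|apply continuous_const]. }
  assert (HG' : forall z, Cmod (z - a) < rho -> continuous G' z).
  { intros z Hz. apply continuous_Cdiv; [now apply continuous_Copp|now apply continuous_Cmult|].
    apply Cmult_neq_0; now apply Hnw. }
  assert (HB : forall z, Cmod (z - a) = r -> Cmod (G z) <= 3 / (2 * m)).
  { intros z Hz. unfold G. rewrite Cmod_inv by (apply Hnw; lra).
    assert (K : 2 * m / 3 <= Cmod (f z - w)).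
    { specialize (Hm z Hz). unfold g in Hm. assert (T := Cmod_tri (f z) w (f a)). lra. }
    replace (3 / (2 * m)) with (/ (2 * m / 3)) by (field; lra).
    apply Rinv_le_contravar; lra. }
  assert (T := trem_bound G G' a rho r Hr HG 0 0 _ ltac:(rewrite Cmod_0; lra) HB).
  rewrite (trem_0 G G' a rho r Hr HG HG') in T by (rewrite Cmod_0; lra).
  replace (a + 0)%C with a in T by ring. rewrite Cmod_0, Rminus_0_r in T. simpl pow in T.
  replace (3 / (2 * m) * 1 * (r / r)) with (3 / (2 * m)) in T by (field; lra).
  unfold G in T. assert (Ha := Hnw a ltac:(rewrite Cmod_diag; lra)).
  rewrite Cmod_inv in T by exact Ha. apply Cmod_gt_0 in Ha. rewrite (Cmod_sym (f a) w) in *.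
  assert (K : / (m / 3) < / Cmod (w - f a)) by (apply Rinv_lt_contravar; nra).
  replace (/ (m / 3)) with (3 / m) in K by (field; lra).
  assert (3 / (2 * m) < 3 / m).
  { apply Rmult_lt_compat_l; [lra|]. apply Rinv_lt_contravar; nra. }
  lra.
Qed.
End EntireC1.


(** * Local inversion by Newton's iteration *)

Section Newton.
Variables (f f' : C -> C) (p A : C) (r : R).
Hypothesis Hr : 0 < r.
Hypothesis HA : A <> RtoC 0.
Hypothesis Hf : forall z, Cmod (z - p) < r -> cder f z (f' z).
Hypothesis HfA : forall z, Cmod (z - p) < r -> Cmod (f' z - A) <= Cmod A / 2.

Lemma newton_linear_approx x y : Cmod (x - p) < r -> Cmod (y - p) < r ->
  Cmod (f y - f x - A * (y - x)) <= Cmod A / 2 * Cmod (y - x).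
Proof.
  intros Hx Hy. apply mean_value_segment_linear with f'.
  - intros t Ht. apply Hf. now apply segment_in_disc.
  - intros t Ht. apply HfA. now apply segment_in_disc.
Qed.

Lemma newton_expansion x y : Cmod (x - p) < r -> Cmod (y - p) < r ->
  Cmod A / 2 * Cmod (x - y) <= Cmod (f x - f y).
Proof.
  intros Hx Hy. assert (K := newton_linear_approx y x Hy Hx).
  assert (T := Cmod_rev (A * (x - y)) (A * (x - y) - (f x - f y))).
  replace (A * (x - y) - (A * (x - y) - (f x - f y)))%C with (f x - f y)%C in T by ring.
  rewrite Cmod_mult in T. rewrite Cmod_sym in K. lra.
Qed.

(** The iteration [z - (f z - w) / A] with fixed slope contracts by 1/2, because [f'] stays within
    [Cmod A / 2] of [A]. Its first step [eta] is below [r / 4], so all iterates stay within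
    [2 * eta < r / 2] of [p]. *)
Lemma newton_surjective w : Cmod (w - f p) < Cmod A * r / 4 ->
  exists z, Cmod (z - p) < r /\ f z = w.
Proof.
  intros Hw. assert (HA0 := proj1 (Cmod_gt_0 _) HA).
  set (T := fun z => (z - (f z - w) / A)%C).
  assert (HT : forall x y, Cmod (x - p) < r -> Cmod (y - p) < r -> Cmod (T y - T x) <= 1 / 2 * Cmod (y - x)).
  { intros x y Hx Hy.
    replace (T y - T x)%C with (- (f y - f x - A * (y - x)) / A)%C by (unfold T; field; auto).
    rewrite Cmod_div, Cmod_opp by auto. apply Rle_div_l; auto.
    assert (K := newton_linear_approx x y Hx Hy). lra. }
  set (eta := Cmod (w - f p) / Cmod A).
  assert (Heta : eta < r / 4). { apply Rlt_div_l; lra. }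
  assert (Heta0 : 0 <= eta). { apply Rdiv_le_0_compat; auto. apply Cmod_ge_0. }
  set (z := fun n => Nat.iter n T p).
  assert (Hz : forall n, Cmod (z (S n) - z n) <= eta * (1 / 2) ^ n /\ Cmod (z n - p) <= 2 * eta - 2 * eta * (1 / 2) ^ n).
  { induction n.
    - simpl. split.
      + unfold T. replace (p - (f p - w) / A - p)%C with ((w - f p) / A)%C by (field; auto).
        rewrite Cmod_div by auto. unfold eta. lra.
      + rewrite Cmod_diag. lra.
    - destruct IHn as [I1 I2]. assert (Q := pow_half_pos n).
      assert (I3 : Cmod (z (S n) - p) <= 2 * eta - 2 * eta * (1 / 2) ^ S n).
      { assert (K := Cmod_tri (z (S n)) (z n) p). simpl pow. lra. }
      split; [|exact I3].
      assert (Q' := pow_half_pos (S n)).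
      assert (K := HT (z n) (z (S n)) ltac:(nra) ltac:(nra)).
      change (z (S (S n))) with (T (z (S n))). change (T (z n)) with (z (S n)) in K.
      simpl pow. lra. }
  destruct (geometric_limit z eta) as [l Hl]; [intros n; apply Hz|].
  assert (Hlp : Cmod (l - p) < r).
  { assert (K := Hl 0%nat). simpl in K. rewrite Cmod_sym in K. lra. }
  exists l. split; auto.
  assert (HTl : Cmod (T l - l) = 0).
  { apply Rle_antisym; [|apply Cmod_ge_0]. apply Rnot_lt_le. intros Hpos.
    destruct (pow_half_small (4 * eta) _ Hpos) as [n Hn]. specialize (Hn n ltac:(lia)).
    assert (Q := pow_half_pos n). destruct (Hz n) as [_ I2].
    assert (K := HT (z n) l ltac:(nra) Hlp). change (T (z n)) with (z (S n)) in K.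
    assert (K1 := Hl n). assert (K2 := Hl (S n)). simpl pow in K2.
    assert (K3 := Cmod_tri (T l) (z (S n)) l). rewrite (Cmod_sym l (z n)) in K. nra. }
  apply Cmod_eq_0 in HTl. unfold T in HTl.
  apply Ceq_minus. transitivity (- A * (l - (f l - w) / A - l))%C; [field; auto|].
  rewrite HTl. ring.
Qed.
End Newton.

Lemma local_inverse (P P' : C -> C) (p : C) :
  (forall z, cder P z (P' z)) -> (forall z, continuous P' z) -> P' p <> RtoC 0 ->
  exists r a e, 0 < r /\ 0 < a /\ 0 < e /\
    (forall x y, Cmod (x - p) < r -> Cmod (y - p) < r -> a * Cmod (x - y) <= Cmod (P x - P y)) /\
    (forall w, Cmod (w - P p) < e -> exists z, Cmod (z - p) < r /\ P z = w).
Proof.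
  intros HP HP' Hn. assert (H0 := proj1 (Cmod_gt_0 _) Hn).
  destruct (proj1 (continuous_C_eps _ _) (HP' p) (Cmod (P' p) / 2)) as [r [Hr Hd]]; [lra|].
  assert (Hd' : forall z, Cmod (z - p) < r -> Cmod (P' z - P' p) <= Cmod (P' p) / 2) by (intros; left; auto).
  exists r, (Cmod (P' p) / 2), (Cmod (P' p) * r / 4).
  split; [exact Hr|]. split; [lra|]. split; [nra|]. split.
  - intros. now apply (newton_expansion P P' p (P' p) r).
  - intros. now apply (newton_surjective P P' p (P' p) r).
Qed.

(** The supremum of the initial intervals on which [Q] holds is attained and can only be 1.
    Uniqueness and existence of lifts both advance along a segment by this principle. *)
Lemma real_induction (Q : R -> Prop) : Q 0 ->
  (forall t, 0 <= t < 1 -> Q t -> exists d, 0 < d /\ forall s, t < s < t + d -> Q s) ->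
  (forall t, 0 < t <= 1 -> (forall s, 0 <= s < t -> Q s) -> Q t) ->
  forall t, 0 <= t <= 1 -> Q t.
Proof.
  intros H0 Hop Hcl.
  set (E := fun t => 0 <= t <= 1 /\ forall s, 0 <= s <= t -> Q s).
  assert (E0 : E 0). { split; [lra|]. intros s Hs. now replace s with 0 by lra. }
  destruct (completeness E) as [m [Hub Hlub]].
  { exists 1. intros x [Hx _]. lra. }
  { now exists 0. }
  assert (Hm0 : 0 <= m) by (apply Hub; auto).
  assert (Hm1 : m <= 1) by (apply Hlub; intros x [Hx _]; lra).
  assert (Hlt : forall s, 0 <= s < m -> Q s).
  { intros s Hs. apply NNPP. intros Hn. assert (K : is_upper_bound E s).
    { intros x [Hx Hq]. apply Rnot_lt_le. intros Hsx. apply Hn, Hq. lra. }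
    specialize (Hlub s K). lra. }
  assert (HQm : Q m). { destruct (Req_dec m 0) as [->|]; auto. apply Hcl; auto. lra. }
  assert (Em : E m).
  { split; [lra|]. intros s Hs. destruct (Req_dec s m) as [->|]; auto. apply Hlt. lra. }
  destruct (Req_dec m 1) as [E1|E1].
  { intros t Ht. apply Em. lra. }
  exfalso. destruct (Hop m ltac:(lra) HQm) as [d [Hd Hd2]].
  set (s := Rmin 1 (m + d / 2)).
  assert (S1 : s <= 1) by apply Rmin_l. assert (S2 : s <= m + d / 2) by apply Rmin_r.
  assert (S3 : m < s) by (apply Rmin_glb_lt; lra).
  assert (Es : E s).
  { split; [lra|]. intros x Hx. destruct (Rle_dec x m); [apply Em; lra|]. apply Hd2. lra. }
  specialize (Hub s Es). lra.
Qed.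

(** * Lifting through a map without singular values over the target *)

Definition seg (x y : C) (t : R) : C := (x + RtoC t * (y - x))%C.
(** A lift along a segment is kept as a function on this convex neighbourhood, so that it is
    continuous in the plane and comparable with lifts towards nearby end points. *)
Definition tube (x y : C) (d : R) (u : C) : Prop := exists t, 0 <= t <= 1 /\ Cmod (u - seg x y t) < d.

Definition escapes_to (P : C -> C) (w : C) : Prop :=
  exists gamma : R -> C,
    (forall t, 0 <= t -> forall eps, eps > 0 -> exists delta, delta > 0 /\
       forall s, 0 <= s -> Rabs (s - t) < delta -> Cmod (gamma s - gamma t) < eps) /\
    (forall M, exists T, forall t, t >= T -> Cmod (gamma t) > M) /\
    (forall eps, eps > 0 -> exists T, forall t, t >= T -> Cmod (P (gamma t) - w) < eps).

Lemma seg_0 x y : seg x y 0 = x. Proof. unfold seg. ring. Qed.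
Lemma seg_1 x y : seg x y 1 = y. Proof. unfold seg. ring. Qed.
Lemma continuous_seg x y t : continuous (seg x y) t.
Proof. apply continuous_affine. Qed.
Lemma seg_seg x y s t : seg x (seg x y s) t = seg x y (t * s).
Proof. unfold seg. rewrite RtoC_mult. ring. Qed.
Lemma seg_dist x y s t : Cmod (seg x y s - seg x y t) = Rabs (s - t) * Cmod (y - x).
Proof. rewrite <- Cmod_scal. f_equal. unfold seg. rewrite RtoC_minus. ring. Qed.
Lemma seg_dist_end x y y' t : 0 <= t <= 1 -> Cmod (seg x y t - seg x y' t) <= Cmod (y - y').
Proof.
  intros Ht. replace (seg x y t - seg x y' t)%C with (RtoC t * (y - y'))%C by (unfold seg; ring).
  rewrite Cmod_scal, Rabs_pos_eq by lra. assert (Q := Cmod_ge_0 (y - y')). nra.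
Qed.

Lemma tube_seg x y d t : 0 < d -> 0 <= t <= 1 -> tube x y d (seg x y t).
Proof. intros Hd Ht. exists t. split; auto. now rewrite Cmod_diag. Qed.

Lemma tube_open x y d u : tube x y d u -> exists e, 0 < e /\ forall v, Cmod (v - u) < e -> tube x y d v.
Proof.
  intros [t [Ht Hu]]. exists (d - Cmod (u - seg x y t)). split; [lra|]. intros v Hv.
  exists t. split; auto. assert (T := Cmod_tri v u (seg x y t)). lra.
Qed.

Lemma tube_convex x y d u v s : tube x y d u -> tube x y d v -> 0 <= s <= 1 -> tube x y d (seg u v s).
Proof.
  intros [t [Ht Hu]] [t' [Ht' Hv]] Hs. exists (t + s * (t' - t)). split; [nra|].
  replace (seg u v s - seg x y (t + s * (t' - t)))%C with
    (RtoC (1 - s) * (u - seg x y t) + RtoC s * (v - seg x y t'))%C.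
  2: { unfold seg. rewrite RtoC_plus, RtoC_mult, !RtoC_minus. ring. }
  eapply Rle_lt_trans; [apply Cmod_triangle|]. rewrite !Cmod_scal, !Rabs_pos_eq by lra.
  destruct (Rle_dec (1/2) s); nra.
Qed.

Section Lifting.
Variables (P P' E : C -> C) (U : C -> Prop).
Hypothesis HP : forall z, cder P z (P' z).
Hypothesis HP' : forall z, continuous P' z.
Hypothesis Uopen : forall u, U u -> exists e, 0 < e /\ forall v, Cmod (v - u) < e -> U v.
Hypothesis Uconv : forall u v s, U u -> U v -> 0 <= s <= 1 -> U (seg u v s).
Hypothesis HE : forall u, U u -> continuous E u.
Hypothesis Hcrit : forall u z, U u -> P z = E u -> P' z <> RtoC 0.
Hypothesis Hasym : forall u, U u -> ~ escapes_to P (E u).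

Let HPc : forall z, continuous P z := fun z => cder_continuous _ _ _ (HP z).

(** The set of coincidence is open because [P] is injective near noncritical points, and closed by
    continuity. *)
Lemma curve_lift_unique (c1 c2 : R -> C) :
  (forall t, 0 <= t <= 1 -> continuous c1 t) -> (forall t, 0 <= t <= 1 -> continuous c2 t) ->
  (forall t, 0 <= t <= 1 -> P (c1 t) = P (c2 t)) -> (forall t, 0 <= t <= 1 -> P' (c1 t) <> RtoC 0) ->
  c1 0 = c2 0 -> forall t, 0 <= t <= 1 -> c1 t = c2 t.
Proof.
  intros H1 H2 HE12 Hn H0. 
  assert (Hall : forall t, 0 <= t <= 1 -> 0 <= t <= 1 -> c1 t = c2 t).
  { apply (real_induction (fun t => 0 <= t <= 1 -> c1 t = c2 t)).
  - auto.
  - intros t Ht Eq. specialize (Eq ltac:(lra)).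
    destruct (local_inverse P P' (c1 t) HP HP' (Hn t ltac:(lra))) as [r [a [e [Hr [Ha [He [Hinj _]]]]]]].
    destruct (proj1 (continuous_RC_eps _ _) (H1 t ltac:(lra)) r Hr) as [d1 [Hd1 K1]].
    destruct (proj1 (continuous_RC_eps _ _) (H2 t ltac:(lra)) r Hr) as [d2 [Hd2 K2]].
    exists (Rmin d1 d2). split; [now apply Rmin_pos|]. intros s Hs Hs1.
    assert (M1 := Rmin_l d1 d2). assert (M2 := Rmin_r d1 d2).
    specialize (K1 s ltac:(rewrite Rabs_pos_eq; lra)). specialize (K2 s ltac:(rewrite Rabs_pos_eq; lra)).
    rewrite <- Eq in K2. specialize (Hinj _ _ K1 K2). rewrite (HE12 s Hs1), Cmod_diag in Hinj.
    apply Ceq_minus, Cmod_eq_0. assert (Q := Cmod_ge_0 (c1 s - c2 s)). nra.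
  - intros t Ht Hs Ht1. apply NNPP. intros Hne. apply Cminus_eq_contra, Cmod_gt_0 in Hne.
    set (e := Cmod (c1 t - c2 t)) in *.
    destruct (proj1 (continuous_RC_eps _ _) (H1 t ltac:(lra)) (e / 2) ltac:(lra)) as [d1 [Hd1 K1]].
    destruct (proj1 (continuous_RC_eps _ _) (H2 t ltac:(lra)) (e / 2) ltac:(lra)) as [d2 [Hd2 K2]].
    set (d := Rmin (Rmin d1 d2) t). assert (Hd : 0 < d) by (repeat apply Rmin_pos; lra).
    assert (M0 : d <= t) by apply Rmin_r. assert (M : d <= Rmin d1 d2) by apply Rmin_l.
    assert (M1 := Rmin_l d1 d2). assert (M2 := Rmin_r d1 d2).
    assert (Ha : Rabs (t - d / 2 - t) = d / 2) by (replace (t - d / 2 - t) with (- (d / 2)) by ring; rewrite Rabs_Ropp, Rabs_pos_eq; lra).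
    specialize (K1 (t - d / 2) ltac:(lra)). specialize (K2 (t - d / 2) ltac:(lra)).
    rewrite <- (Hs (t - d / 2)) in K2 by lra.
    assert (T := Cmod_tri (c1 t) (c1 (t - d / 2)) (c2 t)). rewrite (Cmod_sym (c1 t) (c1 (t - d / 2))) in T. fold e in T. lra. }
  intros t Ht. now apply Hall.
Qed.

Definition is_lift (V : C -> Prop) (psi : C -> C) : Prop :=
  forall u, V u -> continuous psi u /\ P (psi u) = E u.

Lemma lift_unique (V : C -> Prop) (psi1 psi2 : C -> C) (x y : C) :
  (forall u, V u -> U u) -> is_lift V psi1 -> is_lift V psi2 ->
  (forall t, 0 <= t <= 1 -> V (seg x y t)) -> psi1 x = psi2 x -> psi1 y = psi2 y.
Proof.
  intros HVU L1 L2 Hseg Hx.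
  rewrite <- (seg_1 x y).
  apply (curve_lift_unique (fun t => psi1 (seg x y t)) (fun t => psi2 (seg x y t))).
  - intros t Ht. apply (continuous_comp (seg x y) psi1); [apply continuous_seg|]. apply L1; auto.
  - intros t Ht. apply (continuous_comp (seg x y) psi2); [apply continuous_seg|]. apply L2; auto.
  - intros t Ht. destruct (L1 _ (Hseg t Ht)) as [_ ->]. now destruct (L2 _ (Hseg t Ht)) as [_ ->].
  - intros t Ht. apply (Hcrit (seg x y t)); auto. now apply L1, Hseg.
  - now rewrite !seg_0.
  - lra.
Qed.

(** The section chooses solutions near [p]. It is continuous because [P] shrinks distances there at
    most by a fixed factor; the last clause identifies it with any other solution near [p], as
    gluing requires. *)
Lemma local_section (p u : C) : U u -> P p = E u ->
  exists r d sigma, 0 < r /\ 0 < d /\ (forall v, Cmod (v - u) < d -> U v) /\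
    is_lift (fun v => Cmod (v - u) < d) sigma /\
    (forall v z, Cmod (v - u) < d -> Cmod (z - p) < r -> P z = E v -> sigma v = z).
Proof.
  intros Hu Hp.
  destruct (local_inverse P P' p HP HP' (Hcrit u p Hu Hp)) as [r [a [e [Hr [Ha [He [Hinj Hsur]]]]]]].
  rewrite Hp in Hsur.
  destruct (Uopen u Hu) as [d0 [Hd0 HU]].
  destruct (proj1 (continuous_C_eps _ _) (HE u Hu) e He) as [d1 [Hd1 HE1]].
  set (d := Rmin d0 d1). assert (Hd : 0 < d) by now apply Rmin_pos.
  assert (D0 : d <= d0) by apply Rmin_l. assert (D1 : d <= d1) by apply Rmin_r.
  set (sigma := fun v => epsilon (inhabits (RtoC 0)) (fun z => Cmod (z - p) < r /\ P z = E v)).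
  assert (Hs : forall v, Cmod (v - u) < d -> Cmod (sigma v - p) < r /\ P (sigma v) = E v).
  { intros v Hv. unfold sigma. apply epsilon_spec. apply Hsur, HE1. lra. }
  exists r, d, sigma. split; [exact Hr|]. split; [exact Hd|]. split; [intros v Hv; apply HU; lra|]. split.
  - intros v Hv. split; [|now apply Hs].
    apply continuous_C_eps. intros eps Heps.
    destruct (proj1 (continuous_C_eps _ _) (HE v (HU v ltac:(lra))) (a * eps) ltac:(nra)) as [d2 [Hd2 HE2]].
    exists (Rmin d2 (d - Cmod (v - u))). split; [apply Rmin_pos; lra|]. intros w Hw.
    destruct (Rlt_Rmin_inv _ _ _ Hw) as [W1 W2].
    assert (T := Cmod_tri w v u).
    destruct (Hs v Hv) as [S1 S2]. destruct (Hs w ltac:(lra)) as [S3 S4].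
    specialize (Hinj _ _ S3 S1). rewrite S2, S4 in Hinj. specialize (HE2 w W1).
    apply Rmult_lt_reg_l with a; lra.
  - intros v z Hv Hz HPz. destruct (Hs v Hv) as [S1 S2].
    specialize (Hinj _ _ S1 Hz). rewrite S2, HPz, Cmod_diag in Hinj.
    apply Ceq_minus, Cmod_eq_0. assert (Q := Cmod_ge_0 (sigma v - z)). nra.
Qed.

Variables x0 z0 : C.
Hypothesis Hx0 : U x0.
Hypothesis Hz0 : P z0 = E x0.

Definition tube_lift (y : C) (d : R) (psi : C -> C) : Prop :=
  0 < d /\ (forall u, tube x0 y d u -> U u) /\ is_lift (tube x0 y d) psi /\ psi x0 = z0.

Lemma tube_lift_agree y d psi y' d' psi' : tube_lift y d psi -> tube_lift y' d' psi' -> Cmod (y' - y) < d ->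
  psi y' = psi' y'.
Proof.
  intros [Hd [HU [HL H0]]] [Hd' [HU' [HL' H0']]] Hy.
  apply (lift_unique (fun u => tube x0 y d u /\ tube x0 y' d' u) psi psi' x0 y').
  - intros u [Hu _]. auto.
  - intros u [Hu _]. auto.
  - intros u [_ Hu]. auto.
  - intros t Ht. split; [|now apply tube_seg]. exists t. split; auto.
    eapply Rle_lt_trans; [apply seg_dist_end; auto|exact Hy].
  - congruence.
Qed.

(** Otherwise every point of the square has a disc that the curve avoids shortly before [t], and
    compactness makes this happen simultaneously for the whole square. *)
Lemma bounded_accumulation (c : R -> C) (t M : R) :
  (forall s, s < t -> exists s', s < s' < t /\ Cmod (c s') <= M) ->
  exists p, forall e s, 0 < e -> s < t -> exists s', s < s' < t /\ Cmod (c s' - p) < e.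
Proof.
  intros H. apply NNPP. intros Hno.
  assert (Hp : forall p, exists e : posreal, forall s', t - e < s' < t -> 4 * e <= Cmod (c s' - p)).
  { intros p. apply NNPP. intros Hp. apply Hno. exists p. intros e s He Hs.
    apply NNPP. intros Hs'. apply Hp.
    assert (Hpos : 0 < Rmin (e / 4) (t - s)) by (apply Rmin_pos; lra).
    exists (mkposreal _ Hpos). simpl. intros s' Hs2. assert (R1 := Rmin_l (e / 4) (t - s)). assert (R2 := Rmin_r (e / 4) (t - s)).
    apply Rnot_lt_le. intros Hlt. apply Hs'. exists s'. split; [lra|]. lra. }
  set (delta := fun u v : R => proj1_sig (constructive_indefinite_description _ (Hp (u, v)))).
  destruct (compactness_value_2d (- M) M (- M) M delta) as [d Hd].
  destruct (H (t - d)) as [s' [Hs' Hc]]; [assert (Q := cond_pos d); lra|].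
  assert (R1 := Re_le_Cmod (c s')). assert (R2 := Im_le_Cmod (c s')).
  apply Rabs_le_between in R1, R2.
  apply (Hd (Re (c s')) (Im (c s'))); [lra|lra|].
  intros [u [v [_ [_ [H1 [H2 H3]]]]]].
  unfold delta in *. destruct (constructive_indefinite_description _ (Hp (u, v))) as [e He]. simpl in *.
  specialize (He s' ltac:(lra)).
  assert (K := Cmod_le_Re_Im (c s' - (u, v))).
  change (Re (c s' - (u, v))) with (Re (c s') - u) in K. change (Im (c s' - (u, v))) with (Im (c s') - v) in K.
  assert (Q := cond_pos e). lra.
Qed.

(** Continuation along the segment can only fail at a limit parameter [t]. If the lifted curve keeps
    returning to a bounded set, it accumulates at a preimage of [E xt], and the local section there
    prolongs the lift. If not, it tends to infinity while its image tends to [E xt], an asymptotic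
    value excluded by [Hasym]. *)
Lemma tube_lift_exists y : U y -> exists d psi, tube_lift y d psi.
Proof.
  intros Hy.
  assert (Hyx := Cmod_ge_0 (y - x0)). set (L := Cmod (y - x0) + 1).
  assert (Hdist : forall s t, Cmod (seg x0 y s - seg x0 y t) <= Rabs (s - t) * L).
  { intros s t. rewrite seg_dist. unfold L. assert (Q := Rabs_pos (s - t)). nra. }
  assert (HL : 0 < L) by (unfold L; lra).
  rewrite <- (seg_1 x0 y).
  apply (real_induction (fun t => exists d psi, tube_lift (seg x0 y t) d psi)); [| | |lra].
  - rewrite seg_0. destruct (local_section z0 x0 Hx0 Hz0) as [r [d [sigma [Hr [Hd [HU [HL' Hs]]]]]]].
    assert (Ht : forall u, tube x0 x0 d u -> Cmod (u - x0) < d).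
    { intros u [t [_ Hu]]. now replace (seg x0 x0 t) with x0 in Hu by (unfold seg; ring). }
    exists d, sigma. split; [exact Hd|]. split; [intros u Hu; apply HU; auto|]. split; [intros u Hu; apply HL'; auto|].
    apply Hs; auto; rewrite Cmod_diag; auto.
  - intros t Ht [d [psi [Hd [HU [HL' H0]]]]].
    exists (d / 2 / L). split; [apply Rdiv_lt_0_compat; lra|]. intros s Hs.
    assert (Hsub : forall u, tube x0 (seg x0 y s) (d / 2) u -> tube x0 (seg x0 y t) d u).
    { intros u [tau [Htau Hu]]. exists tau. split; auto.
      assert (K := seg_dist_end x0 (seg x0 y s) (seg x0 y t) tau Htau).
      assert (K2 := Hdist s t). rewrite Rabs_pos_eq in K2 by lra.
      assert (K3 : (s - t) * L < d / 2). { apply Rlt_div_r; lra. }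
      assert (T := Cmod_tri u (seg x0 (seg x0 y s) tau) (seg x0 (seg x0 y t) tau)). lra. }
    exists (d / 2), psi. split; [lra|]. split; [intros u Hu; auto|]. split; [intros u Hu; apply HL'; auto|exact H0].
  - intros t Ht IH.
    (* The end value of an arbitrary lift towards [seg x0 y s]; [tube_lift_agree] makes it
       independent of the choice. *)
    set (c := fun s => epsilon (inhabits (RtoC 0)) (fun z => exists d psi, tube_lift (seg x0 y s) d psi /\ psi (seg x0 y s) = z)).
    assert (Hc : forall s, 0 <= s < t -> exists d psi, tube_lift (seg x0 y s) d psi /\ psi (seg x0 y s) = c s).
    { intros s Hs. unfold c. apply epsilon_spec. destruct (IH s Hs) as [d [psi Hl]]. now exists (psi (seg x0 y s)), d, psi. }
    set (xt := seg x0 y t). assert (Hxt : U xt) by (apply Uconv; auto; lra).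
    assert (Hcc : forall s, 0 <= s < t -> forall eps, 0 < eps -> exists delta, 0 < delta /\
      forall s', 0 <= s' < t -> Rabs (s' - s) < delta -> Cmod (c s' - c s) < eps).
    { intros s Hs eps Heps. destruct (Hc s Hs) as [d [psi [Hl Hv]]].
      assert (Hl' := Hl). destruct Hl' as [Hd [_ [HLp _]]].
      destruct (HLp (seg x0 y s)) as [Cp _]. { exists 1. split; [lra|]. now rewrite seg_1, Cmod_diag. }
      destruct (proj1 (continuous_C_eps _ _) Cp eps Heps) as [d1 [Hd1 K1]].
      exists (Rmin d d1 / L). split; [apply Rdiv_lt_0_compat; auto; now apply Rmin_pos|]. intros s' Hs' Hss.
      apply Rlt_div_r in Hss; auto. assert (K := Hdist s' s).
      assert (M1 := Rmin_l d d1). assert (M2 := Rmin_r d d1).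
      destruct (Hc s' Hs') as [d' [psi' [Hl' Hv']]].
      rewrite <- Hv, <- Hv', <- (tube_lift_agree _ _ _ _ _ _ Hl Hl') by lra. apply K1. lra. }
    assert (Pc : forall s, 0 <= s < t -> P (c s) = E (seg x0 y s)).
    { intros s Hs. destruct (Hc s Hs) as [d [psi [[Hd [_ [HLp _]]] <-]]]. apply HLp.
      exists 1. split; [lra|]. now rewrite seg_1, Cmod_diag. }
    assert (Elim : forall eps, 0 < eps -> exists s0, 0 <= s0 < t /\ forall s, s0 <= s < t -> Cmod (E (seg x0 y s) - E xt) < eps /\ Cmod (seg x0 y s - xt) < eps).
    { intros eps Heps. destruct (proj1 (continuous_C_eps _ _) (HE xt Hxt) eps Heps) as [d1 [Hd1 K1]].
      set (m := Rmin d1 eps). assert (Hm : 0 < m) by now apply Rmin_pos.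
      assert (m <= d1) by apply Rmin_l. assert (m <= eps) by apply Rmin_r.
      exists (Rmax 0 (t - m / (2 * L))).
      assert (Hq : 0 < m / (2 * L)) by (apply Rdiv_lt_0_compat; lra).
      split. { split; [apply Rmax_l|]. apply Rmax_lub_lt; lra. }
      intros s [Hs1 Hs2]. assert (Hs3 := Rle_trans _ _ _ (Rmax_r _ _) Hs1).
      assert (K : Cmod (seg x0 y s - xt) < m).
      { eapply Rle_lt_trans; [apply Hdist|]. rewrite Rabs_left1 by lra.
        assert (m / (2 * L) * L = m / 2) by (field; lra). nra. }
      split; [apply K1|]; lra. }
    destruct (classic (exists M, forall s, s < t -> exists s', s < s' < t /\ Cmod (c s') <= M)) as [[M HM]|Hinf].
    + destruct (bounded_accumulation c t M HM) as [p Hp].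
      assert (HPp : P p = E xt).
      { apply NNPP. intros Hne. apply Cminus_eq_contra, Cmod_gt_0 in Hne. set (e := Cmod (P p - E xt)) in *.
        destruct (proj1 (continuous_C_eps _ _) (HPc p) (e / 2) ltac:(lra)) as [d1 [Hd1 K1]].
        destruct (Elim (e / 2) ltac:(lra)) as [s0 [Hs0 K2]].
        destruct (Hp d1 s0 Hd1 ltac:(lra)) as [s' [Hs' K3]].
        specialize (K1 _ K3). destruct (K2 s' ltac:(lra)) as [K4 _]. rewrite (Pc s') in K1 by lra.
        assert (T := Cmod_tri (P p) (E (seg x0 y s')) (E xt)). rewrite (Cmod_sym (P p) (E (seg x0 y s'))) in T. fold e in T. lra. }
      destruct (local_section p xt Hxt HPp) as [r [eta [sigma [Hr [Heta [HUs [HLs Hss]]]]]]].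
      destruct (Elim eta Heta) as [s0 [Hs0 K2]].
      destruct (Hp r s0 Hr ltac:(lra)) as [s [Hs K3]].
      destruct (K2 s ltac:(lra)) as [_ Hnear]. clear K2.
      destruct (Hc s ltac:(lra)) as [d [psi [[Hd [HU [HLp H0]]] Hv]]].
      set (xs := seg x0 y s) in *.
      assert (Txs : tube x0 xs d xs) by (exists 1; split; [lra|]; now rewrite seg_1, Cmod_diag).
      assert (Eqs : sigma xs = psi xs).
      { rewrite Hv. apply Hss; auto. unfold xs. apply Pc. lra. }
      assert (Agree : forall u, tube x0 xs d u -> Cmod (u - xt) < eta -> sigma u = psi u).
      { intros u Hu1 Hu2. apply (lift_unique (fun v => tube x0 xs d v /\ Cmod (v - xt) < eta) sigma psi xs u).
        - intros v [Hv1 _]. auto.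
        - intros v [_ Hv1]. auto.
        - intros v [Hv1 _]. auto.
        - intros tau Htau. split; [now apply tube_convex|]. now apply segment_in_disc.
        - exact Eqs. }
      set (phi := fun u => if excluded_middle_informative (tube x0 xs d u) then psi u else sigma u).
      assert (Phi1 : forall u, tube x0 xs d u -> phi u = psi u).
      { intros u Hu. unfold phi. now destruct (excluded_middle_informative _). }
      assert (Phi2 : forall u, Cmod (u - xt) < eta -> phi u = sigma u).
      { intros u Hu. unfold phi. destruct (excluded_middle_informative _); auto. symmetry. now apply Agree. }
      (* The new tube splits at [xs]: before it, [d' <= d] keeps it in the old tube; beyond it, the
         second bound keeps it in the disc about [xt], where [sigma] is defined. *)
      set (d' := Rmin d (eta - Cmod (xs - xt))).
      assert (Hd' : 0 < d') by (apply Rmin_pos; lra).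
      assert (D1 : d' <= d) by apply Rmin_l. assert (D2 : d' <= eta - Cmod (xs - xt)) by apply Rmin_r.
      assert (Cover : forall u, tube x0 xt d' u -> tube x0 xs d u \/ Cmod (u - xt) < eta).
      { intros u [tau [Htau Hu]]. unfold xt in Hu. rewrite seg_seg in Hu.
        destruct (Rle_dec (tau * t) s) as [Hle|Hgt].
        - left. destruct (Req_dec s 0) as [Es|Es].
          + exists 0. split; [lra|]. rewrite seg_0.
            assert (E0 : tau * t = 0) by nra. rewrite E0, seg_0 in Hu. lra.
          + exists (tau * t / s). split.
            * split; [apply Rdiv_le_0_compat; nra|]. apply Rle_div_l; lra.
            * unfold xs. rewrite seg_seg. replace (tau * t / s * s) with (tau * t) by (field; lra). lra.
        - right. assert (K : Cmod (seg x0 y (tau * t) - xt) <= Cmod (xs - xt)).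
          { unfold xt, xs. rewrite !seg_dist. apply Rmult_le_compat_r; auto.
            rewrite !Rabs_left1 by nra. lra. }
          assert (T := Cmod_tri u (seg x0 y (tau * t)) xt). lra. }
      exists d', phi. split; [exact Hd'|]. split; [|split].
      * intros u Hu. destruct (Cover u Hu); auto.
      * intros u Hu. destruct (Cover u Hu) as [H1|H1].
        -- destruct (HLp u H1) as [C1 C2]. split; [|now rewrite Phi1].
           destruct (tube_open _ _ _ _ H1) as [e [He Ho]].
           apply continuous_C_ext_loc with psi e; auto. intros w Hw. symmetry. auto.
        -- destruct (HLs u H1) as [C1 C2]. split; [|now rewrite Phi2].
           apply continuous_C_ext_loc with sigma (eta - Cmod (u - xt)); auto; [lra|].
           intros w Hw. symmetry. apply Phi2. assert (T := Cmod_tri w u xt). lra.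
      * rewrite Phi1; auto. exists 0. split; [lra|]. now rewrite seg_0, Cmod_diag.
    + exfalso. apply (Hasym xt Hxt).
      (* Asymptotic curves are parametrised by [0, infinity), so [0, t) is stretched. The map is
         1-Lipschitz because [t <= 1], which transfers the continuity of [c]. *)
      set (par := fun tau => t * (tau / (1 + tau))).
      assert (Hpar : forall tau, 0 <= tau -> 0 <= par tau < t).
      { intros tau Htau. unfold par. assert (0 <= tau / (1 + tau) < 1).
        { split; [apply Rdiv_le_0_compat; lra|apply Rlt_div_l; lra]. } nra. }
      assert (Hparlip : forall a b, 0 <= a -> 0 <= b -> Rabs (par a - par b) <= Rabs (a - b)).
      { intros a b Ha Hb. unfold par.
        replace (t * (a / (1 + a)) - t * (b / (1 + b))) with (t / ((1 + a) * (1 + b)) * (a - b)) by (field; lra).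
        rewrite Rabs_mult. assert (Q := Rabs_pos (a - b)).
        rewrite Rabs_pos_eq by (apply Rdiv_le_0_compat; nra).
        assert (t / ((1 + a) * (1 + b)) <= 1) by (apply Rle_div_l; nra). nra. }
      assert (Hparlim : forall s, s < t -> exists T, 0 <= T /\ forall tau, T <= tau -> s < par tau < t).
      { intros s Hs. exists (Rmax 0 (t / (t - s))). split; [apply Rmax_l|]. intros tau Htau.
        assert (H1 := Rle_trans _ _ _ (Rmax_l _ _) Htau). assert (H2 := Rle_trans _ _ _ (Rmax_r _ _) Htau).
        split; [|apply Hpar; lra]. apply Rle_div_l in H2; [|lra]. unfold par.
        replace (t * (tau / (1 + tau))) with (t * tau / (1 + tau)) by (field; lra).
        apply Rlt_div_r; [lra|]. nra. }
      exists (fun tau => c (par tau)). split; [|split].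
      * intros tau Htau eps Heps. destruct (Hcc (par tau) (Hpar tau Htau) eps Heps) as [d [Hd Hd2]].
        exists d. split; auto. intros s Hs Hss. apply Hd2; auto. eapply Rle_lt_trans; [apply Hparlip; auto|exact Hss].
      * intros M. apply NNPP. intros HM. apply Hinf. exists M. intros s Hs. apply NNPP. intros Hs'.
        apply HM. destruct (Hparlim s Hs) as [T [HT HT2]]. exists T. intros tau Htau.
        apply Rnot_le_gt. intros Hle. apply Hs'. exists (par tau). split; auto. apply HT2. lra.
      * intros eps Heps. destruct (Elim eps Heps) as [s0 [Hs0 K2]].
        destruct (Hparlim s0 ltac:(lra)) as [T [HT HT2]]. exists T. intros tau Htau.
        specialize (HT2 tau ltac:(lra)). rewrite Pc by lra. apply K2. lra.
Qed.

(** The value at [y] comes from any lift along the segment from [x0]. Near [y] a single tube lift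
    gives all values, whence continuity. *)
Lemma lift_exists : exists psi, psi x0 = z0 /\ is_lift U psi.
Proof.
  set (psi := fun y => epsilon (inhabits (RtoC 0)) (fun z => exists d phi, tube_lift y d phi /\ phi y = z)).
  assert (Hpsi : forall y, U y -> exists d phi, tube_lift y d phi /\ phi y = psi y).
  { intros y Hy. unfold psi. apply epsilon_spec. destruct (tube_lift_exists y Hy) as [d [phi H]]. now exists (phi y), d, phi. }
  exists psi. split.
  - destruct (Hpsi x0 Hx0) as [d [phi [[_ [_ [_ H]]] <-]]]. exact H.
  - intros y Hy. destruct (Hpsi y Hy) as [d [phi [Hl Hv]]].
    assert (Hl' := Hl). destruct Hl' as [Hd [HU [HLp _]]].
    assert (Ty : tube x0 y d y) by (exists 1; split; [lra|]; now rewrite seg_1, Cmod_diag).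
    destruct (HLp y Ty) as [C1 C2]. split; [|now rewrite <- Hv].
    apply continuous_C_ext_loc with phi d; auto. intros w Hw.
    assert (Hw' : U w). { apply HU. exists 1. split; [lra|]. now rewrite seg_1. }
    destruct (Hpsi w Hw') as [d' [phi' [Hl' <-]]].
    exact (tube_lift_agree _ _ _ _ _ _ Hl Hl' Hw).
Qed.
End Lifting.


(** If no point near [w] dominated [g] up to a factor two on its own disc, a geometric chain of
    counterexamples would converge to a point where [g] is discontinuous. *)
Lemma doubling_point (g : C -> R) (w : C) (d : R) : 0 < d -> 0 < g w ->
  (forall z, Cmod (z - w) <= 2 * d -> continuous g z) ->
  exists a r, 0 < r /\ Cmod (a - w) + 2 * r <= 2 * d /\ d * g w <= r * g a /\
    forall z, Cmod (z - a) < r -> g z <= 2 * g a.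
Proof.
  intros Hd Hg Hc. apply NNPP. intros Hno.
  set (ok := fun (n : nat) (a : C) => Cmod (a - w) <= 2 * d - 2 * d * (1 / 2) ^ n /\ 2 ^ n * g w <= g a).
  assert (Hstep : forall n a, ok n a -> exists b, ok (S n) b /\ Cmod (b - a) <= d * (1 / 2) ^ n).
  { intros n a [H1 H2]. apply NNPP. intros Hb. apply Hno.
    assert (Q := pow_half_pos n). exists a, (d * (1 / 2) ^ n).
    split; [nra|]. split; [lra|]. split.
    - assert (E : (1 / 2) ^ n * 2 ^ n = 1) by (rewrite <- Rpow_mult_distr; replace (1 / 2 * 2) with 1 by field; apply pow1).
      replace (d * g w) with (d * (1 / 2) ^ n * (2 ^ n * g w)) by (transitivity (d * g w * ((1 / 2) ^ n * 2 ^ n)); [ring|rewrite E; ring]).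
      apply Rmult_le_compat_l; nra.
    - intros z Hz. apply Rnot_lt_le. intros Hlt. apply Hb. exists z. split; [|lra]. split.
      + assert (T := Cmod_tri z a w). simpl pow. lra.
      + simpl pow. lra. }
  set (nxt := fun n a => epsilon (inhabits (RtoC 0)) (fun b => ok (S n) b /\ Cmod (b - a) <= d * (1 / 2) ^ n)).
  set (s := fix s n := match n with O => w | S m => nxt m (s m) end).
  assert (Hs : forall n, ok n (s n)).
  { induction n.
    - split; simpl; [rewrite Cmod_diag; lra|lra].
    - simpl. unfold nxt. apply (epsilon_spec (inhabits (RtoC 0)) _ (Hstep n (s n) IHn)). }
  assert (Hs2 : forall n, Cmod (s (S n) - s n) <= d * (1 / 2) ^ n).
  { intros n. simpl. unfold nxt. apply (epsilon_spec (inhabits (RtoC 0)) _ (Hstep n (s n) (Hs n))). }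
  destruct (geometric_limit s d Hs2) as [p Hp].
  assert (Hpw : Cmod (p - w) <= 2 * d).
  { assert (K := Hp 0%nat). simpl in K. rewrite Cmod_sym in K. lra. }
  destruct (proj1 (filterlim_locally _ _) (Hc p Hpw) (mkposreal 1 Rlt_0_1)) as [e He].
  assert (He2 : 0 < e) by apply cond_pos.
  destruct (pow_half_small (2 * d) e He2) as [N1 HN1].
  destruct (Pow_x_infinity 2 ltac:(rewrite Rabs_pos_eq; lra) ((g p + 2) / g w)) as [N2 HN2].
  set (n := (N1 + N2)%nat). specialize (HN1 n ltac:(unfold n; lia)). specialize (HN2 n ltac:(unfold n; lia)).
  assert (Hb : ball (g p) 1 (g (s n))).
  { apply He. apply C_ball_Cmod. eapply Rle_lt_trans; [apply Hp|exact HN1]. }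
  change (Rabs (g (s n) - g p) < 1) in Hb. apply Rabs_lt_between in Hb.
  destruct (Hs n) as [_ H2]. rewrite Rabs_pos_eq in HN2 by (apply pow_le; lra).
  apply Rge_le in HN2. apply Rle_div_l in HN2; auto. lra.
Qed.

(** At a doubling point [a], found within [d / 2] of [w], [f'] has Lipschitz constant [4 * A / r]
    near [a], so it stays within [A / 2] of [f' a] on the disc of radius [r / 8]. Newton's iteration
    there covers the radius [A * r / 32], and [A * r >= d / 4 * Cmod (f' w)] gives 128. *)
Lemma bloch (f f' : C -> C) (w : C) (d : R) : 0 < d ->
  (forall z, Cmod (z - w) < d -> cder f z (f' z)) ->
  (forall z, Cmod (z - w) < d -> continuous f' z) ->
  exists b, forall v, Cmod (v - b) < d * Cmod (f' w) / 128 -> exists z, Cmod (z - w) < d /\ f z = v.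
Proof.
  intros Hd Hf Hf'.
  destruct (Req_dec (Cmod (f' w)) 0) as [E0|E0].
  { exists (RtoC 0). intros v Hv. rewrite E0 in Hv. assert (Q := Cmod_ge_0 (v - 0)). lra. }
  assert (Hw := Cmod_ge_0 (f' w)).
  destruct (doubling_point (fun z => Cmod (f' z)) w (d / 4)) as [a [r [Hr [Har [Hra Hdom]]]]]; [lra|lra| |].
  { intros z Hz. apply continuous_Cmod. apply Hf'. lra. }
  cbv beta in *. set (A := Cmod (f' a)) in *.
  assert (HA : 0 < A) by nra.
  assert (Hin : forall z, Cmod (z - a) < r -> Cmod (z - w) < d).
  { intros z Hz. assert (T := Cmod_tri z a w). assert (Q := Cmod_ge_0 (z - a)). lra. }
  assert (Hlip : forall z, Cmod (z - a) < r / 8 -> Cmod (f' z - f' a) <= A / 2).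
  { intros z Hz.
    eapply Rle_trans; [apply (deriv_lipschitz f f' a z r (r / 2) (2 * A)); [lra|lra|auto|auto|auto]|].
    replace (2 * A / (r / 2) * Cmod (z - a)) with (4 * A * Cmod (z - a) / r) by (field; lra).
    apply Rle_div_l; [lra|]. nra. }
  exists (f a). intros v Hv.
  destruct (newton_surjective f f' a (f' a) (r / 8)) with (w := v) as [z [Hz1 Hz2]]; auto.
  - apply Cmod_gt_0. exact HA.
  - intros z Hz. apply Hf, Hin. lra.
  - fold A. nra.
  - exists z. split; auto. apply Hin. lra.
Qed.

(** Along such a curve the exponential of [gam - s] stays close to 1, so its exponent has bounded
    real part. The imaginary part must then be unbounded and by continuity hits an odd multiple of
    pi, where the cosine is -1 instead of positive. *)
Lemma cexp_no_escape (w : C) : w <> RtoC 0 -> ~ escapes_to cexp w.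
Proof.
  intros Hw [gam [Hc [Hinf Hlim]]].
  destruct (clog_exists w Hw) as [s Hs].
  assert (Hw0 := proj1 (Cmod_gt_0 _) Hw).
  destruct (Hlim (Cmod w / 2) ltac:(lra)) as [T1 HT1].
  set (T := Rmax T1 0). assert (HT0 : 0 <= T) by apply Rmax_r. assert (HTT1 : T1 <= T) by apply Rmax_l.
  assert (Hnear : forall t, T <= t -> Cmod (cexp (gam t - s) - 1) < 1 / 2).
  { intros t Ht. assert (K := HT1 t ltac:(lra)).
    assert (E : cexp (gam t) = (w * cexp (gam t - s))%C).
    { rewrite <- Hs, <- cexp_add. f_equal. ring. }
    rewrite E in K. replace (w * cexp (gam t - s) - w)%C with (w * (cexp (gam t - s) - 1))%C in K by ring.
    rewrite Cmod_mult in K. nra. }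
  assert (Hcos : forall t, T <= t -> cos (Im (gam t - s)) > 0).
  { intros t Ht. assert (K := Hnear t Ht). assert (K2 := Re_le_Cmod (cexp (gam t - s) - 1)).
    change (Re (cexp (gam t - s) - 1)) with (exp (Re (gam t - s)) * cos (Im (gam t - s)) - 1) in K2.
    assert (P := exp_pos (Re (gam t - s))).
    assert (K3 : Rabs (exp (Re (gam t - s)) * cos (Im (gam t - s)) - 1) < 1 / 2) by lra.
    apply Rabs_lt_between in K3. nra. }
  assert (Hre : forall t, T <= t -> Rabs (Re (gam t - s)) <= 1).
  { intros t Ht. assert (K := Hnear t Ht).
    assert (K1 := Cmod_rev (cexp (gam t - s)) 1). assert (K2 := Cmod_rev 1 (cexp (gam t - s))).
    rewrite (Cmod_sym 1) in K2. rewrite Cmod_1, Cmod_cexp in *.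
    set (x := Re (gam t - s)) in *. apply Rabs_le. split.
    - apply Rnot_lt_le. intros Hlt. apply exp_increasing in Hlt.
      replace (exp (- (1))) with (/ exp 1) in Hlt by now rewrite exp_Ropp.
      assert (B := exp_ineq1_le 1). assert (/ exp 1 <= / (1 + 1)) by (apply Rinv_le_contravar; lra). lra.
    - apply Rnot_lt_le. intros Hlt. apply exp_increasing in Hlt. assert (B := exp_ineq1_le 1). lra. }
  (* Freezing the curve before [T] gives a function continuous on the whole line, as the
     intermediate value theorem asks. *)
  set (y := fun t => Im (gam (Rmax t T)) - Im s).
  assert (Hy : continuity y).
  { intros t. apply continuity_pt_of_continuous. apply filterlim_locally. intros [e He].
    destruct (Hc (Rmax t T) ltac:(eapply Rle_trans; [exact HT0|apply Rmax_r]) e He) as [d [Hd Hd2]].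
    exists (mkposreal d Hd). intros t' Ht'. change (Rabs (t' - t) < d) in Ht'.
    change (Rabs (y t' - y t) < e). unfold y.
    replace (Im (gam (Rmax t' T)) - Im s - (Im (gam (Rmax t T)) - Im s)) with (Im (gam (Rmax t' T) - gam (Rmax t T))).
    2: { unfold Im, Cminus, Cplus, Copp; simpl. ring. }
    eapply Rle_lt_trans; [apply Im_le_Cmod|]. apply Hd2.
    - eapply Rle_trans; [exact HT0|apply Rmax_r].
    - eapply Rle_lt_trans; [|exact Ht']. unfold Rmax. destruct (Rle_dec t' T), (Rle_dec t T); unfold Rabs;
        repeat destruct (Rcase_abs _); lra. }
  assert (HPI := PI_RGT_0).
  (* Large enough for [y] to change by at least [2 * PI], hence to pass an odd multiple of [PI]. *)
  set (B := 2 + Cmod s + Rabs (y T) + 4 * PI).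
  destruct (Hinf B) as [T2 HT2].
  set (t := Rmax T2 T). assert (Ht1 : T <= t) by apply Rmax_r. assert (Ht2 : T2 <= t) by apply Rmax_l.
  assert (Hbig : Rabs (y t) >= Rabs (y T) + 2 * PI).
  { assert (K := HT2 t ltac:(lra)). assert (K1 := Hre t Ht1).
    assert (K2 := Cmod_le_Re_Im (gam t - s)). assert (K3 := Cmod_rev (gam t) s).
    unfold y at 1. rewrite (Rmax_left t T) by lra.
    change (Im (gam t) - Im s) with (Im (gam t - s)). unfold B in K. lra. }
  assert (Hodd : exists k : Z, Rmin (y T) (y t) <= PI + 2 * IZR k * PI <= Rmax (y T) (y t)).
  { set (m := Rmin (y T) (y t)).
    destruct (archimed ((m - PI) / (2 * PI) )) as [A1 A2].
    exists (up ((m - PI) / (2 * PI))). set (k := IZR (up ((m - PI) / (2 * PI)))) in *.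
    assert (Em : m = PI + 2 * PI * ((m - PI) / (2 * PI))) by (field; lra).
    assert (Hlen : m + 2 * PI <= Rmax (y T) (y t)).
    { unfold m, Rmin, Rmax. unfold Rabs in Hbig.
      destruct (Rle_dec (y T) (y t)); repeat destruct (Rcase_abs _); lra. }
    split; nra. }
  destruct Hodd as [k Hk].
  destruct (IVT_gen y T t (PI + 2 * IZR k * PI) Hy) as [x [Hx Ex]]; [exact Hk|].
  rewrite Rmin_left, Rmax_right in Hx by lra.
  assert (K := Hcos x ltac:(lra)).
  unfold y in Ex. rewrite Rmax_left in Ex by lra.
  change (Im (gam x - s)) with (Im (gam x) - Im s) in K. rewrite Ex in K.
  rewrite neg_cos in K || (rewrite Rplus_comm, neg_cos in K).
  assert (Hc1 : cos (2 * IZR k * PI) = 1).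
  { replace (2 * IZR k * PI) with (2 * (PI * IZR k)) by ring. rewrite cos_2a_sin.
    assert (Hz : sin (PI * IZR k) = 0) by (apply sin_eq_0_1; exists k; ring). rewrite Hz. ring. }
  lra.
Qed.

(** * Logarithmic coordinates over a half-plane without singular values *)

Definition halfplane (ell : R) (u : C) : Prop := ell < Re u.

Lemma halfplane_disc ell u v : halfplane ell u -> Cmod (v - u) < Re u - ell -> halfplane ell v.
Proof.
  unfold halfplane. intros Hu Hv. assert (K := Re_le_Cmod (v - u)).
  change (Re (v - u)) with (Re v - Re u) in K.
  assert (K2 : Rabs (Re v - Re u) < Re u - ell) by lra. apply Rabs_lt_between in K2. lra.
Qed.

Lemma halfplane_open ell u : halfplane ell u -> exists e, 0 < e /\ forall v, Cmod (v - u) < e -> halfplane ell v.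
Proof.
  intros Hu. exists (Re u - ell). split; [unfold halfplane in Hu; lra|]. intros v. now apply halfplane_disc.
Qed.

Lemma halfplane_convex ell u v s : halfplane ell u -> halfplane ell v -> 0 <= s <= 1 -> halfplane ell (seg u v s).
Proof.
  unfold halfplane. intros Hu Hv Hs.
  replace (Re (seg u v s)) with (Re u + s * (Re v - Re u)).
  2: { unfold seg, Re, Cplus, Cminus, Cmult, Copp, RtoC; simpl. ring. }
  destruct (Rle_dec (1 / 2) s); nra.
Qed.

Lemma Re_per z k : Re (z + per k) = Re z.
Proof. unfold Re, Cplus, per; simpl. ring. Qed.

Lemma Cmod_per k : Cmod (per k) = 2 * PI * Rabs (IZR k).
Proof.
  replace (per k) with (Ci * RtoC (2 * PI * IZR k))%C.
  2: { unfold per, Ci, Cmult, RtoC; simpl. f_equal; ring. }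
  assert (H := PI_RGT_0).
  rewrite Cmod_mult, Cmod_Ci, Cmod_R, Rabs_mult, (Rabs_pos_eq (2 * PI)); lra.
Qed.

Section LogCoordinates.
Variables (f f' : C -> C) (ell : R).
Hypothesis Hf : forall z, cder f z (f' z).
Hypothesis Hf' : forall z, continuous f' z.
Hypothesis Htr : ~ exists l, forall z, f z = peval l z.
Hypothesis Hcritf : forall w, exp ell < Cmod w -> forall z, f z = w -> f' z <> RtoC 0.
Hypothesis Hasymf : forall w, exp ell < Cmod w -> ~ escapes_to f w.
Hypothesis Hf0 : Cmod (f 0) < exp ell.

Let H := halfplane ell.

Lemma exp_lt_Cmod_cexp u : H u -> exp ell < Cmod (cexp u).
Proof. intros Hu. rewrite Cmod_cexp. now apply exp_increasing. Qed.

Lemma cexp_crit u z : H u -> f z = cexp u -> f' z <> RtoC 0.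
Proof. intros Hu E. apply (Hcritf (cexp u)); auto. now apply exp_lt_Cmod_cexp. Qed.

Definition log_branch (Phi Phi' : C -> C) : Prop :=
  (forall u, H u -> cder Phi u (Phi' u)) /\ (forall u, H u -> continuous Phi' u) /\
  (forall u, H u -> f (cexp (Phi u)) = cexp u).

(** Two liftings in succession: [cexp] through [f] gives [psi], and [psi] through [cexp] gives
    [Phi]. Both are differentiated by [cder_lift]. *)
Lemma log_branch_exists om s0 : H om -> f (cexp s0) = cexp om ->
  exists Phi Phi', Phi om = s0 /\ log_branch Phi Phi'.
Proof.
  intros Hom E0.
  destruct (lift_exists f f' cexp H Hf Hf' (halfplane_open ell) (halfplane_convex ell)
    (fun u _ => continuous_cexp u) cexp_crit
    (fun u Hu => Hasymf _ (exp_lt_Cmod_cexp u Hu)) om (cexp s0) Hom E0) as [psi [Hpsi0 Hpsi]].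
  (* By [Hf0] the point 0 has too small an image to lie over the half-plane. So [psi] omits 0, and
     its values can be lifted through [cexp]. *)
  assert (Hnz : forall u, H u -> psi u <> RtoC 0).
  { intros u Hu E. destruct (Hpsi u Hu) as [_ E2]. rewrite E in E2.
    assert (K := exp_lt_Cmod_cexp u Hu). rewrite <- E2 in K. lra. }
  destruct (lift_exists cexp cexp psi H cder_cexp continuous_cexp (halfplane_open ell) (halfplane_convex ell)
    (fun u Hu => proj1 (Hpsi u Hu)) (fun u z _ _ => cexp_neq_0 z)
    (fun u Hu => cexp_no_escape _ (Hnz u Hu)) om s0 Hom (eq_sym Hpsi0)) as [Phi [HPhi0 HPhi]].
  set (psi' := fun u => (cexp u / f' (psi u))%C).
  assert (Dpsi : forall u, H u -> cder psi u (psi' u)).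
  { intros u Hu. destruct (halfplane_open ell u Hu) as [e [He Ho]].
    apply (cder_lift f cexp psi u (f' (psi u)) (cexp u) e He).
    - intros w Hw. apply Hpsi, Ho, Hw.
    - now apply Hpsi.
    - apply Hf.
    - apply (cexp_crit u); auto. now apply Hpsi.
    - apply cder_cexp. }
  assert (Cpsi' : forall u, H u -> continuous psi' u).
  { intros u Hu. apply continuous_Cdiv; [apply continuous_cexp| |].
    - apply (continuous_comp psi f'); [now apply Hpsi|apply Hf'].
    - apply (cexp_crit u); auto. now apply Hpsi. }
  exists Phi, (fun u => (psi' u / cexp (Phi u))%C). split; [exact HPhi0|]. split; [|split].
  - intros u Hu. destruct (halfplane_open ell u Hu) as [e [He Ho]].
    apply (cder_lift cexp psi Phi u (cexp (Phi u)) (psi' u) e He).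
    + intros w Hw. apply HPhi, Ho, Hw.
    + now apply HPhi.
    + apply cder_cexp.
    + apply cexp_neq_0.
    + auto.
  - intros u Hu. apply continuous_Cdiv; auto.
    + apply (continuous_comp Phi cexp); [now apply HPhi|apply continuous_cexp].
    + apply cexp_neq_0.
  - intros u Hu. destruct (HPhi u Hu) as [_ ->]. now apply Hpsi.
Qed.

Section Branch.
Variables Phi Phi' : C -> C.
Hypothesis HPhi : log_branch Phi Phi'.

Let DPhi := proj1 HPhi.
Let CPhi' := proj1 (proj2 HPhi).
Let EPhi := proj2 (proj2 HPhi).

(** * Exclusion of branches that close up around the origin *)

Section Periodic.
Variable k : Z.
Hypothesis Hper : forall u, H u -> Phi (u + per k)%C = (Phi u + per 1)%C.

Let kap := Cmod (per k).
Let line (x t : R) : C := (RtoC x + RtoC t * per k)%C.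

Lemma line_Re x t : Re (line x t) = x.
Proof. unfold line, Re, Cplus, Cmult, per, RtoC; simpl. ring. Qed.

Lemma line_H x t : ell < x -> H (line x t).
Proof. intros Hx. unfold H, halfplane. now rewrite line_Re. Qed.

Lemma line_ends x : line x 1 = (line x 0 + per k)%C.
Proof. unfold line. ring. Qed.

Lemma kap_pos : 0 < kap.
Proof.
  unfold kap. apply Cmod_gt_0. intros E.
  assert (Hu : H (line (ell + 1) 0)) by (apply line_H; lra).
  assert (K := Hper _ Hu). rewrite E in K. replace (line (ell + 1) 0 + 0)%C with (line (ell + 1) 0) in K by ring.
  assert (K2 : per 1 = RtoC 0).
  { transitivity (Phi (line (ell + 1) 0) + per 1 - Phi (line (ell + 1) 0))%C; [ring|]. rewrite <- K. ring. }
  assert (K3 := Cmod_per 1). rewrite K2, Cmod_0, Rabs_pos_eq in K3 by lra. assert (P := PI_RGT_0). lra.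
Qed.

Lemma rder_Phi_line x t : ell < x -> rder (fun t => Phi (line x t)) t (Phi' (line x t) * per k).
Proof.
  intros Hx. apply (rder_comp Phi (line x)); [now apply DPhi, line_H|apply rder_affine].
Qed.

Lemma continuous_line x t : continuous (line x) t.
Proof. apply continuous_affine. Qed.

Lemma continuous_Phi_line x t : ell < x -> continuous (fun t => Phi (line x t)) t.
Proof. intros Hx. eapply rder_continuous, rder_Phi_line; auto. Qed.

Lemma continuous_Phi'_line x t : ell < x -> continuous (fun t => Phi' (line x t)) t.
Proof.
  intros Hx. apply (continuous_comp (line x) Phi'); [apply continuous_line|]. now apply CPhi', line_H.
Qed.

Section Contour.
Variables (x : R) (n : nat).
Hypothesis Hx : ell < x.

(** [psi] is a closed curve of winding number 1 about 0, since [Phi] gains [per 1] along it. With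
    [z = psi t], the weight [W m] is the form [z^(m - n - 1) dz]; its integral is [per 1] for
    [m = n] and 0 otherwise, so integration extracts the coefficient of index [n]. *)
Let psi t := cexp (Phi (line x t)).
Let cf (m : nat) : C := RtoC (INR m - INR n).
Let W m t := (cexp (cf m * Phi (line x t)) * (Phi' (line x t) * per k))%C.
Let co m := tcoef f 0 1 m.

(** The remainder [trem] at the point [psi t], written by successive division; in this form it is
    visibly continuous in [t] and free of a radius. *)
Fixpoint rm (m : nat) (t : R) : C :=
  match m with O => f (psi t) | S m' => ((rm m' t - co m') / psi t)%C end.

Lemma psi_neq_0 t : psi t <> RtoC 0.
Proof. apply cexp_neq_0. Qed.

Lemma continuous_psi t : continuous psi t.
Proof. apply (continuous_comp (fun t => Phi (line x t)) cexp); [now apply continuous_Phi_line|apply continuous_cexp]. Qed.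

Lemma continuous_W m t : continuous (W m) t.
Proof.
  apply continuous_Cmult.
  - apply (continuous_comp (fun t => (cf m * Phi (line x t))%C) cexp); [|apply continuous_cexp].
    apply continuous_Cmult; [apply continuous_const|now apply continuous_Phi_line].
  - apply continuous_Cmult; [now apply continuous_Phi'_line|apply continuous_const].
Qed.

Lemma continuous_rm m t : continuous (rm m) t.
Proof.
  induction m; simpl.
  - apply (continuous_comp psi f); [apply continuous_psi|]. eapply cder_continuous, Hf.
  - apply continuous_Cdiv; [|apply continuous_psi|apply psi_neq_0].
    apply continuous_Cminus; auto. apply continuous_const.
Qed.

Lemma W_S m t : W (S m) t = (psi t * W m t)%C.
Proof.
  unfold W, psi.
  replace (cexp (cf (S m) * Phi (line x t))) with (cexp (Phi (line x t)) * cexp (cf m * Phi (line x t)))%C; [ring|].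
  rewrite <- cexp_add. f_equal.
  unfold cf. rewrite S_INR. replace (INR m + 1 - INR n) with (1 + (INR m - INR n)) by ring.
  rewrite RtoC_plus. ring.
Qed.

Lemma CInt_W m : CInt (W m) 0 1 = if Nat.eq_dec m n then per 1 else RtoC 0.
Proof.
  assert (Hend : Phi (line x 1) = (Phi (line x 0) + per 1)%C).
  { rewrite line_ends. apply Hper. now apply line_H. }
  destruct (Nat.eq_dec m n) as [->|Hmn].
  - rewrite (CInt_FTC (fun t => Phi (line x t))).
    + rewrite Hend. ring.
    + intros t. assert (K := rder_Phi_line x t Hx).
      replace (W n t) with (Phi' (line x t) * per k)%C; [exact K|].
      unfold W, cf. rewrite Rminus_diag. replace (RtoC 0 * Phi (line x t))%C with (RtoC 0) by ring.
      rewrite cexp_0. ring.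
    + apply continuous_W.
  - assert (Hc : cf m <> RtoC 0).
    { unfold cf. apply Cmod_gt_0. rewrite Cmod_R. apply Rabs_pos_lt. intros E. apply Hmn, INR_eq. lra. }
    rewrite (CInt_FTC (fun t => (/ cf m * cexp (cf m * Phi (line x t)))%C)).
    + rewrite Hend. replace (cf m * (Phi (line x 0) + per 1))%C with (cf m * Phi (line x 0) + per (Z.of_nat m - Z.of_nat n))%C.
      * rewrite cexp_per. ring.
      * rewrite Cmult_plus_distr_l. f_equal. unfold per, cf, Cmult, RtoC; simpl.
        rewrite minus_IZR, <- !INR_IZR_INZ. f_equal; ring.
    + intros t.
      assert (D : cder (fun z => (/ cf m * cexp (cf m * z))%C) (Phi (line x t)) (cexp (cf m * Phi (line x t)))).
      { eapply cder_eq.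
        - apply cder_scal, (cder_comp cexp (fun z => (cf m * z)%C)); [apply cder_cexp|apply cder_scal, cder_id].
        - field. exact Hc. }
      exact (rder_comp _ (fun t => Phi (line x t)) t _ _ D (rder_Phi_line x t Hx)).
    + apply continuous_W.
Qed.

Let D m := CInt (fun t => (rm m t * W m t)%C) 0 1.

Lemma D_step m : D m = (co m * CInt (W m) 0 1 + D (S m))%C.
Proof.
  unfold D. rewrite <- CInt_scal by apply continuous_W. rewrite <- CInt_plus.
  - apply CInt_ext. intros t. rewrite W_S. simpl. field. apply psi_neq_0.
  - intros t. apply continuous_Cmult; [apply continuous_const|apply continuous_W].
  - intros t. apply continuous_Cmult; [apply continuous_rm|apply continuous_W].
Qed.

Lemma D_telescope N : D 0 = (D N + (if le_lt_dec N n then RtoC 0 else co n * per 1))%C.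
Proof.
  induction N.
  - destruct (le_lt_dec 0 n); [ring|lia].
  - rewrite IHN, (D_step N), CInt_W.
    destruct (le_lt_dec N n), (le_lt_dec (S N) n), (Nat.eq_dec N n); try lia; subst; ring.
Qed.

Lemma W_pow m t : W m t = (psi t ^ m * W 0 t)%C.
Proof. induction m; [simpl; ring|]. rewrite W_S, IHm. simpl. ring. Qed.

Lemma bounded_on_unit (g : R -> C) : (forall t, continuous g t) -> exists K, 0 <= K /\ forall t, 0 <= t <= 1 -> Cmod (g t) <= K.
Proof.
  intros Hg. destruct (continuity_ab_maj (fun t => Cmod (g t)) 0 1) as [t0 [H0 _]]; [lra| |].
  - intros t _. now apply continuity_pt_of_continuous, continuous_Cmod.
  - exists (Cmod (g t0)). split; [apply Cmod_ge_0|exact H0].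
Qed.

(** Cauchy's coefficient formula over the curve [psi], on which [f] equals [cexp (line x t)].
    Splitting off the terms up to [N > n] leaves an integral of the remainder, which tends to 0
    because the radius [r] exceeds twice the largest modulus on the curve. *)
Lemma contour_coefficient :
  CInt (fun t => (cexp (line x t) * (cexp (RtoC (- INR n) * Phi (line x t)) * (Phi' (line x t) * per k)))%C) 0 1
  = (co n * per 1)%C.
Proof.
  transitivity (D 0).
  { unfold D. apply CInt_ext. intros t. simpl. unfold psi. rewrite EPhi by now apply line_H.
    unfold W, cf. simpl INR. now replace (0 - INR n) with (- INR n) by ring. }
  apply NNPP. intros Hne. apply Cminus_eq_contra, Cmod_gt_0 in Hne.
  destruct (bounded_on_unit psi continuous_psi) as [R0 [HR0 HR]].
  destruct (bounded_on_unit (W 0) (continuous_W 0)) as [K [HK0 HK]].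
  set (r := 2 * R0 + 2).
  destruct (entire_circle_bounded f f' Hf 0 r ltac:(unfold r; lra)) as [M [HM0 HM]].
  assert (Hrm : forall t m, 0 <= t <= 1 -> rm m t = trem f 0 r (psi t) m).
  { intros t m Ht. assert (Hpr : Cmod (psi t) < r) by (specialize (HR t Ht); unfold r; lra).
    induction m.
    - simpl. rewrite (entire_trem_0 f f' Hf Hf') by exact Hpr. f_equal. ring.
    - simpl. rewrite IHm, (entire_trem_step f f' Hf 0 r _ m Hpr).
      unfold co. rewrite (tcoef_radius f f' Hf Hf' 0 r 1) by (unfold r; lra). field. apply psi_neq_0. }
  destruct (pow_half_small (2 * M * K) _ Hne) as [N0 HN0].
  set (N := (N0 + n + 1)%nat). specialize (HN0 N ltac:(unfold N; lia)).
  rewrite (D_telescope N) in HN0. destruct (le_lt_dec N n) as [l|l]; [unfold N in l; lia|].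
  replace (D N + co n * per 1 - co n * per 1)%C with (D N) in HN0 by ring.
  assert (B : Cmod (D N) <= (1 - 0) * (2 * M * K * (1 / 2) ^ N)).
  { unfold D. apply CInt_norm; [lra| |].
    - intros t. apply continuous_Cmult; [apply continuous_rm|apply continuous_W].
    - intros t Ht. rewrite Cmod_mult, (Hrm t N Ht), W_pow, Cmod_mult, Cmod_pow.
      specialize (HR t Ht). specialize (HK t Ht).
      assert (Hpr : Cmod (psi t) < r) by (unfold r; lra).
      assert (T := entire_trem_bound f f' Hf 0 r (psi t) N M Hpr HM).
      assert (T2 : r / (r - Cmod (psi t)) <= 2) by (apply Rle_div_l; unfold r; lra).
      assert (Pr : 0 < / r) by (apply Rinv_0_lt_compat; unfold r; lra).
      assert (PN : 0 < (/ r) ^ N) by now apply pow_lt.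
      assert (Pp : 0 <= Cmod (psi t) ^ N) by (apply pow_le, Cmod_ge_0).
      assert (B3 : Cmod (psi t) ^ N * (/ r) ^ N <= (1 / 2) ^ N).
      { rewrite <- Rpow_mult_distr. apply pow_incr. split.
        - apply Rmult_le_pos; [apply Cmod_ge_0|lra].
        - apply Rle_div_l; unfold r; lra. }
      assert (T3 : Cmod (trem f 0 r (psi t) N) <= M * (/ r) ^ N * 2).
      { eapply Rle_trans; [exact T|]. apply Rmult_le_compat_l; nra. }
      apply Rle_trans with (M * (/ r) ^ N * 2 * (Cmod (psi t) ^ N * K)).
      + apply Rmult_le_compat; auto; [apply Cmod_ge_0| |].
        * apply Rmult_le_pos; [exact Pp|apply Cmod_ge_0].
        * now apply Rmult_le_compat_l.
      + replace (M * (/ r) ^ N * 2 * (Cmod (psi t) ^ N * K)) with (2 * M * K * (Cmod (psi t) ^ N * (/ r) ^ N)) by ring.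
        apply Rmult_le_compat_l; [nra|exact B3]. }
  lra.
Qed.
End Contour.

(** Near 0 the modulus of [f] stays below [exp ell], so the values [cexp (Phi u)] avoid a disc about
    0. *)
Lemma Re_Phi_lower : exists c0, forall u, H u -> c0 <= Re (Phi u).
Proof.
  assert (Hc : continuous f (RtoC 0)) by (eapply cder_continuous, Hf).
  destruct (proj1 (continuous_C_eps _ _) Hc (exp ell - Cmod (f 0)) ltac:(lra)) as [d [Hd K]].
  exists (ln d). intros u Hu. apply Rnot_lt_le. intros Hlt.
  assert (Hs : Cmod (cexp (Phi u) - 0) < d).
  { replace (cexp (Phi u) - 0)%C with (cexp (Phi u)) by ring. rewrite Cmod_cexp.
    rewrite <- (exp_ln d) by auto. now apply exp_increasing. }
  specialize (K _ Hs). rewrite EPhi in K by auto.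
  assert (K2 := exp_lt_Cmod_cexp u Hu). assert (K3 := Cmod_rev (cexp u) (f 0)). lra.
Qed.

(** Subtracting [c0 - 1] makes the real part at least 1, and Harnack's inequality [Hpick] bounds
    [Phi'] by [4 * u / (Re - ell)]. Since [Phi] must move by [2 pi i] over a segment of fixed
    length, [u] is large somewhere on it, and by Harnack everywhere on it: it grows linearly with
    [Re]. In [contour_coefficient] the factor of modulus [exp (- n * Re Phi)] then beats [exp x]. *)
Lemma no_period : False.
Proof.
  destruct Re_Phi_lower as [c0 Hc0]. assert (Hk := kap_pos). assert (HPI := PI_RGT_0).
  set (u := fun z => Re (Phi z) - (c0 - 1)).
  assert (Hu1 : forall z, H z -> 1 <= u z). { intros z Hz. specialize (Hc0 z Hz). unfold u. lra. }
  assert (Hpick : forall z, H z -> Cmod (Phi' z) <= 4 / (Re z - ell) * u z).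
  { intros z Hz. assert (Hd : 0 < Re z - ell) by (unfold H, halfplane in Hz; lra).
    assert (K := deriv_bound_of_Re_pos (fun w => (Phi w - RtoC (c0 - 1))%C) Phi' z (Re z - ell) ((Re z - ell) / 2) ltac:(lra)).
    cbv beta in K.
    assert (Ere : forall w, Re (Phi w - RtoC (c0 - 1)) = u w).
    { intros w. unfold u, Re, Cminus, Cplus, Copp, RtoC; simpl. ring. }
    rewrite Ere in K. replace (4 / (Re z - ell)) with (2 / ((Re z - ell) / 2)) by (field; lra).
    apply K.
    - intros w Hw. eapply cder_eq; [apply cder_minus; [apply DPhi; now apply (halfplane_disc ell z)|apply cder_const]|]. ring.
    - intros w Hw. apply CPhi'. now apply (halfplane_disc ell z).
    - intros w Hw. rewrite Ere. assert (Hw' := Hu1 w (halfplane_disc ell z w Hz Hw)). lra. }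
  (* A point with speed above [PI] has [u] at least [PI * d / (4 * kap) = 3 * sg * d]; the passage
     to other points of the segment costs the factor [exp 1 <= 3]. *)
  set (sg := PI / (12 * kap)). assert (Hsg : 0 < sg) by (apply Rdiv_lt_0_compat; lra).
  assert (Hgrow : forall x, 4 * kap <= x - ell -> forall t, 0 <= t <= 1 -> sg * (x - ell) <= u (line x t)).
  { intros x Hd t Ht. assert (Hx : ell < x) by lra. set (d := x - ell) in *.
    assert (Hex : exists ts, 0 <= ts <= 1 /\ PI < Cmod (Phi' (line x ts)) * kap).
    { apply NNPP. intros Hno.
      assert (K := curve_mean_value (fun t => Phi (line x t)) (fun t => (Phi' (line x t) * per k)%C) PI).
      cbv beta in K. rewrite line_ends, Hper in K by now apply line_H.
      replace (Phi (line x 0) + per 1 - Phi (line x 0))%C with (per 1) in K by ring.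
      rewrite Cmod_per, Rabs_pos_eq in K by lra.
      assert (K2 : 2 * PI * 1 <= PI); [|lra]. apply K.
      - intros s Hs. now apply rder_Phi_line.
      - intros s Hs. rewrite Cmod_mult. apply Rnot_lt_le. intros Hlt. apply Hno. now exists s. }
    destruct Hex as [ts [Hts Hbig]].
    assert (Hline := line_H x). 
    assert (Hus : 3 * sg * d <= u (line x ts)).
    { assert (K := Hpick _ (Hline ts Hx)). rewrite line_Re in K. fold d in K.
      assert (Hmul : PI < 4 / d * u (line x ts) * kap) by nra.
      replace (3 * sg * d) with (PI * d / (4 * kap)) by (unfold sg; field; lra).
      apply Rle_div_l; [lra|].
      assert (PI * d < 4 / d * u (line x ts) * kap * d) by (apply Rmult_lt_compat_r; lra).
      replace (4 / d * u (line x ts) * kap * d) with (u (line x ts) * (4 * kap)) in H0 by (field; lra). lra. }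
    (* The logarithm of [u] has derivative at most [4 * kap / d <= 1] along the segment, so it
       varies by at most 1. *)
    assert (Hv := bounded_variation (fun t => ln (u (line x t))) (fun t => Re (Phi' (line x t) * per k) / u (line x t)) 1 ts t).
    cbv beta in Hv.
    assert (Hv2 : Rabs (ln (u (line x t)) - ln (u (line x ts))) <= 1).
    { eapply Rle_trans; [apply Hv|].
      - intros s _. assert (Hus' := Hu1 _ (Hline s Hx)). split.
        + assert (Du : is_derive (fun t => u (line x t)) s (Re (Phi' (line x s) * per k))).
          { unfold u. assert (K := rder_Re _ _ _ (rder_Phi_line x s Hx)).
            replace (Re (Phi' (line x s) * per k)) with (minus (Re (Phi' (line x s) * per k)) 0) by (unfold minus, plus, opp; simpl; ring).
            apply (is_derive_minus (V := R_NormedModule) (fun t => Re (Phi (line x t))) (fun _ => c0 - 1)); auto.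
            apply (is_derive_const (V := R_NormedModule)). }
          replace (Re (Phi' (line x s) * per k) / u (line x s)) with (scal (Re (Phi' (line x s) * per k)) (/ u (line x s))) by reflexivity.
          apply (is_derive_comp (V := R_NormedModule) ln (fun t => u (line x t))); auto.
          apply is_derive_Reals, derivable_pt_lim_ln. lra.
        + unfold Rdiv. rewrite Rabs_mult, (Rabs_pos_eq (/ _)) by (left; apply Rinv_0_lt_compat; lra).
          apply Rle_div_l; [lra|]. rewrite Rmult_1_l.
          eapply Rle_trans; [apply Re_le_Cmod|]. rewrite Cmod_mult. fold kap.
          assert (K := Hpick _ (Hline s Hx)). rewrite line_Re in K. fold d in K.
          apply Rle_trans with (4 / d * u (line x s) * kap); [apply Rmult_le_compat_r; lra|].
          replace (4 / d * u (line x s) * kap) with (u (line x s) * (4 * kap) / d) by (field; lra).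
          apply Rle_div_l; [lra|]. apply Rmult_le_compat_l; lra.
      - rewrite Rmult_1_l. apply Rabs_le. lra. }
    apply Rabs_le_between in Hv2.
    assert (Hut := Hu1 _ (Hline t Hx)). assert (Hut' := Hu1 _ (Hline ts Hx)).
    assert (Hln : ln (u (line x ts)) <= 1 + ln (u (line x t))) by lra.
    assert (Hexp : u (line x ts) <= exp 1 * u (line x t)).
    { rewrite <- (exp_ln (u (line x ts))), <- (exp_ln (u (line x t))), <- exp_plus by lra.
      destruct Hln as [Hln| ->]; [left; now apply exp_increasing|lra]. }
    assert (E3 := exp_le_3). nra. }
  (* With [(n - 1) * sg >= 2] the product [(n - 1) * U] is at least [2 * d]: one [d] cancels the
     growth of [exp x], the other leaves the decay [exp (- d)]. One factor [exp U] is spent on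
     [Phi'], hence [n - 1]. *)
  destruct (archimed (2 / sg + 1)) as [A1 _].
  assert (A0 : 0 < 2 / sg) by (apply Rdiv_lt_0_compat; lra).
  destruct (transcendental_tcoef f f' Hf Hf' Htr (Z.to_nat (up (2 / sg + 1)))) as [n [Hn Hne]].
  assert (HnR : 2 / sg <= INR n - 1).
  { apply le_INR in Hn. rewrite INR_IZR_INZ, Z2Nat.id in Hn.
    - lra. - apply le_IZR. lra. }
  set (Q := exp ell * exp (INR n * (1 - c0))).
  assert (HQ : 0 < Q) by (apply Rmult_lt_0_compat; apply exp_pos).
  assert (Hco : forall d, 4 * kap <= d -> Cmod (tcoef f 0 1 n * per 1) <= Q * exp (- d)).
  { intros d Hd. set (x := ell + d). assert (Hx : ell < x) by (unfold x; lra).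
    assert (Exd : x - ell = d) by (unfold x; ring).
    rewrite <- (contour_coefficient x n Hx).
    replace (Q * exp (- d)) with ((1 - 0) * (Q * exp (- d))) by ring.
    assert (HC0 : forall t, continuous (fun t => (RtoC (- INR n) * Phi (line x t))%C) t).
    { intros t. apply continuous_Cmult; [apply continuous_const|now apply continuous_Phi_line]. }
    apply CInt_norm; [lra| |].
    - intros t. apply continuous_Cmult.
      + apply (continuous_comp (line x) cexp); [apply continuous_line|apply continuous_cexp].
      + apply continuous_Cmult.
        * apply (continuous_comp (fun t => (RtoC (- INR n) * Phi (line x t))%C) cexp); [auto|apply continuous_cexp].
        * apply continuous_Cmult; [now apply continuous_Phi'_line|apply continuous_const].
    - intros t Ht. rewrite !Cmod_mult, !Cmod_cexp, line_Re. fold kap.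
      assert (HuL := Hgrow x ltac:(lra) t Ht). rewrite Exd in HuL.
      assert (K := Hpick _ (line_H x t Hx)). rewrite line_Re, Exd in K.
      set (U := u (line x t)) in *.
      replace (Re (RtoC (- INR n) * Phi (line x t))) with (- INR n * (U + (c0 - 1))).
      2: { unfold U, u, Re, Cmult, RtoC; simpl. ring. }
      assert (HU1 : 1 <= U) by (apply Hu1, line_H; auto).
      assert (K2 : Cmod (Phi' (line x t)) * kap <= U).
      { apply Rle_trans with (4 / d * U * kap); [apply Rmult_le_compat_r; lra|].
        replace (4 / d * U * kap) with (U * (4 * kap) / d) by (field; lra).
        apply Rle_div_l; [lra|]. apply Rmult_le_compat_l; lra. }
      assert (K3 : U <= exp U) by (assert (B := exp_ineq1_le U); lra).
      apply Rle_trans with (exp x * (exp (- INR n * (U + (c0 - 1))) * exp U)).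
      + apply Rmult_le_compat_l; [left; apply exp_pos|]. apply Rmult_le_compat_l; [left; apply exp_pos|]. lra.
      + unfold Q. rewrite <- !exp_plus.
        assert (Hfin : x + (- INR n * (U + (c0 - 1)) + U) <= ell + INR n * (1 - c0) + - d).
        { assert ((INR n - 1) * U >= 2 * d).
          { assert (2 / sg * (sg * d) = 2 * d) by (field; lra).
            assert (2 / sg * (sg * d) <= (INR n - 1) * U).
            { apply Rmult_le_compat; [lra|nra|lra|lra]. } lra. }
          unfold x. nra. }
        destruct Hfin as [Hfin| ->]; [left; now apply exp_increasing|lra]. }
  assert (Hpos : 0 < Cmod (tcoef f 0 1 n * per 1)).
  { apply Cmod_gt_0, Cmult_neq_0; auto. apply Cmod_gt_0. rewrite Cmod_per, Rabs_pos_eq; lra. }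
  set (eps := Cmod (tcoef f 0 1 n * per 1)) in *.
  set (d := 4 * kap + Q / eps).
  assert (Hqe : 0 < Q / eps) by (apply Rdiv_lt_0_compat; lra).
  assert (K := Hco d ltac:(unfold d; lra)).
  rewrite exp_Ropp in K. assert (B := exp_ineq1_le d).
  assert (Hd : 0 < d) by (unfold d; lra).
  change (Q * / exp d) with (Q / exp d) in K. apply Rle_div_r in K; [|apply exp_pos].
  assert (Q / eps * eps = Q) by (field; lra). unfold d in *. nra.
Qed.
End Periodic.

(** * Omitted points and the derivative of a branch *)

Lemma PI_lt_4 : PI < 4.
Proof.
  destruct (Rle_lt_or_eq_dec _ _ PI_4) as [?|E]; auto. exfalso.
  assert (B := cos_PI2). rewrite E in B. replace (4 / 2) with 2 in B by field.
  assert (PB := PI2_3_2).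
  (* If [PI] were 4, then [cos 2] would be 0, whereas the Taylor bound gives
     [cos 2 <= 1 - 2 + 2 / 3]. *)
  assert (K := cos_bound 2 0). simpl in K. unfold cos_approx, cos_term in K. simpl in K.
  lra.
Qed.

(** The points tested are [b + pi i] and [b - pi i]; they lie in the disc because [PI < 4]. If both
    are values of [Phi], their arguments have the same exponential and differ by some [per k]. *)
Lemma branch_omits b : exists p, Cmod (p - b) < 4 /\ forall u, H u -> Phi u <> p.
Proof.
  apply NNPP. intros Hno.
  assert (Hsur : forall p, Cmod (p - b) < 4 -> exists u, H u /\ Phi u = p).
  { intros p Hp. apply NNPP. intros Hu. apply Hno. exists p. split; auto. intros u Hu1 Hu2. apply Hu. now exists u. }
  assert (HPI := PI_RGT_0).
  set (q := (RtoC (1 / 2) * per 1)%C).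
  assert (Hq : Cmod q < 4).
  { unfold q. rewrite Cmod_half, Cmod_per, Rabs_pos_eq by lra.
    assert (P := PI_lt_4). lra. }
  destruct (Hsur (b + q)%C) as [u1 [Hu1 E1]]; [rewrite Cmod_plus_cancel; exact Hq|].
  destruct (Hsur (b - q)%C) as [u2 [Hu2 E2]].
  { replace (b - q - b)%C with (- q)%C by ring. now rewrite Cmod_opp. }
  assert (E12 : Phi u1 = (Phi u2 + per 1)%C).
  { rewrite E1, E2. rewrite (half_split (per 1)). unfold q. ring. }
  destruct (cexp_inj u1 u2) as [k Hk].
  { rewrite <- (EPhi u1 Hu1), <- (EPhi u2 Hu2), E12. now rewrite cexp_per. }
  assert (Hshift : forall u, H u -> H (u + per k)%C).
  { intros u Hu. unfold H, halfplane. now rewrite Re_per. }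
  assert (CPhi : forall u, H u -> continuous Phi u) by (intros u Hu; eapply cder_continuous, DPhi, Hu).
  assert (Csh : forall u, H u -> continuous (fun u => Phi (u + per k)%C) u).
  { intros u Hu. apply (continuous_comp (fun u => (u + per k)%C) Phi).
    - apply continuous_Cplus; [apply continuous_id|apply continuous_const].
    - now apply CPhi, Hshift. }
  (* Both sides lift [cexp] through [f] and agree at [u2], so they agree throughout. The same
     argument one level up, through [cexp], then treats [Phi] itself. *)
  assert (Hpsi : forall u, H u -> cexp (Phi (u + per k)) = cexp (Phi u)).
  { intros u Hu.
    apply (lift_unique f f' cexp H Hf Hf' cexp_crit H (fun u => cexp (Phi (u + per k)%C)) (fun u => cexp (Phi u)) u2 u).
    - auto.
    - intros v Hv. split.
      + apply (continuous_comp (fun u => Phi (u + per k)%C) cexp); [now apply Csh|apply continuous_cexp].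
      + rewrite EPhi by now apply Hshift. apply cexp_per.
    - intros v Hv. split; [|now apply EPhi].
      apply (continuous_comp Phi cexp); [now apply CPhi|apply continuous_cexp].
    - intros t Ht. now apply halfplane_convex.
    - rewrite <- Hk, E12. apply cexp_per. }
  apply (no_period k). intros u Hu.
  apply (lift_unique cexp cexp (fun u => cexp (Phi u)) H cder_cexp continuous_cexp
    (fun v z _ _ => cexp_neq_0 z) H (fun u => Phi (u + per k)%C) (fun u => (Phi u + per 1)%C) u2 u).
  - auto.
  - intros v Hv. split; [now apply Csh|now apply Hpsi].
  - intros v Hv. split; [|apply cexp_per].
    apply continuous_Cplus; [now apply CPhi|apply continuous_const].
  - intros t Ht. now apply halfplane_convex.
  - rewrite <- Hk. exact E12.
Qed.

(** Bloch's disc has radius [(Re u - ell) * Cmod (Phi' u) / 128] and contains no disc of radius 4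
    about its centre; [512 = 4 * 128]. *)
Lemma branch_deriv_bound u : H u -> Cmod (Phi' u) <= 512 / (Re u - ell).
Proof.
  intros Hu. assert (Hd : 0 < Re u - ell) by (unfold H, halfplane in Hu; lra).
  destruct (bloch Phi Phi' u (Re u - ell) Hd) as [b Hb].
  - intros z Hz. apply DPhi. now apply (halfplane_disc ell u).
  - intros z Hz. apply CPhi'. now apply (halfplane_disc ell u).
  - destruct (branch_omits b) as [p [Hp Hpo]].
    apply Rle_div_r; [exact Hd|]. apply Rnot_lt_le. intros Hlt.
    destruct (Hb p) as [z [Hz1 Hz2]]; [lra|].
    apply (Hpo z); auto. now apply (halfplane_disc ell u).
Qed.

Lemma branch_lipschitz u v m : 0 < m -> ell + m <= Re u -> ell + m <= Re v ->
  Cmod (Phi v - Phi u) <= 512 / m * Cmod (v - u).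
Proof.
  intros Hm Hu Hv.
  assert (Hs : forall t, 0 <= t <= 1 -> ell + m <= Re (u + RtoC t * (v - u))).
  { intros t Ht. replace (Re (u + RtoC t * (v - u))) with (Re u + t * (Re v - Re u)).
    - nra.
    - unfold Re, Cplus, Cminus, Cmult, Copp, RtoC; simpl. ring. }
  apply (mean_value_segment Phi Phi').
  - intros t Ht. apply DPhi. specialize (Hs t Ht). unfold H, halfplane. lra.
  - intros t Ht. specialize (Hs t Ht).
    eapply Rle_trans; [apply branch_deriv_bound; unfold H, halfplane; lra|].
    apply Rmult_le_compat_l; [lra|]. apply Rinv_le_contravar; lra.
Qed.
End Branch.
End LogCoordinates.

(** * Functions of bounded type *)

Lemma Cnorm_Cmod (z : C) : Cnorm z = Cmod z.
Proof. unfold Cnorm, Cmod. f_equal. ring. Qed.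

Lemma has_cderiv_cder (f : C -> C) z l : has_cderiv f z l <-> cder f z l.
Proof.
  rewrite cder_eps. split; intros H e He.
  - destruct (H e He) as [d [Hd K]]. exists d. split; auto. intros w Hw.
    destruct (Ceq_dec w z) as [->|Hn].
    + replace (f z - f z - l * (z - z))%C with (RtoC 0) by ring. rewrite Cmod_0, Cmod_diag. lra.
    + apply Cminus_eq_contra, Cmod_gt_0 in Hn.
      specialize (K (w - z)%C). rewrite !Cnorm_Cmod in K.
      replace (Cadd z (w - z)%C) with w in K by (change (Cadd z (w - z)%C) with (z + (w - z))%C; ring).
      apply K. lra.
  - destruct (H e He) as [d [Hd K]]. exists d. split; auto. intros h Hh. rewrite !Cnorm_Cmod in *.
    specialize (K (z + h)%C). rewrite Cmod_plus_cancel in K.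
    replace (f (z + h)%C - f z - l * (z + h - z))%C with (f (z + h)%C - f z - l * h)%C in K by ring.
    apply K. lra.
Qed.

Lemma poly_eval_peval l z : poly_eval l z = peval l z.
Proof. induction l; simpl; [reflexivity|]. rewrite IHl. reflexivity. Qed.

Lemma escapes_to_asymptotic (f : C -> C) w : escapes_to f w -> asymptotic_value f w.
Proof.
  intros [gam [H1 [H2 H3]]]. exists gam. split; [|split].
  - intros t Ht e He. destruct (H1 t Ht e He) as [d [Hd K]]. exists d. split; auto.
    intros s Hs Hst. rewrite Cnorm_Cmod. now apply K.
  - intros M. destruct (H2 M) as [T HT]. exists T. intros t Ht. rewrite Cnorm_Cmod. now apply HT.
  - intros e He. destruct (H3 e He) as [T HT]. exists T. intros t Ht. rewrite Cnorm_Cmod. now apply HT.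
Qed.

(** The radius 12 leaves room for an error of 8 in [escaping_near] and for the choice of a logarithm,
    which moves a point by at most [PI < 4]. *)
Definition expanding (F : C -> C) (X : R) : Prop :=
  (forall om s, X <= Re om -> F (cexp s) = cexp om ->
     exists Phi : C -> C, Phi om = s /\
       (forall u, Cmod (u - om) <= 12 -> F (cexp (Phi u)) = cexp u) /\
       (forall u v, Cmod (u - om) <= 12 -> Cmod (v - om) <= 12 ->
          Cmod (Phi v - Phi u) <= 1 / 4 * Cmod (v - u))) /\
  (forall x, X <= x -> exists z, Cmod z = exp x /\ exp (2 * x) <= Cmod (F z)).

Lemma expanding_mono F X Y : X <= Y -> expanding F X -> expanding F Y.
Proof.
  intros HXY [H1 H2]. split.
  - intros om s Hom. apply H1. lra.
  - intros x Hx. apply H2. lra.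
Qed.

Lemma bounded_type_entire (F : C -> C) : bounded_type F -> exists F', (forall z, cder F z (F' z)) /\ (forall z, continuous F' z).
Proof.
  intros [[He _] _]. apply entire_C1. intros z. destruct (He z) as [l Hl]. exists l. now apply has_cderiv_cder.
Qed.

Lemma bounded_type_transcendental (F : C -> C) : bounded_type F -> ~ exists l, forall z, F z = peval l z.
Proof.
  intros [[_ Hp] _] [l Hl]. apply Hp. exists l. intros z. rewrite poly_eval_peval. apply Hl.
Qed.

Lemma bounded_type_expanding (F : C -> C) : bounded_type F -> exists X, 1 <= X /\ expanding F X.
Proof.
  intros HB. destruct (bounded_type_entire F HB) as [F' [HF HF']].
  assert (Htr := bounded_type_transcendental F HB).
  destruct HB as [_ [M HM]].
  (* Beyond this modulus there are no singular values, and [F 0] lies below it. *)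
  set (B := Rabs M + Cmod (F 0) + 1).
  assert (HM0 := Rabs_pos M). assert (HM1 := Rle_abs M). assert (HF0 := Cmod_ge_0 (F 0)).
  assert (HB : 0 < B) by (unfold B; lra).
  set (ell := ln B). assert (Eell : exp ell = B) by now apply exp_ln.
  assert (Hcrit : forall w, exp ell < Cmod w -> forall z, F z = w -> F' z <> RtoC 0).
  { intros w Hw z Ez E0. assert (K : Cnorm w <= M).
    { apply HM. left. left. exists z. split; auto. apply has_cderiv_cder.
      change C0 with (RtoC 0). rewrite <- E0. apply HF. }
    rewrite Cnorm_Cmod in K. rewrite Eell in Hw. unfold B in Hw. lra. }
  assert (Hasym : forall w, exp ell < Cmod w -> ~ escapes_to F w).
  { intros w Hw E. assert (K : Cnorm w <= M).
    { apply HM. left. right. now apply escapes_to_asymptotic. }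
    rewrite Cnorm_Cmod in K. rewrite Eell in Hw. unfold B in Hw. lra. }
  assert (H0 : Cmod (F 0) < exp ell) by (rewrite Eell; unfold B; lra).
  destruct (transcendental_growth F F' HF HF' Htr) as [r0 [Hr0 Hgr]].
  (* At distance 2048 from [ell] the derivative is at most [512 / 2048 = 1 / 4]; the remaining 12 is
     the radius of the disc about [om]. Beyond [ln r0] the growth estimate applies. *)
  set (X := Rmax 1 (Rmax (ell + 2060) (ln r0))).
  assert (X1 : 1 <= X) by apply Rmax_l.
  assert (X2 : ell + 2060 <= X) by (eapply Rle_trans; [apply Rmax_l|apply Rmax_r]).
  assert (X3 : ln r0 <= X) by (eapply Rle_trans; [apply Rmax_r|apply Rmax_r]).
  exists X. split; [exact X1|]. split.
  - intros om s Hom Es.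
    assert (Hom' : halfplane ell om) by (unfold halfplane; lra).
    destruct (log_branch_exists F F' ell HF HF' Hcrit Hasym H0 om s Hom' Es) as [Phi [Phi' [E1 E2]]].
    assert (Hre : forall u, Cmod (u - om) <= 12 -> ell + 2048 <= Re u).
    { intros u Hu. assert (K := Re_le_Cmod (u - om)). change (Re (u - om)) with (Re u - Re om) in K.
      assert (K2 : Rabs (Re u - Re om) <= 12) by lra. apply Rabs_le_between in K2. lra. }
    exists Phi. split; [exact E1|]. split.
    + intros u Hu. apply E2. unfold halfplane. specialize (Hre u Hu). lra.
    + intros u v Hu Hv. replace (1 / 4) with (512 / 2048) by field.
      apply (branch_lipschitz F F' ell HF HF' Htr Hcrit H0 Phi Phi' E2); auto. lra.
  - intros x Hx. destruct (Hgr (exp x)) as [z [Hz1 Hz2]].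
    + rewrite <- (exp_ln r0) by lra. destruct (Rle_lt_or_eq_dec (ln r0) x ltac:(lra)) as [Hlt| ->]; [left; now apply exp_increasing|lra].
    + exists z. split; auto. replace (2 * x) with (x + x) by ring. now rewrite exp_plus.
Qed.


(** * Construction of escaping points of the composition *)

Section Escape.
Variables (f g : C -> C) (X : R).
Hypothesis HX : 1 <= X.
Hypothesis Ef : expanding f X.
Hypothesis Eg : expanding g X.

(** [g] comes at even steps, so that two steps from an even index make one application of
    [f o g]. *)
Let Fn (n : nat) : C -> C := if Nat.even n then g else f.

Lemma expanding_Fn n : expanding (Fn n) X.
Proof. unfold Fn. now destruct (Nat.even n). Qed.

(** Take a point of large image on the circle of radius [exp (Re om)] and its logarithm vertically
    nearest to [om]: the real parts agree and the imaginary parts differ by at most [PI < 4]. Its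
    image has the logarithm [om'], and [Phi] is the branch that leads back. *)
Lemma branch_step n om : X <= Re om -> exists om' (Phi : C -> C),
  2 * Re om <= Re om' /\ Cmod (Phi om' - om) <= 4 /\
  (forall u, Cmod (u - om') <= 12 -> Fn n (cexp (Phi u)) = cexp u) /\
  (forall u v, Cmod (u - om') <= 12 -> Cmod (v - om') <= 12 -> Cmod (Phi v - Phi u) <= 1 / 4 * Cmod (v - u)).
Proof.
  intros Hom. destruct (expanding_Fn n) as [H1 H2].
  destruct (H2 (Re om) Hom) as [z [Hz1 Hz2]].
  assert (P1 := exp_pos (Re om)). assert (P2 := exp_pos (2 * Re om)).
  destruct (clog_near z (Im om)) as [s [Es Hs]]; [apply Cmod_gt_0; lra|].
  destruct (clog_exists (Fn n z)) as [om' Eo]; [apply Cmod_gt_0; lra|].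
  assert (Hre : Re s = Re om). { apply exp_inv. now rewrite <- Cmod_cexp, Es. }
  assert (Hre' : 2 * Re om <= Re om').
  { rewrite <- Eo, Cmod_cexp in Hz2. apply Rnot_lt_le. intros Hlt. apply exp_increasing in Hlt. lra. }
  destruct (H1 om' s) as [Phi [E1 [E2 E3]]]; [lra|now rewrite Es|].
  exists om', Phi. split; [exact Hre'|]. split; [|split; auto].
  rewrite E1. eapply Rle_trans; [apply Cmod_le_Re_Im|].
  change (Re (s - om)) with (Re s - Re om). change (Im (s - om)) with (Im s - Im om).
  rewrite Hre, Rminus_diag, Rabs_R0. assert (K := PI_lt_4). lra.
Qed.

(** A shadowing argument: the points [om n] form an orbit up to errors of 4, and contracting
    branches lead backwards. Pulling back from ever later levels converges to points [p n] that form
    an exact orbit at distance at most 8. *)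
Lemma escaping_near om0 : X <= Re om0 -> exists p, Cmod (p - om0) <= 8 /\ escaping (fun z => f (g z)) (cexp p).
Proof.
  intros H0.
  set (spec := fun n om (r : C * (C -> C)) => let (om', Phi) := r in
    2 * Re om <= Re om' /\ Cmod (Phi om' - om) <= 4 /\
    (forall u, Cmod (u - om') <= 12 -> Fn n (cexp (Phi u)) = cexp u) /\
    (forall u v, Cmod (u - om') <= 12 -> Cmod (v - om') <= 12 -> Cmod (Phi v - Phi u) <= 1 / 4 * Cmod (v - u))).
  set (ch := fun n om => epsilon (inhabits (RtoC 0, fun z : C => z)) (spec n om)).
  assert (Hch : forall n om, X <= Re om -> spec n om (ch n om)).
  { intros n om Hom. unfold ch. apply epsilon_spec.
    destruct (branch_step n om Hom) as [om' [Phi K]]. exists (om', Phi). exact K. }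
  set (om := fix om n := match n with O => om0 | S m => fst (ch m (om m)) end).
  set (Phi := fun n => snd (ch n (om n))).
  assert (Hom : forall n, X <= Re (om n)).
  { induction n; [exact H0|]. assert (K := Hch n (om n) IHn). simpl. destruct (ch n (om n)) as [o P]. simpl. destruct K as [K _]. lra. }
  assert (Hst : forall n, 2 * Re (om n) <= Re (om (S n)) /\ Cmod (Phi n (om (S n)) - om n) <= 4 /\
    (forall u, Cmod (u - om (S n)) <= 12 -> Fn n (cexp (Phi n u)) = cexp u) /\
    (forall u v, Cmod (u - om (S n)) <= 12 -> Cmod (v - om (S n)) <= 12 -> Cmod (Phi n v - Phi n u) <= 1 / 4 * Cmod (v - u))).
  { intros n. assert (K := Hch n (om n) (Hom n)). unfold Phi. simpl. destruct (ch n (om n)) as [o P]. exact K. }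
  assert (Hgrow : forall n, INR n <= Re (om n)).
  { induction n; [simpl; assert (K := Hom 0%nat); simpl in K; lra|].
    rewrite S_INR. destruct (Hst n) as [K _]. assert (K2 := Hom n). lra. }
  (* [q j n] is [om (n + j)] pulled back through [j] branches to level [n]. *)
  set (q := fix q j n := match j with O => om n | S j' => Phi n (q j' (S n)) end).
  (* The induction closes because [4 + 7 / 4 <= 7], and 7 is within the radius 12 of the
     branches. *)
  assert (Hq : forall j n, Cmod (q j n - om n) <= 7).
  { induction j; intros n; simpl; [rewrite Cmod_diag; lra|].
    destruct (Hst n) as [_ [K1 [_ K2]]]. specialize (IHj (S n)).
    assert (K3 := K2 (om (S n)) (q j (S n)) ltac:(rewrite Cmod_diag; lra) ltac:(lra)).
    assert (T := Cmod_tri (Phi n (q j (S n))) (Phi n (om (S n))) (om n)). lra. }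
  assert (Hqc : forall j n, Cmod (q (S j) n - q j n) <= 7 * (1 / 2) ^ j).
  { induction j; intros n.
    - assert (K := Hq 1%nat n). simpl in *. lra.
    - destruct (Hst n) as [_ [_ [_ K2]]]. specialize (IHj (S n)).
      change (q (S (S j)) n) with (Phi n (q (S j) (S n))). change (q (S j) n) with (Phi n (q j (S n))).
      assert (A1 := Hq j (S n)). assert (A2 := Hq (S j) (S n)).
      eapply Rle_trans; [apply K2; lra|]. assert (Q := pow_half_pos j). simpl pow. lra. }
  assert (Hlim : forall n, exists p, forall j, Cmod (q j n - p) <= 2 * 7 * (1 / 2) ^ j).
  { intros n. apply (geometric_limit (fun j => q j n) 7). intros j. apply Hqc. }
  set (p := fun n => epsilon (inhabits (RtoC 0)) (fun p => forall j, Cmod (q j n - p) <= 2 * 7 * (1 / 2) ^ j)).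
  assert (Hp : forall n j, Cmod (q j n - p n) <= 2 * 7 * (1 / 2) ^ j).
  { intros n. unfold p. exact (epsilon_spec (inhabits (RtoC 0)) _ (Hlim n)). }
  (* At [j = 4] the tail is [14 / 16], and [7 + 7 / 8 < 8]. *)
  assert (Hpo : forall n, Cmod (p n - om n) <= 8).
  { intros n. assert (K := Hp n 4%nat). assert (K2 := Hq 4%nat n). rewrite Cmod_sym in K.
    assert (T := Cmod_tri (p n) (q 4%nat n) (om n)). replace (2 * 7 * (1 / 2) ^ 4) with (7 / 8) in K by (simpl; field). lra. }
  assert (Hfix : forall n, p n = Phi n (p (S n))).
  { intros n. apply NNPP. intros Hne. apply Cminus_eq_contra, Cmod_gt_0 in Hne.
    destruct (pow_half_small 14 _ Hne) as [j Hj]. specialize (Hj j ltac:(lia)).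
    assert (K1 := Hp n (S j)). assert (K2 := Hp (S n) j). destruct (Hst n) as [_ [_ [_ K3]]].
    assert (A1 := Hq j (S n)). assert (A2 := Hpo (S n)).
    specialize (K3 (p (S n)) (q j (S n)) ltac:(lra) ltac:(lra)).
    change (q (S j) n) with (Phi n (q j (S n))) in K1.
    assert (T := Cmod_tri (p n) (Phi n (q j (S n))) (Phi n (p (S n)))). rewrite (Cmod_sym (p n) (Phi n (q j (S n)))) in T.
    simpl pow in K1. assert (Q := pow_half_pos j). lra. }
  assert (HF : forall n, Fn n (cexp (p n)) = cexp (p (S n))).
  { intros n. rewrite (Hfix n). destruct (Hst n) as [_ [_ [K _]]]. apply K. assert (A := Hpo (S n)). lra. }
  assert (Hit : forall m, iterate (fun z => f (g z)) m (cexp (p 0%nat)) = cexp (p (2 * m)%nat)).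
  { induction m; [reflexivity|].
    change (iterate (fun z => f (g z)) (S m) (cexp (p 0%nat))) with (f (g (iterate (fun z => f (g z)) m (cexp (p 0%nat))))).
    rewrite IHm. assert (K1 := HF (2 * m)%nat). assert (K2 := HF (S (2 * m))%nat).
    assert (Ev : Nat.even (2 * m) = true) by now rewrite Nat.even_mul.
    unfold Fn in K1, K2. rewrite Nat.even_succ, <- Nat.negb_even, Ev in K2. rewrite Ev in K1. cbv beta iota delta [negb] in K2.
    rewrite K1, K2. do 2 f_equal. lia. }
  exists (p 0%nat). split; [exact (Hpo 0%nat)|].
  intros M. destruct (INR_unbounded (M + 8)) as [N HN]. exists N. intros n Hn.
  rewrite Hit, Cnorm_Cmod, Cmod_cexp.
  assert (K1 := Hpo (2 * n)%nat). assert (K2 := Hgrow (2 * n)%nat).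
  assert (K3 := Re_le_Cmod (p (2 * n)%nat - om (2 * n)%nat)).
  change (Re (p (2 * n)%nat - om (2 * n)%nat)) with (Re (p (2 * n)%nat) - Re (om (2 * n)%nat)) in K3.
  assert (K4 : Rabs (Re (p (2 * n)%nat) - Re (om (2 * n)%nat)) <= 8) by lra. apply Rabs_le_between in K4.
  assert (K5 : INR N <= INR (2 * n)) by (apply le_INR; lia).
  assert (K6 := exp_ineq1_le (Re (p (2 * n)%nat))). lra.
Qed.

(** Here the branches follow a true orbit: the one at level [n] sends [s (S n)] exactly to [s n], so
    errors only contract. Of the factor 1/4, 1/2 is used. *)
Lemma pullback_along_orbit (s : nat -> C) (n0 : nat) :
  (forall n, (n0 <= n)%nat -> X <= Re (s n) /\ f (cexp (s n)) = cexp (s (S n))) ->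
  forall j u r, 0 <= r <= 12 -> Cmod (u - s (n0 + j)%nat) <= r ->
  exists v, Cmod (v - s n0) <= r * (1 / 2) ^ j /\ iterate f j (cexp v) = cexp u.
Proof.
  intros Hs. induction j; intros u r Hr Hu.
  - exists u. rewrite Nat.add_0_r in Hu. simpl. split; [lra|reflexivity].
  - rewrite Nat.add_succ_r in Hu.
    destruct (Hs (n0 + j)%nat ltac:(lia)) as [_ E]. destruct (Hs (S (n0 + j)) ltac:(lia)) as [Hre _].
    destruct Ef as [H1 _]. destruct (H1 _ _ Hre E) as [Phi [E1 [E2 E3]]].
    assert (K := E3 (s (S (n0 + j))) u ltac:(rewrite Cmod_diag; lra) ltac:(lra)). rewrite E1 in K.
    destruct (IHj (Phi u) (r / 2)) as [v [Hv1 Hv2]]; [lra|lra|].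
    exists v. split; [simpl; lra|].
    change (iterate f (S j) (cexp v)) with (f (iterate f j (cexp v))). rewrite Hv2. apply E2. lra.
Qed.
End Escape.

(** * Commuting functions *)

Section Commuting.
Variables f g : C -> C.
Hypothesis Bf : bounded_type f.
Hypothesis Bg : bounded_type g.
Hypothesis Hcomm : forall z, f (g z) = g (f z).

Let h z := f (g z).

Lemma iterate_comm n z : iterate h n (f z) = f (iterate h n z).
Proof.
  induction n; [reflexivity|].
  change (h (iterate h n (f z)) = f (h (iterate h n z))). rewrite IHn. unfold h. f_equal. symmetry. apply Hcomm.
Qed.

(** [f] is bounded on bounded sets, so [f] of an iterate of [h] can be large only if the iterate is.
    Commutation identifies this with the orbit of [f z]. *)
Lemma escaping_of_image z : escaping h (f z) -> escaping h z.
Proof.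
  intros H M. destruct (bounded_type_entire f Bf) as [f' [Hf _]].
  destruct (bounded_on_disc f (Rabs M + 1)) as [B HB].
  { intros w. eapply cder_continuous, Hf. }
  destruct (H B) as [N HN]. exists N. intros n Hn. specialize (HN n Hn).
  rewrite iterate_comm, Cnorm_Cmod in HN. rewrite Cnorm_Cmod.
  apply Rnot_le_gt. intros Hle. assert (Q := Rle_abs M). specialize (HB (iterate h n z) ltac:(lra)). lra.
Qed.

Lemma escaping_of_iterate j z : escaping h (iterate f j z) -> escaping h z.
Proof. induction j; [auto|]. intros H. apply IHj, escaping_of_image, H. Qed.

Lemma closure_of_image z : Cclosure (escaping h) (f z) -> Cclosure (escaping h) z.
Proof.
  intros H e He. destruct (bounded_type_entire f Bf) as [f' [Hf Hf']].
  destruct (open_mapping f f' Hf Hf' (bounded_type_transcendental f Bf) z e He) as [d [Hd Hop]].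
  destruct (H d Hd) as [w [Hw1 Hw2]]. rewrite Cnorm_Cmod in Hw2.
  destruct (Hop w Hw2) as [v [Hv1 Hv2]]. exists v. split.
  - apply escaping_of_image. now rewrite Hv2.
  - rewrite Cnorm_Cmod. exact Hv1.
Qed.

Lemma closure_of_iterate j z : Cclosure (escaping h) (iterate f j z) -> Cclosure (escaping h) z.
Proof. induction j; [auto|]. intros H. apply IHj, closure_of_image, H. Qed.

(** Far along the orbit of [z0] there is a point of I(h) within 8 in logarithmic coordinates. Pulled
    back by [j] branches it comes within [8 * (1 / 2) ^ j] of level [N], and it still escapes under
    [h] because its [j]-th image under [f] does. *)
Lemma escaping_subset_closure z0 : escaping f z0 -> Cclosure (escaping h) z0.
Proof.
  intros Hz0.
  destruct (bounded_type_expanding f Bf) as [Xf [Xf1 Ef]]. destruct (bounded_type_expanding g Bg) as [Xg [Xg1 Eg]].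
  set (X := Rmax Xf Xg). assert (HX1 : Xf <= X) by apply Rmax_l. assert (HX2 : Xg <= X) by apply Rmax_r.
  apply (expanding_mono _ _ _ HX1) in Ef. apply (expanding_mono _ _ _ HX2) in Eg.
  destruct (Hz0 (exp X)) as [N HN].
  (* Before [N] an iterate might be 0 and have no logarithm; only the values from [N] on are
     used. *)
  set (s := fun n => epsilon (inhabits (RtoC 0)) (fun s => cexp s = iterate f n z0)).
  assert (Hs : forall n, (N <= n)%nat -> cexp (s n) = iterate f n z0).
  { intros n Hn. unfold s. apply (epsilon_spec (inhabits (RtoC 0))). apply clog_exists, Cmod_gt_0.
    specialize (HN n Hn). rewrite Cnorm_Cmod in HN. assert (P := exp_pos X). lra. }
  assert (Hre : forall n, (N <= n)%nat -> X <= Re (s n)).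
  { intros n Hn. specialize (HN n Hn). rewrite Cnorm_Cmod, <- (Hs n Hn), Cmod_cexp in HN.
    apply Rnot_lt_le. intros Hlt. apply exp_increasing in Hlt. lra. }
  apply (closure_of_iterate N). rewrite <- (Hs N) by lia. intros e He.
  destruct (proj1 (continuous_C_eps _ _) (continuous_cexp (s N)) e He) as [d [Hd Hc]].
  destruct (pow_half_small 8 d Hd) as [j Hj]. specialize (Hj j ltac:(lia)).
  destruct (escaping_near f g X ltac:(lra) Ef Eg (s (N + j)%nat)) as [p [Hp1 Hp2]]; [apply Hre; lia|].
  destruct (pullback_along_orbit f X Ef s N) with (j := j) (u := p) (r := 8) as [v [Hv1 Hv2]]; [|lra|exact Hp1|].
  { intros n Hn. split; [now apply Hre|]. rewrite (Hs n Hn), (Hs (S n)) by lia. reflexivity. }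
  exists (cexp v). split.
  - apply (escaping_of_iterate j). now rewrite Hv2.
  - rewrite Cnorm_Cmod. apply Hc. lra.
Qed.
End Commuting.

Lemma Cclosure_closure (E F : C -> Prop) w : (forall z, E z -> Cclosure F z) -> Cclosure E w -> Cclosure F w.
Proof.
  intros H Hw e He. destruct (Hw (e / 2) ltac:(lra)) as [z [Hz1 Hz2]].
  destruct (H z Hz1 (e / 2) ltac:(lra)) as [y [Hy1 Hy2]]. exists y. split; auto.
  rewrite Cnorm_Cmod in *. assert (T := Cmod_tri y z w).
  change (Csub y z) with (y - z)%C in Hy2. change (Csub z w) with (z - w)%C in Hz2. change (Csub y w) with (y - w)%C. lra.
Qed.

(** Exchanging [f] and [g] in the final step yields points escaping under [g o f], which equals
    [f o g] only pointwise. *)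
Lemma escaping_ext (h k : C -> C) z : (forall z, h z = k z) -> escaping h z -> escaping k z.
Proof.
  intros E H M. destruct (H M) as [N HN]. exists N. intros n Hn.
  replace (iterate k n z) with (iterate h n z); auto.
  clear - E. unfold iterate. induction n; simpl; [reflexivity|]. now rewrite IHn, E.
Qed.

Theorem theorem5 (f g : CC -> CC) :
  bounded_type f -> bounded_type g ->
  (forall z, f (g z) = g (f z)) ->
  forall w, (Cclosure (escaping f) w \/ Cclosure (escaping g) w) ->
    Cclosure (escaping (fun z => f (g z))) w.
Proof.
  intros Bf Bg Hc w [Hw|Hw].
  - revert Hw. apply Cclosure_closure. intros z Hz. now apply escaping_subset_closure.
  - revert Hw. apply Cclosure_closure. intros z Hz e He.
    destruct (escaping_subset_closure g f Bg Bf (fun z => eq_sym (Hc z)) z Hz e He) as [y [Hy1 Hy2]].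
    exists y. split; auto. revert Hy1. apply escaping_ext. intros v. symmetry. apply Hc.
Qed.
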